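(* Let $D$ be a Prüfer domain and let $X\subseteq\mathrm{Max}(D)$ be a discrete splitting set of $D$. For every ordinal number $\beta$, let $Y_\beta:=\mathrm{Crit}_X^\beta(D)\setminus\mathrm{Crit}_X^{\beta+1}(D)$. Then the following hold. (a) For every ordinal $\gamma$, there is an exact sequence of groups $$0\longrightarrow\bigoplus_{\beta<\gamma}\mathcal C_c(Y_\beta,\mathbb Z)\longrightarrow\mathrm{Inv}_X(D)\longrightarrow\mathrm{Inv}_{XT_\gamma}(T_\gamma)\longrightarrow 0.$$ (b) If $\gamma$ is the SP-rank of $D$ with respect to $X$, then $\mathrm{Inv}_X(D)\simeq\bigoplus_{\beta<\gamma}\mathcal C_c(Y_\beta,\mathbb Z)$. (c) $\mathrm{Inv}_X(D)$ is a free abelian group.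
   Context: $\mathrm{Inv}(D)$ is the group of invertible fractional ideals of $D$. For $X\subseteq\mathrm{Spec}(D)$, $X^\uparrow:=\{P\in\mathrm{Spec}(D)\mid Q\subseteq P\text{ for some }Q\in X\}$. The inverse topology on $\mathrm{Spec}(D)$ is the topology having as a subbasis of open sets the sets $\mathcal V(I)=\{P\in\mathrm{Spec}(D)\mid I\subseteq P\}$, for $I$ a finitely generated ideal. $X$ is a splitting set if $X=X^\uparrow$ and $X$ is open in the inverse topology (equivalently, $X=X^\uparrow$ and $\mathrm{Spec}(D)\setminus X$ is quasi-compact in the Zariski topology); it is discrete if $P\neq P^2$ for every $P\in X$. The support of a fractional ideal $I$ is $\mathrm{supp}(I):=\{P\in\mathrm{Spec}(D)\mid ID_P\neq D_P\}$, and $\mathrm{Inv}_X(D):=\{I\in\mathrm{Inv}(D)\mid\mathrm{supp}(I)\subseteq X\}$. A maximal ideal $M\in X$ is critical with respect to $X$ if there is no radical (integral) ideal $I\in\mathrm{Inv}_X(D)$ with $I\subseteq M$; $\mathrm{Crit}_X(D)$ is the set of such $M$. The same definitions are used for overrings of $D$ in place of $D$. For an overring $T$ of $D$ (a ring between $D$ and its quotient field), $XT:=\{PT\mid P\in X,\ PT\neq T\}$. Define recursively, for ordinals $\alpha$: $\mathrm{Crit}_X^0(D):=X$; if $\alpha=\gamma+1$, $\mathrm{Crit}_X^\alpha(D):=\{P\in X\mid PT_\gamma\in\mathrm{Crit}_{XT_\gamma}(T_\gamma)\}$; if $\alpha$ is a limit ordinal, $\mathrm{Crit}_X^\alpha(D):=\bigcap_{\gamma<\alpha}\mathrm{Crit}_X^\gamma(D)$;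 and for every $\alpha$, $T_\alpha:=\bigcap\{D_P\mid P\in\mathrm{Crit}_X^\alpha(D)\cup(\mathrm{Spec}(D)\setminus X)\}$. The SP-rank of $D$ with respect to $X$ is the minimal ordinal $\alpha$ such that $\mathrm{Crit}_X^\alpha(D)=\emptyset$ (such an ordinal exists). For a topological space $Y$, $\mathcal C_c(Y,\mathbb Z)$ is the group of continuous functions $f\colon Y\to\mathbb Z$ ($\mathbb Z$ discrete) with compact support, the support being the closure of $f^{-1}(\mathbb Z\setminus\{0\})$. Subsets of $X$ carry the (subspace) inverse topology. *)

(* Defs.v *)
From HB Require Import structures.
From mathcomp Require Import all_boot all_order all_algebra.
From mathcomp Require Import all_classical topology.

Set Implicit Arguments.
Unset Strict Implicit.
Unset Printing Implicit Defensive.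

Import Order.TTheory GRing.Theory.
Local Open Scope classical_set_scope.
Local Open Scope ring_scope.

(* All rings are subrings of a fixed field K, all (fractional) ideals are
   subsets of K; an overring of D is a subring of K = Frac(D) containing D. *)

Section Modules.
Variable K : fieldType.
Implicit Types (A : subringClosed K) (I J L : set K).

Definition is_quotient_field A :=
  forall x : K, exists a b, [/\ a \in A, b \in A, b != 0 & x = a / b].

Definition submod A I :=
  [/\ I 0, forall x y, I x -> I y -> I (x + y)
    & forall a x, a \in A -> I x -> I (a * x)].

Definition fractional_ideal A I :=
  submod A I /\ exists d, [/\ d \in A, d != 0 & forall x, I x -> d * x \in A].

Definition ideal A I := submod A I /\ I `<=` [set` A].

Definition prime_ideal A I :=
  [/\ ideal A I, ~ I 1
    & forall x y, x \in A -> y \in A -> I (x * y) -> I x \/ I y].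

Definition maximal_ideal A I :=
  [/\ ideal A I, I <> [set` A]
    & forall J, ideal A J -> J <> [set` A] -> I `<=` J -> J = I].

Definition radical_ideal A I :=
  ideal A I /\ forall x n, x \in A -> I (x ^+ n) -> I x.

Definition span A (s : seq K) : set K :=
  [set x | exists2 c : nat -> K, forall i, c i \in A
                               & x = \sum_(i < size s) c i * s`_i].

Definition fg_ideal A I := exists2 s : seq K, {subset s <= A} & I = span A s.

Definition idmul I J : set K :=
  [set x | exists2 s : seq (K * K), forall p, p \in s -> I p.1 /\ J p.2
                                  & x = \sum_(p <- s) p.1 * p.2].

Definition invertible A I :=
  fractional_ideal A I /\
  exists2 J, fractional_ideal A J & idmul I J = [set` A].

(* Being an integral domain is automatic for a subring of a field. *)
Definition prufer A :=
  forall I, fg_ideal A I -> I <> [set 0] -> invertible A I.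

Lemma idmul_prod I J x y : I x -> J y -> idmul I J (x * y).
Proof.
move=> Ix Jy; exists [:: (x, y)]; last by rewrite big_seq1.
by move=> p; rewrite inE => /eqP ->.
Qed.

Lemma idmul0 I J : idmul I J 0.
Proof. by exists [::]; rewrite ?big_nil. Qed.

Lemma idmulD I J x y : idmul I J x -> idmul I J y -> idmul I J (x + y).
Proof.
move=> [s hs ->] [t ht ->]; exists (s ++ t); last by rewrite big_cat.
by move=> p; rewrite mem_cat => /orP[/hs|/ht].
Qed.

Lemma idmul_sub I J (S : set K) : S 0 ->
  (forall x y, S x -> S y -> S (x + y)) ->
  (forall x y, I x -> J y -> S (x * y)) -> idmul I J `<=` S.
Proof.
move=> S0 SD SM x [s hs ->]; rewrite big_seq.
apply: (big_ind S) => // p /hs[Ip Jp]; exact: SM.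
Qed.

Lemma idmulC I J : idmul I J = idmul J I.
Proof.
have sub I' J' : idmul I' J' `<=` idmul J' I'.
  apply: idmul_sub; [exact: idmul0|exact: idmulD|].
  by move=> x y Ix Jy; rewrite mulrC; exact: idmul_prod.
by apply/seteqP; split; exact: sub.
Qed.

Lemma idmulA I J L : idmul I (idmul J L) = idmul (idmul I J) L.
Proof.
have sub I' J' L' : idmul (idmul I' J') L' `<=` idmul I' (idmul J' L').
  apply: idmul_sub; [exact: idmul0|exact: idmulD|move=> x y IJx Ly].
  suff /(_ x IJx) : idmul I' J' `<=` [set z | idmul I' (idmul J' L') (z * y)].
    by [].
  apply: idmul_sub => /=.
  - by rewrite mul0r; exact: idmul0.
  - by move=> u v hu hv; rewrite mulrDl; exact: idmulD.
  - by move=> u v Iu Jv; rewrite -mulrA; do 2![apply: idmul_prod => //].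
apply/seteqP; split; last exact: sub.
by rewrite idmulC (idmulC (idmul I J)) (idmulC I) (idmulC J); exact: sub.
Qed.

Lemma idmul1 A I : submod A I -> idmul [set` A] I = I.
Proof.
move=> [I0 ID IM]; apply/seteqP; split.
  by apply: idmul_sub => // x y /=; exact: IM.
by move=> x Ix; rewrite -[x]mul1r; apply: idmul_prod => //=; exact: rpred1.
Qed.

Lemma submod1 A : submod A [set` A].
Proof.
split=> /= [|x y|a x]; [exact: rpred0|exact: rpredD|exact: rpredM].
Qed.

Lemma fractional1 A : fractional_ideal A [set` A].
Proof.
split; first exact: submod1.
by exists 1; split=> [||x]; rewrite ?rpred1 ?oner_eq0 ?mul1r.
Qed.

Lemma fractionalM A I J : fractional_ideal A I -> fractional_ideal A J ->
  fractional_ideal A (idmul I J).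
Proof.
move=> [[I0 ID IM] [d [Ad d0 hd]]] [[J0 JD JM] [e [Ae e0 he]]]; split.
  split; [exact: idmul0|exact: idmulD|move=> a x Aa IJx].
  suff /(_ x IJx) : idmul I J `<=` [set z | idmul I J (a * z)] by [].
  apply: idmul_sub => /=.
  - by rewrite mulr0; exact: idmul0.
  - by move=> u v hu hv; rewrite mulrDr; exact: idmulD.
  - by move=> u v Iu Jv; rewrite mulrA; apply: idmul_prod => //; exact: IM.
exists (d * e); split; [exact: rpredM|by rewrite mulf_neq0|].
apply: idmul_sub => [|x y|x y Ix Jy].
- by rewrite mulr0 rpred0.
- by rewrite mulrDr; exact: rpredD.
- by rewrite mulrACA rpredM ?hd ?he.
Qed.

Lemma invertible1 A : invertible A [set` A].
Proof.
split; first exact: fractional1.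
by exists [set` A]; [exact: fractional1|exact/idmul1/submod1].
Qed.

Lemma invertibleM A I J :
  invertible A I -> invertible A J -> invertible A (idmul I J).
Proof.
move=> [fI [I' fI' eI]] [fJ [J' fJ' eJ]]; split; first exact: fractionalM.
exists (idmul I' J'); first exact: fractionalM.
rewrite (idmulC I') idmulA -(idmulA I) eJ (idmulC I) idmul1 //.
by case: fI.
Qed.

End Modules.

Section Spectrum.
Variables (K : fieldType) (A : subringClosed K).

Record Spec := MkSpec {
  spec_val :> set K;
  spec_valP : `[< prime_ideal A spec_val >] }.

HB.instance Definition _ := [isSub for spec_val].
HB.instance Definition _ := gen_eqMixin Spec.
HB.instance Definition _ := gen_choiceMixin Spec.

Lemma spec_prime (P : Spec) : prime_ideal A P.
Proof. exact/asboolP/spec_valP. Qed.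

(* The canonical topology on Spec is the inverse topology. *)
HB.instance Definition _ := isSubBaseTopological.Build Spec
  (fg_ideal A) (fun I : set K => [set P : Spec | I `<=` P]).

Definition localization (P : Spec) : set K :=
  [set x | exists a b, [/\ a \in A, b \in A, ~ spec_val P b & x = a / b]].

Definition Max : set Spec := [set P | maximal_ideal A P].

Definition upset (X : set Spec) : set Spec :=
  [set P : Spec | exists2 Q : Spec, X Q & Q `<=` P].

Definition splitting_set (X : set Spec) := X = upset X /\ open X.

Definition discrete_set (X : set Spec) :=
  forall P : Spec, X P -> P <> idmul P P :> set K.

Definition supp (I : set K) : set Spec :=
  [set P | idmul I (localization P) <> localization P].

Definition in_InvX (X : set Spec) (I : set K) := invertible A I /\ supp I `<=` X.

Definition CritX (X : set Spec) : set Spec :=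
  [set M | [/\ Max M, X M
    & ~ exists I, [/\ radical_ideal A I, in_InvX X I & I `<=` M]]].

Lemma localization_nz (P : Spec) b : ~ spec_val P b -> b != 0.
Proof.
by case: (spec_prime P) => -[[P0 _ _] _] _ _ Pb; apply/eqP => b0; rewrite b0 in Pb.
Qed.

Lemma localizationP (P : Spec) :
  [/\ localization P 1,
      forall x y, localization P x -> localization P y -> localization P (x - y)
    & forall x y, localization P x -> localization P y -> localization P (x * y)].
Proof.
have [_ P1 PM] := spec_prime P; split.
- by exists 1, 1; rewrite rpred1 divr1.
- move=> _ _ [a [b [Aa Ab Pb ->]]] [c [d [Ac Ad Pd ->]]].
  exists (a * d - c * b), (b * d); split; rewrite ?(rpredB, rpredM) //.
    by move=> /PM[].
  by rewrite -[- (c / d)]mulNr addf_div ?mulNr //; exact: (@localization_nz P).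
- move=> _ _ [a [b [Aa Ab Pb ->]]] [c [d [Ac Ad Pd ->]]].
  exists (a * c), (b * d); split; rewrite ?rpredM //; first by move=> /PM[].
  by rewrite mulf_div.
Qed.

Lemma idmul_localization (P : Spec) :
  idmul [set` A] (localization P) = localization P.
Proof.
have [l1 lB lM] := localizationP P.
have l0 : localization P 0 by rewrite -(subrr 1); exact: lB.
apply: idmul1; split=> // [x y lx ly|a x Aa lx].
  by rewrite -[y]opprK; apply: (lB) => //; rewrite -[- y]sub0r; exact: (lB).
apply: (lM) => //; exists a, 1; rewrite rpred1 divr1; split=> //.
by case: (spec_prime P).
Qed.

Lemma supp_out I P : ~ supp I P -> idmul I (localization P) = localization P.
Proof. exact: contrapT. Qed.

Lemma in_InvX1 X : in_InvX X [set` A].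
Proof.
by split; [exact: invertible1|move=> P []; exact: idmul_localization].
Qed.

Lemma in_InvXM X I J : in_InvX X I -> in_InvX X J -> in_InvX X (idmul I J).
Proof.
move=> [iI sI] [iJ sJ]; split; first exact: invertibleM.
move=> P; apply: contraPP => XP; apply.
by rewrite -idmulA (supp_out (I := J)) ?(supp_out (I := I)) //; [move/sI|move/sJ].
Qed.

Lemma in_InvXV X I : in_InvX X I ->
  exists2 J, in_InvX X J & idmul J I = [set` A].
Proof.
move=> [[fI [J fJ IJ]] sI]; exists J; last by rewrite idmulC.
split; first by split=> //; exists I; rewrite // idmulC.
move=> P; apply: contraPP => XP; apply.
rewrite -{1}(supp_out (I := I) (P := P)) ?idmulA; last by move/sI.
by rewrite (idmulC J) IJ idmul_localization.
Qed.

End Spectrum.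
Arguments Max {K} A _.

(* Inv_X(A) with ideal multiplication, written additively: the sum of I and J
   is the product ideal IJ and the zero element is A. *)
Section InvX.
Variables (K : fieldType) (A : subringClosed K) (X : set (Spec A)).

Record InvX := MkInvX {
  invx_val :> set K;
  invx_valP : `[< in_InvX X invx_val >] }.

HB.instance Definition _ := [isSub for invx_val].
HB.instance Definition _ := gen_eqMixin InvX.
HB.instance Definition _ := gen_choiceMixin InvX.

Lemma invxP (I : InvX) : in_InvX X I.
Proof. exact/asboolP/invx_valP. Qed.

Definition invx_one := MkInvX (asboolT (in_InvX1 X)).
Definition invx_mul (I J : InvX) :=
  MkInvX (asboolT (in_InvXM (invxP I) (invxP J))).
Definition invx_inv (I : InvX) :=
  MkInvX (asboolT (s2valP (cid2 (in_InvXV (invxP I))))).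

Lemma invx_mulA : associative invx_mul.
Proof. by move=> I J L; apply: val_inj; exact: idmulA. Qed.

Lemma invx_mulC : commutative invx_mul.
Proof. by move=> I J; apply: val_inj; exact: idmulC. Qed.

Lemma invx_mul1 : left_id invx_one invx_mul.
Proof.
by move=> I; apply: val_inj; apply: idmul1; have [[[]]] := invxP I.
Qed.

Lemma invx_mulV : left_inverse invx_one invx_inv invx_mul.
Proof.
move=> I; apply: val_inj => /=; exact: (s2valP' (cid2 (in_InvXV (invxP I)))).
Qed.

HB.instance Definition _ := GRing.isZmodule.Build InvX
  invx_mulA invx_mulC invx_mul1 invx_mulV.

End InvX.

Section Localizations.
Variables (K : fieldType) (D : subringClosed K).

Definition bigcap_loc (F : set (Spec D)) : {pred K} :=
  fun x => `[< forall P, F P -> localization P x >].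

Lemma bigcap_loc_subring F : subring_closed (bigcap_loc F).
Proof.
split=> [|x y /asboolP Fx /asboolP Fy|x y /asboolP Fx /asboolP Fy];
  apply/asboolP => P FP; have [l1 lB lM] := localizationP P => //.
- exact: lB (Fx _ FP) (Fy _ FP).
- exact: lM (Fx _ FP) (Fy _ FP).
Qed.

HB.instance Definition _ F :=
  GRing.isSubringClosed.Build K (bigcap_loc F) (bigcap_loc_subring F).

(* XT = {PT | P in X, PT <> T}, as a subset of Spec T: an element of Spec T is
   different from T, and for D Pruefer each PT <> T with P prime is prime. *)
Definition ext_set (X : set (Spec D)) (T : subringClosed K) : set (Spec T) :=
  [set Q : Spec T | exists2 P, X P & Q = idmul P [set` T] :> set K].
Arguments ext_set X T _ : clear implicits.

(* T_alpha as a function of C = Crit_X^alpha(D) *)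
Definition Tring (X C : set (Spec D)) : subringClosed K :=
  bigcap_loc (C `|` ~` X).

(* Crit_X^(alpha+1)(D) as a function of C = Crit_X^alpha(D) *)
Definition crit_step (X C : set (Spec D)) : set (Spec D) :=
  [set P | X P /\
     exists2 Q : Spec (Tring X C), Q = idmul P [set` Tring X C] :> set K
                                 & CritX (ext_set X (Tring X C)) Q].

End Localizations.
Arguments ext_set {K D} X T _.

(* An ordinal is represented by an element gamma of a well-ordered type W: it
   is the order type of {beta : W | beta < gamma}. Every ordinal arises in this
   way, and the ordinals below gamma are those represented by the elements
   below gamma in W. *)
Section Ordinals.
Context {d : Order.disp_t} {W : orderType d}.
Implicit Types a b g : W.

Definition is_zero a := forall b, (a <= b)%O.
Definition is_succ g a := (g < a)%O /\ forall b, (g < b)%O -> (a <= b)%O.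
Definition is_limit a := ~ is_zero a /\ ~ exists g, is_succ g a.

Variable wfW : well_founded (fun a b : W => (a < b)%O).
Variables (K : fieldType) (D : subringClosed K) (X : set (Spec D)).

Definition crit_rec a (rec : forall g, (g < a)%O -> set (Spec D)) :
    set (Spec D) :=
  [set P | if pselect (is_zero a) then X P
           else if pselect (exists g, is_succ g a) then
             forall g (ga : (g < a)%O), is_succ g a -> crit_step X (rec g ga) P
           else forall g (ga : (g < a)%O), rec g ga P].

(* Crit_X^a(D), T_a and Y_a; in Y_a, Crit_X^(a+1)(D) is written directly as
   crit_step (see crit_succ), so that Y_a makes sense for the top element of W. *)
Definition crit : W -> set (Spec D) := Fix wfW (fun _ => set (Spec D)) crit_rec.
Definition T_ a : subringClosed K := Tring X (crit a).
Definition Y_ a : set (Spec D) := crit a `\` crit_step X (crit a).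

Definition is_SP_rank g := crit g = set0 /\ forall b, crit b = set0 -> (g <= b)%O.

Lemma critE a : crit a = crit_rec (fun g (_ : (g < a)%O) => crit g).
Proof.
rewrite /crit Fix_eq // => b f1 f2 f12; congr crit_rec.
by apply: functional_extensionality_dep => g;
  apply: functional_extensionality_dep => gb; exact: f12.
Qed.

Lemma crit_zero a : is_zero a -> crit a = X.
Proof.
by move=> a0; rewrite critE /crit_rec; apply/seteqP; split=> P /=;
  case: (pselect (is_zero a)).
Qed.

Lemma crit_succ g a : is_succ g a -> crit a = crit_step X (crit g).
Proof.
move=> ga; have [lt_ga min_a] := ga.
have na0 : ~ is_zero a by move=> /(_ g); rewrite leNgt lt_ga.
have ea : exists g', is_succ g' a by exists g.
rewrite critE /crit_rec; apply/seteqP; split=> P /=;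
  case: (pselect (is_zero a)) => [/na0 //|h0] /=;
  case: (pselect (exists g, is_succ g a)) => [h1|/(_ ea) //] /=.
  by move=> /(_ _ lt_ga ga).
move=> critP g' lt_g'a [_ min_a'].
suff -> : g' = g by [].
by apply/eqP; rewrite eq_le !leNgt; apply/andP; split; apply/negP;
  [move=> /min_a|move=> /min_a']; rewrite leNgt ?lt_g'a ?lt_ga.
Qed.

Lemma crit_limit a : is_limit a ->
  crit a = \bigcap_(g in [set g | (g < a)%O]) crit g.
Proof.
move=> [na0 nsa]; rewrite critE /crit_rec; apply/seteqP; split=> P /=;
  case: (pselect (is_zero a)) => [/na0 //|h0] /=;
  case: (pselect (exists g, is_succ g a)) => [/nsa //|h1] /=;
  by move=> h g; exact: h.
Qed.

End Ordinals.

Section CompactlySupported.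
Variable Y : topologicalType.

Definition fsupport (f : Y -> int) : set Y := closure [set y | f y != 0].

Definition Cc_pred : {pred Y -> int} := fun f =>
  `[< continuous (f : Y -> discrete_topology int) /\ compact (fsupport f) >].

Lemma cts_discrete (Z : choiceType) (f : Y -> discrete_topology Z) :
  continuous f <-> forall y, \forall z \near y, f z = f y.
Proof.
split=> [cf y|h y U nU]; last first.
  by apply: filterS (h y) => z /= ->; move: nU => /principal_filterP.
by have := cf y [set f y]; apply; exact/principal_filterP.
Qed.

Lemma Cc_zmod : zmod_closed Cc_pred.
Proof.
split=> [|f g /asboolP[cf kf] /asboolP[cg kg]]; apply/asboolP; split.
- by apply/cts_discrete => y; exact: nearW.
- rewrite /fsupport [X in closure X](_ : _ = set0) ?closure0.
    exact: compact0.
  by apply/seteqP; split=> y //=; rewrite eqxx.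
- apply/cts_discrete => y; move/cts_discrete/(_ y): cf.
  move/cts_discrete/(_ y): cg; apply: filterS2 => z gz fz.
  by rewrite !fctE gz fz.
- apply: (@subclosed_compact _ _ (fsupport f `|` fsupport g)).
  + exact: closed_closure.
  + exact: compactU.
  rewrite /fsupport -closureU; apply: closure_subset => y /=.
  apply: contraPP => /not_orP[/negP/negPn/eqP f0 /negP/negPn/eqP g0].
  by rewrite !fctE f0 g0 subrr eqxx.
Qed.

HB.instance Definition _ := GRing.isZmodClosed.Build _ Cc_pred Cc_zmod.

Record Cc := MkCc { cc_val :> Y -> int; cc_valP : cc_val \in Cc_pred }.

HB.instance Definition _ := [isSub for cc_val].
HB.instance Definition _ := [Choice of Cc by <:].
HB.instance Definition _ := [SubChoice_isSubZmodule of Cc by <:].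

End CompactlySupported.

Section DirectSum.
Variables (I : Type) (V : I -> zmodType).

Record dsum := MkDsum {
  dsum_val :> forall i, V i;
  dsum_valP : `[< finite_set [set i | dsum_val i != 0] >] }.

HB.instance Definition _ := [isSub for dsum_val].
HB.instance Definition _ := gen_eqMixin dsum.
HB.instance Definition _ := gen_choiceMixin dsum.

Lemma dsumP (f : dsum) : finite_set [set i | f i != 0].
Proof. exact/asboolP/dsum_valP. Qed.

Lemma dsum_eqP (f g : dsum) : (forall i, f i = g i) -> f = g.
Proof. by move=> fg; apply: val_inj; exact: functional_extensionality_dep. Qed.

Fact dsum_zero_subproof : finite_set [set i | (0 : V i) != 0].
Proof.
by rewrite [X in finite_set X](_ : _ = set0) //; apply/seteqP; split=> i //=;
  rewrite eqxx.
Qed.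

Fact dsum_add_subproof (f g : dsum) : finite_set [set i | f i + g i != 0].
Proof.
apply: (@sub_finite_set _ _ ([set i | f i != 0] `|` [set i | g i != 0])).
  move=> i /=; apply: contraPP => /not_orP[].
  by move=> /negP/negPn/eqP -> /negP/negPn/eqP ->; rewrite addr0 eqxx.
by rewrite finite_setU; split; exact: dsumP.
Qed.

Fact dsum_opp_subproof (f : dsum) : finite_set [set i | - f i != 0].
Proof.
apply: sub_finite_set (dsumP f) => i /=; by rewrite oppr_eq0.
Qed.

Definition dsum_zero := MkDsum (asboolT dsum_zero_subproof).
Definition dsum_add f g := MkDsum (asboolT (dsum_add_subproof f g)).
Definition dsum_opp f := MkDsum (asboolT (dsum_opp_subproof f)).

Lemma dsum_addA : associative dsum_add.
Proof. by move=> f g h; apply: dsum_eqP => i; exact: addrA. Qed.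
Lemma dsum_addC : commutative dsum_add.
Proof. by move=> f g; apply: dsum_eqP => i; exact: addrC. Qed.
Lemma dsum_add0 : left_id dsum_zero dsum_add.
Proof. by move=> f; apply: dsum_eqP => i; exact: add0r. Qed.
Lemma dsum_addN : left_inverse dsum_zero dsum_opp dsum_add.
Proof. by move=> f; apply: dsum_eqP => i; exact: addNr. Qed.

HB.instance Definition _ := GRing.isZmodule.Build dsum
  dsum_addA dsum_addC dsum_add0 dsum_addN.

End DirectSum.

Definition isomorphic (U V : zmodType) :=
  exists f : {additive U -> V}, bijective f.

Definition short_exact (U V W : zmodType)
    (f : {additive U -> V}) (g : {additive V -> W}) :=
  [/\ injective f, range f = [set v | g v = 0] & range g = setT].

Definition free_abelian (U : zmodType) :=
  exists B : Type, isomorphic (dsum (fun _ : B => int)) U.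

(* The direct sum of the groups C_c(Y_beta, Z) over beta < g; the set Y_ beta
   has the subspace topology of the inverse topology on Spec D. *)
Definition sum_Cc (d : Order.disp_t) (W : orderType d)
    (wfW : well_founded (fun a b : W => (a < b)%O))
    (K : fieldType) (D : subringClosed K) (X : set (Spec D)) (g : W) : zmodType :=
  dsum (fun b : {b : W | (b < g)%O} => Cc (Y_ wfW X (sval b))).

(* Main.v *)
From HB Require Import structures.
From mathcomp Require Import all_boot all_order all_algebra.
From mathcomp Require Import all_classical topology.
From mathcomp Require Import ring zify.
Require Import Defs.
Set Implicit Arguments.
Unset Strict Implicit.
Unset Printing Implicit Defensive.
Import Order.TTheory GRing.Theory Num.Theory.
Local Open Scope classical_set_scope.
Local Open Scope ring_scope.

(** Why the theorem is true.

For P in X the maximal ideal PD_P is principal, because D_P is a valuation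
ring and P <> P^2; let p generate it. Every I in Inv_X(D) satisfies
ID_P = p^n D_P for an integer n, the value of I at P: otherwise a generator of
ID_P, or its inverse, would be divisible in D_P by all powers of p, and the
prime ideal of the elements of D with this property, which lies strictly below
P and hence outside X, would be in the support of I. Thus G = Inv_X(D) is a
group of integer valued functions on X. It is closed under minima, because the
values of I + J are the minima of those of I and J, and the supports of its
positive elements, the sets V(I), are compact open subsets of X that form a
basis of the inverse topology. This is [InvX_valued_group].

Let C be a closed subset of X, and T the intersection of the D_P for P in C or
outside X. The map I |-> IT sends G onto Inv_{XT}(T) ([ext_surj]): a finitely
generated T-module is extended from the D-module with the same generators. Its
kernel consists of the elements of G that vanish on C ([ext_ker]), and IT is
radical exactly when I takes only the values 0 and 1 on C ([ext_radical]).
Consequently one step of the critical sequence can be read off from the values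
([crit_stepE]): it leads from C to the set C' of the points of C at which no
element of G that is 0-1 valued on C takes the value 1. Near a point y of
C \ C' such an element e exists, and an element g of G is there equal to
g(y) e, since g - g(y) e vanishes at y and hence near y. So elements of G are
continuous on C \ C', and those that vanish on C' restrict to compactly
supported functions on Y = C \ C'. By compactness all of C_c(Y, Z) arises in
this way ([restr_Cc], [restr_surj]).

Let K_b be the subgroup of the elements of G that vanish on Crit^b. It is the
kernel of the map from G to Inv_{XT_b}(T_b), one has K_0 = 0 and
K_(b+1) / K_b = C_c(Y_b, Z), and K_b is the union of the earlier ones when b is
a limit, since supports are compact ([vanish_Cr]). The groups C_c(Y, Z) are free
([Cc_free]), so the chain splits and K_c is the direct sum of the C_c(Y_b, Z)
for b < c ([chain_dsum]). This is (a), and (b) is the case where Crit^c is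
empty. For (c) it remains to see that Crit^c is empty for some c. A nonempty
closed set C has noncritical points, by an argument in the style of Baire
([critical_points_proper]); so the sequence decreases strictly until it is empty
and cannot be indexed by an ordinal with more elements than Spec(D)
([chain_injection]).

The freeness of C_c(Y, Z) is Noebeling's theorem, proved here by Bergman's
method ([free_idempotents]): a torsion-free commutative ring generated by
idempotents is free as an abelian group. Well-order the generating idempotents
and let A_c be the ring generated by those before the c-th one, e. The map
x |-> x e identifies A_(c+1) / A_c with a quotient of A_c, which is again a
torsion-free ring and is generated by fewer idempotents, so it is free by
induction. A well-ordered chain with free quotients has a free union
([free_filtration]). *)

(** * Direct sums and well-ordered filtrations *)

(** Subgroups are mere subsets, so that the members of a chain live in one group
and statements about a quotient H/L can be made about elements of H modulo
membership in L, without forming the quotient. *)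
Definition subgroup (U : zmodType) (F : set U) :=
  F 0 /\ forall x y, F x -> F y -> F (x - y).

Section Subgroup.
Variables (U : zmodType) (F : set U).
Hypothesis sF : subgroup F.

Lemma subgroupN x : F x -> F (- x).
Proof. by move=> Fx; rewrite -sub0r; apply: sF.2 => //; exact: sF.1. Qed.

Lemma subgroupD x y : F x -> F y -> F (x + y).
Proof. by move=> Fx Fy; rewrite -[y]opprK; apply: sF.2 => //; exact: subgroupN. Qed.

Lemma subgroup_sum (I : Type) (r : seq I) (P : pred I) (f : I -> U) :
  (forall i, P i -> F (f i)) -> F (\sum_(i <- r | P i) f i).
Proof. by move=> h; elim/big_ind: _ => //; [exact: sF.1|exact: subgroupD]. Qed.

Lemma subgroup_mulz x n : F x -> F (x *~ n).
Proof.
move=> Fx; have h m : F (x *+ m).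
  by elim: m => [|m IH]; rewrite ?mulr0n ?mulrS; [exact: sF.1|exact: subgroupD].
by case: n => m; rewrite ?NegzE ?mulrNz; [exact: h|apply: subgroupN; exact: h].
Qed.

Lemma subgroup_trans y x z : F (x - y) -> F (y - z) -> F (x - z).
Proof. by move=> xy yz; rewrite -(subrK y x) -addrA; exact: subgroupD. Qed.
End Subgroup.

Lemma subgroup0 (U : zmodType) : subgroup [set (0 : U)].
Proof. by split=> //= x y -> ->; rewrite subrr. Qed.

Section DsumSingle.
Variables (I : Type) (V : I -> zmodType).

Definition single_fun a (x : V a) i : V i :=
  if pselect (a = i) is left e then ecast j (V j) e x else 0.

Lemma single_same a (x : V a) : single_fun x a = x.
Proof.
rewrite /single_fun; case: pselect => // e.
by rewrite (Prop_irrelevance e erefl).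
Qed.

Lemma single_other a (x : V a) i : a <> i -> single_fun x i = 0.
Proof. by rewrite /single_fun; case: pselect. Qed.

Fact single_subproof a (x : V a) : finite_set [set i | single_fun x i != 0].
Proof.
apply: sub_finite_set (finite_set1 a) => i /=.
by apply: contra_neqP => ia; rewrite single_other // => /esym.
Qed.

Definition single a (x : V a) := MkDsum (asboolT (single_subproof x)).
End DsumSingle.

Section DsumLift.
Variables (I : Type) (V : I -> zmodType) (U : zmodType).
Variable s : forall i, {additive V i -> U}.

(** The map out of a direct sum given by maps s i out of its summands. The index
set is an arbitrary type; {classic I} has the choice structure that finite sums
require. *)
Definition dlift (c : dsum V) : U :=
  \sum_(i \in [set i : {classic I} | c i != 0]) s i (c i).

Lemma dliftE (r : seq {classic I}) (c : dsum V) : uniq r ->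
  (forall i : {classic I}, c i != 0 -> i \in r) -> dlift c = \sum_(i <- r) s i (c i).
Proof.
move=> ur cr; rewrite /dlift.
rewrite (@fsbig_widen _ _ _ _ _ [set` r]).
- by rewrite -fsbig_seq.
- by move=> i /cr.
- by move=> i /= [_ /negP/negPn/eqP ->]; rewrite raddf0.
Qed.

Lemma dsum_enum (c : dsum V) :
  exists2 r : seq {classic I}, uniq r & forall i : {classic I}, (c i != 0) = (i \in r).
Proof.
have fc : finite_set [set i : {classic I} | c i != 0] by exact: dsumP.
exists (finmap.enum_fset (fset_set [set i : {classic I} | c i != 0])).
  exact: finmap.fset_uniq.
move=> i; rewrite [RHS](in_fset_set fc i).
by apply/idP/idP; rewrite inE.
Qed.

Fact dlift_is_additive : zmod_morphism dlift.
Proof.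
move=> c1 c2.
have [r1 u1 h1] := dsum_enum c1; have [r2 u2 h2] := dsum_enum c2.
have ur := undup_uniq (r1 ++ r2).
have hr (i : {classic I}) : c1 i != 0 \/ c2 i != 0 -> i \in undup (r1 ++ r2).
  by rewrite mem_undup mem_cat h1 h2 => -[->|->]; rewrite ?orbT.
rewrite !(dliftE ur); last 3 first.
- by move=> i c2i; apply: hr; right.
- by move=> i c1i; apply: hr; left.
- move=> i; apply: contraPT => /negP ir.
  suff -> : (c1 - c2) i = c1 i - c2 i.
    by case: (eqVneq (c1 i) 0) (eqVneq (c2 i) 0) => [->|n1] [->|n2];
      rewrite ?subr0 ?eqxx // => _; apply: ir; apply: hr; [right|left|left].
  by [].
rewrite -sumrB; apply: eq_bigr => i _; exact: raddfB.
Qed.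

HB.instance Definition _ := GRing.isZmodMorphism.Build (dsum V) U dlift
  dlift_is_additive.

Lemma dlift_single a (x : V a) : dlift (single x) = s a x.
Proof.
rewrite (@dliftE [:: (a : {classic I})]) //.
  by rewrite big_seq1 /= single_same.
move=> i; apply: contra_neqT => /=; rewrite inE => /eqP ia.
by rewrite single_other // => /esym.
Qed.
End DsumLift.

Section Eval.
Variables (I : Type) (V : I -> zmodType).

Definition deval i (c : dsum V) := c i.
Fact deval_is_additive i : zmod_morphism (deval i).
Proof. by []. Qed.
HB.instance Definition _ i := GRing.isZmodMorphism.Build (dsum V) (V i) (deval i)
  (deval_is_additive i).
End Eval.

Section DsumInt.
Variables (B : Type) (U : zmodType).

Definition zmul (x : U) (n : int) : U := x *~ n.
Fact zmul_is_additive x : zmod_morphism (zmul x).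
Proof. by move=> m n; rewrite /zmul mulrzBr. Qed.
HB.instance Definition _ x := GRing.isZmodMorphism.Build int U (zmul x)
  (zmul_is_additive x).

Definition lin (b : B -> U) : {additive dsum (fun _ : B => int) -> U} :=
  dlift (fun i => zmul (b i)).

Lemma dsum_int_eq (f : {additive dsum (fun _ : B => int) -> U}) c :
  f c = lin (fun i => f (single (V := fun _ => int) (a := i) 1)) c.
Proof.
have [r ur hr] := dsum_enum c.
rewrite [RHS](dliftE _ ur); last by move=> i; rewrite hr.
have {1}-> : c = \sum_(i <- r) single (V := fun _ => int) (a := i) 1 *~ c i.
  apply: dsum_eqP => j; rewrite -[RHS]/(deval j _) raddf_sum.
  have E (i : {classic B}) :
      deval j (single (V := fun _ => int) (a := i) 1 *~ c i)
      = if i == j then c j else 0.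
    rewrite raddfMz /deval; case: eqP => [->|ij]; first by rewrite /= single_same intz.
    by rewrite /= single_other // mul0rz.
  rewrite (eq_bigr _ (fun i _ => E i)) -big_mkcond /=.
  have [jr|jr] := boolP ((j : {classic B}) \in r).
    by rewrite -big_filter filter_pred1_uniq // big_seq1.
  have c0 : c j = 0 by apply/eqP; rewrite -[_ == _]negbK hr.
  by rewrite c0 big1.
by rewrite raddf_sum; apply: eq_bigr => i _; rewrite raddfMz.
Qed.
End DsumInt.

Lemma raddf_lin (B : Type) (U V : zmodType) (r : {additive U -> V}) (b : B -> U) c :
  r (lin b c) = lin (r \o b) c.
Proof.
have [q uq hq] := dsum_enum c.
have cq (i : {classic B}) : c i != 0 -> i \in q by rewrite hq.
rewrite [lin b c](dliftE _ uq cq) [RHS](dliftE _ uq cq).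
by rewrite raddf_sum; apply: eq_bigr => i _; rewrite /= /zmul raddfMz.
Qed.

(** Free groups are projective: lift the basis. The subgroup H matters when r has
the required range only on H. *)
Lemma dsum_int_lift (B : Type) (U V : zmodType) (r : {additive U -> V}) (H : set U)
    (s : {additive dsum (fun _ : B => int) -> V}) :
  subgroup H -> (forall c, exists2 h, H h & r h = s c) ->
  exists2 t : {additive dsum (fun _ : B => int) -> U},
    forall c, H (t c) & forall c, r (t c) = s c.
Proof.
move=> sH rs; pose b i := s2val (cid2 (rs (single (V := fun _ => int) (a := i) 1))).
exists (lin b) => c.
  apply: subgroup_sum => // i _; apply: subgroup_mulz => //.
  exact: (s2valP (cid2 (rs _))).
rewrite raddf_lin [s c]dsum_int_eq; congr (lin _ c); apply/funext => i /=.
exact: (s2valP' (cid2 (rs _))).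
Qed.

Section Filtration.
Variables (I : Type) (lt : I -> I -> Prop).

Definition strict_wellorder :=
  [/\ well_founded lt, forall a b c, lt a b -> lt b c -> lt a c
    & forall a b, [\/ lt a b, a = b | lt b a]].

Hypothesis wo : strict_wellorder.

Lemma exists_max (T : eqType) (g : T -> I) (r : seq T) : r != [::] ->
  exists2 m, m \in r & forall x, x \in r -> g x = g m \/ lt (g x) (g m).
Proof.
have [_ tr tot] := wo.
elim: r => // x [_ _|y r /(_ isT) [m mr hm] _].
  by exists x; rewrite ?inE // => z; rewrite inE => /eqP ->; left.
have [xm|xm|mx] := tot (g x) (g m).
- exists m; first by rewrite inE mr orbT.
  by move=> z; rewrite inE => /predU1P[->|/hm //]; right.
- exists m; first by rewrite inE mr orbT.
  by move=> z; rewrite inE => /predU1P[->|/hm //]; left.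
- exists x; first by rewrite inE eqxx.
  move=> z; rewrite inE => /predU1P[->|/hm [->|zm]]; [by left|by right|right].
  exact: tr zm mx.
Qed.

(* F a and F' a are the members of the chain before and after the step a, and
   s a splits F' a over F a. By FE and HE the chain is continuous: an element
   present before the step a lies in L or has appeared at an earlier step. *)
Variables (U : zmodType) (L H : set U) (F F' : I -> set U).
Variables (V : I -> zmodType) (s : forall i, {additive V i -> U}).
Hypotheses (sL : subgroup L) (sH : subgroup H) (sF : forall a, subgroup (F a)).
Hypotheses (LF : forall a, L `<=` F a) (F'F : forall a b, lt a b -> F' a `<=` F b).
Hypothesis F'H : forall a, F' a `<=` H.
Hypothesis FE : forall a h, F a h -> L h \/ exists2 b, lt b a & F' b h.
Hypothesis HE : forall h, H h -> L h \/ exists b, F' b h.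
Hypotheses (sF' : forall a x, F' a (s a x)) (sinj : forall a x, F a (s a x) -> x = 0).
Hypothesis ssurj : forall a h, F' a h -> exists x, F a (h - s a x).

(** The component of largest index does not vanish modulo the earlier steps. *)
Lemma filtration_inj c : L (dlift s c) -> c = 0.
Proof.
have [r ur hr] := dsum_enum c.
have [r0|/(exists_max (id : {classic I} -> I))] := eqVneq r [::].
  by move=> _; apply: dsum_eqP => i; apply/eqP; rewrite -[_ == _]negbK hr r0.
move=> [m mr maxm] Lc; move: (mr); rewrite -hr => /eqP; case.
apply: sinj; have := LF m Lc.
rewrite (dliftE _ ur); last by move=> i; rewrite hr.
rewrite (big_rem m) //= => Fm.
set T := \sum_(_ <- _) _ in Fm.
rewrite -[s _ _](addrK T); apply: (sF m).2 => //.
rewrite /T big_seq; apply: subgroup_sum => // i; rewrite mem_rem_uniq // inE.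
move=> /andP[/eqP im /maxm [//|lim]].
exact: (F'F lim).
Qed.

(** Induction on the step a at which h appears: subtracting a value of s a leaves
an element that appeared earlier. *)
Lemma filtration_surj h : H h -> exists c, L (h - dlift s c).
Proof.
have base g : L g -> exists c, L (g - dlift s c).
  by move=> Lg; exists 0; rewrite raddf0 subr0.
suff IH a g : F' a g -> exists c, L (g - dlift s c).
  by move=> /HE [/base //|[a /IH]].
elim/(well_founded_ind (let: And3 w _ _ := wo in w)): a g => a IH g F'g.
have [x Fx] := ssurj F'g.
have [c Lc] : exists c, L (g - s a x - dlift s c).
  by case: (FE Fx) => [/base //|[b ba /(IH _ ba)]].
exists (c + single x).
have -> : dlift s (c + single x) = dlift s c + s a x by rewrite raddfD /= dlift_single.
by rewrite opprD addrA addrAC.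
Qed.

Lemma filtration_sub c : H (dlift s c).
Proof. by apply: subgroup_sum => // i _; apply: F'H; exact: sF'. Qed.
End Filtration.

(** H/L is free: s induces an isomorphism from a free group onto it. *)
Definition free_mod (U : zmodType) (H L : set U) :=
  exists (B : Type) (s : {additive dsum (fun _ : B => int) -> U}),
    [/\ forall c, H (s c), forall c, L (s c) -> c = 0
      & forall h, H h -> exists c, L (h - s c)].

Section Curry.
Variables (I : Type) (B : I -> Type).

Fact curry1_subproof (c : dsum (fun _ : {i & B i} => int)) i :
  finite_set [set b : B i | c (existT B i b) != 0].
Proof.
have fc := finite_image (fun p : {i & B i} => if pselect (projT1 p = i) is left e
  then Some (ecast j (B j) e (projT2 p)) else None) (dsumP c).
apply: sub_finite_set (finite_preimage (f := Some) _ fc) => [b /= cb|].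
  exists (existT B i b) => //=; case: pselect => // e.
  by rewrite (Prop_irrelevance e erefl).
by move=> x y _ _ [].
Qed.

Definition curry1 c i := MkDsum (asboolT (curry1_subproof c i)).

Fact curry_subproof c : finite_set [set i | curry1 c i != 0].
Proof.
apply: sub_finite_set (finite_image (@projT1 _ _) (dsumP c)) => i /= /eqP c0.
apply: contrapT => ic; apply: c0; apply: dsum_eqP => b /=.
by apply/eqP/negPn/negP => cb; apply: ic; exists (existT B i b).
Qed.

(** This isomorphism shows that a direct sum of free groups is free, on the
disjoint union of the bases. *)
Definition dsum_curry c : dsum (fun i => dsum (fun _ : B i => int)) :=
  MkDsum (asboolT (curry_subproof c)).

Fact dsum_curry_is_additive : zmod_morphism dsum_curry.
Proof. by move=> c1 c2; apply: dsum_eqP => i; apply: dsum_eqP => b. Qed.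
HB.instance Definition _ := GRing.isZmodMorphism.Build _ _ dsum_curry
  dsum_curry_is_additive.

Lemma dsum_curry_inj : injective dsum_curry.
Proof.
move=> c1 c2 c12; apply: dsum_eqP => -[i b].
by rewrite -[LHS]/(dsum_curry c1 i b) c12.
Qed.

Lemma dsum_curry_surj d : exists c, dsum_curry c = d.
Proof.
have fd : finite_set [set p : {i & B i} | d (projT1 p) (projT2 p) != 0].
  apply: (@sub_finite_set _ _ (\bigcup_(i in [set i | d i != 0])
      existT B i @` [set b | d i b != 0])).
    move=> [i b] /= db; exists i => /=; last by exists b.
    by apply: contra_neq db => ->.
  by apply: bigcup_finite => [|i _]; [|apply: finite_image]; exact: dsumP.
by exists (MkDsum (asboolT fd)); apply: dsum_eqP => i; apply: dsum_eqP.
Qed.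
End Curry.

(** Free quotients make the chain split, so H/L is the direct sum of the F' a/F a. *)
Lemma free_filtration (I : Type) (lt : I -> I -> Prop) (U : zmodType)
    (L H : set U) (F F' : I -> set U) :
  strict_wellorder lt -> subgroup L -> subgroup H -> (forall a, subgroup (F a)) ->
  (forall a, L `<=` F a) -> (forall a b, lt a b -> F' a `<=` F b) ->
  (forall a, F' a `<=` H) ->
  (forall a h, F a h -> L h \/ exists2 b, lt b a & F' b h) ->
  (forall h, H h -> L h \/ exists b, F' b h) ->
  (forall a, free_mod (F' a) (F a)) -> free_mod H L.
Proof.
move=> wo sL sH sF LF F'F F'H FE HE qfree.
pose B a := sval (cid (qfree a)).
pose s a := sval (cid (svalP (cid (qfree a)))).
have hs a := svalP (cid (svalP (cid (qfree a)))).
have sF' a x : F' a (s a x) by case: (hs a) => + _ _; apply.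
have sinj a x : F a (s a x) -> x = 0 by case: (hs a) => _ + _; apply.
have ssurj a h : F' a h -> exists x, F a (h - s a x).
  by case: (hs a) => _ _; apply.
exists {a & B a}, (dlift s \o @dsum_curry I B); split=> [c|c /=|h Hh].
- exact: filtration_sub F'H sF' _.
- move=> /(filtration_inj wo sF LF F'F sF' sinj) c0.
  by apply: dsum_curry_inj; rewrite c0 raddf0.
- have [d Ld] := filtration_surj wo FE HE ssurj Hh.
  by have [c cd] := dsum_curry_surj d; exists c; rewrite /= cd.
Qed.

(** * Rings generated by idempotents *)

Lemma wellorder_exists (T : Type) : exists lt : T -> T -> Prop, strict_wellorder lt.
Proof.
have [R woR] := wochoice.well_ordering_principle {classic T}.
have mn (A : pred {classic T}) x : A x -> exists z, A z /\ forall y, A y -> R z y.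
  by move=> Ax; have [|z [[Az hz] _]] := woR A; [exists x|exists z; split=> // y /hz].
have uniq2 (A : pred {classic T}) x y : A x -> A y ->
    (forall z, A z -> R x z) -> (forall z, A z -> R y z) -> x = y.
  move=> Ax Ay hx hy; have [|z [_ hz]] := woR A; first by exists x.
  by rewrite -(hz x) ?(hz y).
have refl x : R x x.
  by have [z [/eqP -> h]] := mn (pred1 x) x (eqxx x); apply: h => /=.
have anti x y : R x y -> R y x -> x = y.
  move=> xy yx; apply: (uniq2 (pred2 x y)); rewrite /= ?eqxx ?orbT //.
    by move=> z /orP[] /eqP ->.
  by move=> z /orP[] /eqP ->.
have tot x y : R x y \/ R y x.
  have [z [/orP[] /eqP -> h]] := mn (pred2 x y) x (predU1l _ erefl).
    by left; apply: h; rewrite /= eqxx orbT.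
  by right; apply: h; rewrite /= eqxx.
exists (fun a b => R a b /\ a <> b); split.
- move=> a; apply: contrapT => na.
  have [z [/asboolP nz hz]] := mn (fun x => `[< ~ Acc (fun a b => R a b /\ a <> b) x >]) a (asboolT na).
  apply: nz; constructor => y [yz neq]; apply: contrapT => /asboolT ny.
  by apply: neq; apply: anti => //; exact: hz.
- move=> a b c [ab nab] [bc nbc].
  have [z [/or3P[] /eqP -> h]] := mn (pred3 (a : {classic T}) b c) a (predU1l _ erefl).
  + split; first by apply: h; rewrite /= eqxx !orbT.
    by move=> ac; apply: nab; apply: anti => //; rewrite ac.
  + by case: nab; apply: anti => //; apply: h; rewrite /= eqxx.
  + by case: nbc; apply: anti => //; apply: h; rewrite /= eqxx orbT.
- move=> a b; have [->|ab] := pselect (a = b); first exact: Or32.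
  by have [?|?] := tot a b; [apply: Or31|apply: Or33]; split=> // /esym.
Qed.

Section RingGenerated.
Variable S : comPzRingType.
Implicit Types (E J : set S) (x y z e : S).

(** These rings need not contain 1, as C_c(Y, Z) does not when Y is not compact;
rgen1 E below adjoins it. *)
Inductive rgen E : set S :=
  | rgen0 : rgen E 0
  | rgen_in x : E x -> rgen E x
  | rgenB x y : rgen E x -> rgen E y -> rgen E (x - y)
  | rgenM x y : rgen E x -> rgen E y -> rgen E (x * y).

Definition idem x := x * x = x.
Notation rgen1 E := (rgen ([set 1] `|` E)).

Lemma subgroup_rgen E : subgroup (rgen E).
Proof. by split; [exact: rgen0|exact: rgenB]. Qed.

Lemma rgen_mono E E' : E `<=` E' -> rgen E `<=` rgen E'.
Proof.
move=> EE' x; elim=> [|y /EE'|y z _ ? _ ?|y z _ ? _ ?];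
  [exact: rgen0|exact: rgen_in|exact: rgenB|exact: rgenM].
Qed.

Lemma rgen_sub1 E x : rgen E x -> rgen1 E x.
Proof. by apply: rgen_mono => y; right. Qed.

Lemma rgen1_mul E a x : rgen1 E a -> rgen E x -> rgen E (a * x).
Proof.
move=> Ea; elim: Ea x => [|y [->|Ey]|y z _ IHy _ IHz|y z _ IHy _ IHz] x Ex.
- by rewrite mul0r; exact: rgen0.
- by rewrite mul1r.
- by apply: rgenM => //; exact: rgen_in.
- by rewrite mulrBl; apply: rgenB; [exact: IHy|exact: IHz].
- by rewrite -mulrA; apply: IHy; exact: IHz.
Qed.

(** No powers of e occur because e is idempotent. *)
Lemma rgen_adjoin E e x : idem e -> rgen (E `|` [set e]) x ->
  exists u v, [/\ rgen E u, rgen1 E v & x = u + v * e].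
Proof.
move=> ee; have sE := subgroup_rgen E; have sE1 := subgroup_rgen ([set 1] `|` E).
elim=> [|y [Ey|->]|y z _ [u [v [Eu Ev ->]]] _ [u' [v' [Eu' Ev' ->]]]
  |y z _ [u [v [Eu Ev ->]]] _ [u' [v' [Eu' Ev' ->]]]].
- by exists 0, 0; rewrite mul0r addr0; split=> //; exact: rgen0.
- by exists y, 0; rewrite mul0r addr0; split; [exact: rgen_in|exact: rgen0|].
- by exists 0, 1; rewrite mul1r add0r; split; [exact: rgen0|apply: rgen_in; left|].
- exists (u - u'), (v - v'); split; [exact: rgenB|exact: rgenB|].
  by rewrite mulrBl opprD addrACA.
- exists (u * u'), (u * v' + v * u' + v * v'); split; first exact: rgenM.
    have [? ?] := (rgen_sub1 Eu, rgen_sub1 Eu').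
    by do !apply: subgroupD => //; exact: rgenM.
  rewrite mulrDl mulrDr -addrA; congr (_ + _).
  rewrite mulrDr !mulrDl !mulrA addrA; congr (_ + _ + _).
    by rewrite -mulrA [e * u']mulrC mulrA.
  by rewrite -[v * e * v']mulrA [e * v']mulrC mulrA -[_ * e * e]mulrA ee.
Qed.

Lemma rgen_span E x : (forall e, E e -> idem e) -> rgen E x ->
  exists2 r : seq (int * S), forall p, p \in r -> rgen E p.2 /\ idem p.2
    & x = \sum_(p <- r) p.2 *~ p.1.
Proof.
move=> iE; elim=> [|y Ey|y z _ [r hr ->] _ [t ht ->]|y z _ [r hr ->] _ [t ht ->]].
- by exists [::]; rewrite ?big_nil.
- exists [:: (1, y)]; last by rewrite big_seq1.
  by move=> p; rewrite inE => /eqP -> /=; split; [exact: rgen_in|exact: iE].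
- exists (r ++ [seq (- p.1, p.2) | p <- t]).
    by move=> p; rewrite mem_cat => /orP[/hr//|/mapP[q /ht ? ->]].
  rewrite big_cat big_map /= -sumrN; congr (_ + _).
  by apply: eq_bigr => p _; rewrite mulrNz.
- exists [seq (p.1 * q.1, p.2 * q.2) | p <- r, q <- t].
    move=> _ /allpairsP[[p q] /= [/hr[? ip] /ht[? iq] ->]] /=.
    by split; [exact: rgenM|rewrite /idem mulrACA ip iq].
  rewrite big_allpairs_dep mulr_suml; apply: eq_bigr => p _.
  rewrite mulr_sumr; apply: eq_bigr => q _ /=.
  by rewrite mulrzAl mulrzAr mulrzA mulrzAC.
Qed.

(** The idempotents that occur in y cut 1 into orthogonal idempotents f on each of
which y is an integer k, that is, y f = k f. Only the piece that is disjoint from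
all of them may lie outside rgen E, and there k = 0. *)
Lemma idem_local E y (P : S -> Prop) : (forall e, E e -> idem e) -> rgen E y ->
  (forall f g, P f -> P g -> P (f + g)) ->
  (forall f k, rgen1 E f -> idem f -> y * f = f *~ k -> k = 0 \/ rgen E f -> P f) ->
  P 1.
Proof.
move=> iE Ey PD Ploc; have [r + yE] := rgen_span iE Ey.
suff gen t f k : (forall p, p \in t -> rgen E p.2 /\ idem p.2) -> rgen1 E f ->
    idem f -> k = 0 \/ rgen E f ->
    y * f = f *~ k + (\sum_(p <- t) p.2 *~ p.1) * f -> P f.
  move=> hr; apply: (gen r 1 0) => //; [exact/rgen_in/or_introl|exact: mul1r|by left|].
  by rewrite mulr0z add0r yE.
elim: t f k => [|[l e] t IH] f k ht Ef ff kf.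
  by rewrite big_nil mul0r addr0 => yf; exact: Ploc yf kf.
have ht' p : p \in t -> rgen E p.2 /\ idem p.2.
  by move=> pt; apply: ht; rewrite inE pt orbT.
have [/= Ee ee] := ht _ (mem_head _ _).
rewrite big_cons /= => yf.
rewrite -[f]mulr1 -(subrK e 1) mulrDr; apply: PD.
- apply: (IH _ k) => //.
  + rewrite mulrBr mulr1 mulrC; apply: rgenB => //; apply: rgenM => //.
    exact: rgen_sub1.
  + rewrite /idem mulrACA ff; congr (_ * _).
    by rewrite mulrBr mulr1 mulrBl mul1r ee subrr subr0.
  + case: kf => [|Ef']; [by left|right].
    by rewrite mulrBr mulr1; apply: rgenB => //; exact: rgenM.
  + rewrite mulrA yf; have e0 : e * (1 - e) = 0 by rewrite mulrBr mulr1 ee subrr.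
    set T := \sum_(_ <- _) _.
    transitivity (k%:~R * (f * (1 - e)) + T * (f * (1 - e)) + l%:~R * f * (e * (1 - e))).
      ring.
    by rewrite e0 mulr0 addr0 mulrzl.
- apply: (IH _ (k + l)) => //.
  + by apply: rgenM => //; exact: rgen_sub1.
  + by rewrite /idem mulrACA ff ee.
  + by right; apply: rgen1_mul.
  + rewrite mulrA yf; set T := \sum_(_ <- _) _.
    transitivity (k%:~R * (f * e) + T * (f * e) + l%:~R * f * (e * e)); first ring.
    rewrite ee mulrzDr; ring.
Qed.

(** The quotient of rgen E' by rgen E + J is torsion-free. Cut 1 into pieces f on
which y is an integer k, and then into pieces g on which z is an integer l. Then
(l n - k) f g is in J, so that f g is in J unless l n = k. If k is not a multiple
of n, then z f is in J; otherwise z f is congruent to (k / n) f. *)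
Lemma rgen_purity E E' J y z (n : int) :
  (forall e, E' e -> idem e) -> E `<=` E' -> subgroup J ->
  (forall a x, rgen1 E' a -> J x -> J (a * x)) ->
  (forall (m : int) x, m != 0 -> rgen E' x -> J (x *~ m) -> J x) ->
  rgen E y -> rgen E' z -> n != 0 -> J (z *~ n - y) ->
  exists2 w, rgen E w & J (z - w).
Proof.
move=> iE' EE' sJ J_mul pure Ey Ez n0 Jzy.
have iE e : E e -> idem e by move=> /EE'/iE'.
have EE1 : rgen1 E `<=` rgen1 E' by apply: rgen_mono => x [|/EE']; [left|right].
have sE := subgroup_rgen E.
suff : exists2 w, rgen E w & J (z * 1 - w) by rewrite mulr1.
apply: (idem_local (y := y) (E := E) (P := fun f => exists2 w, rgen E w & J (z * f - w))) => //.
  move=> f g [u Eu Ju] [v Ev Jv]; exists (u + v); first exact: subgroupD.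
  by rewrite mulrDr opprD addrACA; exact: subgroupD.
move=> f k Ef ff yf kf.
have Jf : J (z * f *~ n - f *~ k).
  have := J_mul _ _ (EE1 _ Ef) Jzy.
  by rewrite mulrBr [f * y]mulrC yf mulrzAr [f * z]mulrC.
have Ezf : rgen E' (z * f) by rewrite mulrC; apply: rgen1_mul => //; exact: EE1.
have [k0|k0] := eqVneq k 0.
  exists 0; first exact: rgen0.
  by rewrite subr0; apply: (pure n) => //; move: Jf; rewrite k0 mulr0z subr0.
case: kf => [/eqP|Ef']; first by rewrite (negPf k0).
have [[l kl]|nk] := pselect (exists l, k = l * n).
  exists (f *~ l); first exact: subgroup_mulz.
  apply: (pure n) => //; last by rewrite mulrzBl -mulrzA -kl.
  apply: rgenB => //; apply: subgroup_mulz; first exact: subgroup_rgen.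
  exact: rgen_mono Ef'.
exists 0; first exact: rgen0.
rewrite subr0 -[z * f]mulr1.
apply: (idem_local (y := z) (E := E') (P := fun g => J (z * f * g))) => //.
  by move=> g h Jg Jh; rewrite mulrDr; exact: subgroupD.
move=> g l Eg gg zg _.
have Jfg : J ((f * g) *~ (l * n - k)).
  have := J_mul _ _ Eg Jf.
  have -> : g * (z * f *~ n - f *~ k) = (f * (z * g)) *~ n - (f * g) *~ k.
    by ring.
  by rewrite zg mulrzAr -mulrzA -mulrzBr.
have /pure/(_ _ Jfg) : l * n - k != 0.
  by rewrite subr_eq0; apply/eqP => lk; apply: nk; exists l.
rewrite mulrC => /(_ (rgen1_mul Eg (rgen_mono EE' Ef'))) Jgf.
by rewrite mulrAC zg mulrzAl; exact: subgroup_mulz.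
Qed.

(** The quotient of rgen1 E by J is then a torsion-free ring, generated by the
images of E. *)
Definition pure_ideal E J :=
  [/\ subgroup J, J `<=` rgen1 E, forall a x, rgen1 E a -> J x -> J (a * x)
    & forall (n : int) x, n != 0 -> rgen1 E x -> J (x *~ n) -> J x].

(** Multiplication by e maps rgen1 E onto the quotient of F + (rgen1 E) e by F, and
its kernel is a pure ideal. *)
Lemma free_mod_adjoin E e (F : set S) : subgroup F ->
  (forall a x, rgen1 E a -> F x -> F (a * x)) ->
  (forall (n : int) x, n != 0 -> rgen1 E x -> F ((x * e) *~ n) -> F (x * e)) ->
  (forall J, pure_ideal E J -> free_mod (rgen1 E) J) ->
  free_mod [set h | exists2 x, rgen1 E x & F (h - x * e)] F.
Proof.
move=> sF F_mul pure free.
have [|B [s [Es inj surj]]] := free [set x | rgen1 E x /\ F (x * e)].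
  split=> [|x []//|a x Ea [Ex Fx]|n x n0 Ex [_ Fx]] /=.
  - split=> [|x y [Ex Fx] [Ey Fy]] /=.
      by split; [exact: rgen0|rewrite mul0r; exact: sF.1].
    by split; [exact: rgenB|rewrite mulrBl; exact: sF.2].
  - by split; [exact: rgenM|rewrite -mulrA; exact: F_mul].
  - by split=> //; apply: (pure n) => //; rewrite -mulrzAl.
pose m x := x * e.
have m_add : zmod_morphism m by move=> x y; exact: mulrBl.
pose M : {additive S -> S} := HB.pack m (GRing.isZmodMorphism.Build S S m m_add).
exists B, (M \o s); split=> [c|c Fc|h [x Ex Fx]] /=.
- by exists (s c) => //; rewrite subrr; exact: sF.1.
- by apply: inj; split.
- have [c [_ Fc]] := surj x Ex; exists c.
  by apply: (subgroup_trans sF Fx); rewrite -mulrBl.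
Qed.
End RingGenerated.
Notation rgen1 E := (rgen ([set 1] `|` E)).

Definition sumset (U : zmodType) (P J : set U) : set U :=
  [set h | exists2 w, P w & J (h - w)].

Lemma subgroup_sumset (U : zmodType) (P J : set U) :
  subgroup P -> subgroup J -> subgroup (sumset P J).
Proof.
move=> sP sJ; split=> [|x y [u Pu Ju] [v Pv Jv]].
  by exists 0; [exact: sP.1|rewrite subr0; exact: sJ.1].
exists (u - v); first exact: sP.2.
have -> : x - y - (u - v) = (x - u) - (y - v) by rewrite !opprD !opprK addrACA.
exact: sJ.2.
Qed.

(** This is a filtration with two steps, indexed by bool. *)
Lemma free_mod_trans (U : zmodType) (H M L : set U) :
  subgroup L -> subgroup M -> subgroup H -> L `<=` M -> M `<=` H ->
  free_mod H M -> free_mod M L -> free_mod H L.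
Proof.
move=> sL sM sH LM MH fHM fML.
pose F (b : bool) := if b then M else L; pose F' (b : bool) := if b then H else M.
have wo : strict_wellorder (fun a b : bool => ~~ a && b).
  have a0 : Acc (fun a b : bool => ~~ a && b) false by constructor=> -[].
  split.
  - by case; [constructor; case => [/andP[]|_]|exact: a0].
  - by move=> [] [] [].
  - by move=> [] []; [apply: Or32|apply: Or33|apply: Or31|apply: Or32].
refine (free_filtration (F := F) (F' := F') wo sL sH _ _ _ _ _ _ _).
- by case.
- by case=> // h.
- by case=> [] [] // _ h.
- by case=> // h.
- by case=> h /= ?; [right; exists false|left].
- by move=> h ?; right; exists true.
- by case.
Qed.

Section Nobeling.
Variables (S : comPzRingType) (I : Type) (lt : I -> I -> Prop) (e : I -> S).
Hypotheses (wo : strict_wellorder lt) (ee : forall i, idem (e i)).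

Let below b : set S := e @` [set d | lt d b].

(** An element involves finitely many generators; b is the last of them. *)
Lemma rgen_support (E0 : set S) (V : set I) x : rgen (E0 `|` e @` V) x ->
  rgen E0 x \/ exists2 b, V b & rgen ((E0 `|` below b) `|` [set e b]) x.
Proof.
have [_ tr tot] := wo.
have up b c : lt b c ->
    rgen ((E0 `|` below b) `|` [set e b]) `<=` rgen ((E0 `|` below c) `|` [set e c]).
  move=> bc; apply: rgen_mono => y [[?|[d db <-]]|->]; left; [by left|right|right].
    by exists d => //; exact: tr bc.
  by exists b.
have E0b b : rgen E0 `<=` rgen ((E0 `|` below b) `|` [set e b]).
  by apply: rgen_mono => y; left; left.
pose Q y := rgen E0 y \/ exists2 b, V b & rgen ((E0 `|` below b) `|` [set e b]) y.
have op (o : S -> S -> S) : (forall E u v, rgen E u -> rgen E v -> rgen E (o u v)) ->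
    forall u v, Q u -> Q v -> Q (o u v).
  move=> ro u v [Eu|[b Vb bu]] [Ev|[c Vc cv]].
  - by left; exact: ro.
  - by right; exists c => //; apply: ro => //; exact: E0b.
  - by right; exists b => //; apply: ro => //; exact: E0b.
  - right; have [bc|bc|cb] := tot b c.
    + by exists c => //; apply: ro => //; exact: up bc _ _.
    + by exists c => //; apply: ro => //; rewrite -bc.
    + by exists b => //; apply: ro => //; exact: up cb _ _.
elim=> [|y [Ey|[b Vb <-]]|y z _ IHy _ IHz|y z _ IHy _ IHz].
- by left; exact: rgen0.
- by left; exact: rgen_in.
- by right; exists b => //; apply: rgen_in; right.
- by apply: (op (fun u v => u - v)) => // *; exact: rgenB.
- by apply: (op (fun u v => u * v)) => // *; exact: rgenM.
Qed.

(** Adjoin the generators one at a time. The induction below takes E0 = {1}, and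
rings without unit take E0 empty. *)
Lemma free_mod_rgen (E0 J : set S) (V : set I) :
  E0 `<=` [set 1] -> (forall b c, lt b c -> V c -> V b) ->
  subgroup J -> J `<=` rgen (E0 `|` e @` V) ->
  (forall a x, rgen1 (e @` V) a -> J x -> J (a * x)) ->
  (forall (m : int) x, m != 0 -> rgen (E0 `|` e @` V) x -> J (x *~ m) -> J x) ->
  (forall c, V c -> forall J', pure_ideal (below c) J' ->
    free_mod (rgen1 (below c)) J') ->
  free_mod (rgen (E0 `|` e @` V)) (sumset (rgen E0) J).
Proof.
move=> E01 Vdown sJ JH J_mul pure free.
have [wf tr tot] := wo.
pose I' := {c | V c}; pose lt' (a b : I') := lt (sval a) (sval b).
pose F (c : I') := sumset (rgen (E0 `|` below (sval c))) J.
pose F' (c : I') := [set h | exists2 x, rgen1 (below (sval c)) x &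
  F c (h - x * e (sval c))].
have sr (E : set S) := subgroup_rgen E.
have sF c : subgroup (F c) by exact: subgroup_sumset.
have belowV (c : I') : below (sval c) `<=` e @` V.
  by move=> _ [d dc <-]; exists d => //; exact: Vdown dc (svalP c).
have belowE0V (c : I') : E0 `|` below (sval c) `<=` E0 `|` e @` V.
  by move=> y [|/belowV]; [left|right].
have below1V (c : I') : rgen1 (below (sval c)) `<=` rgen1 (e @` V).
  by apply: rgen_mono => y [|/belowV]; [left|right].
have lift1 (E E' : set S) : E `<=` E' -> rgen1 E `<=` rgen1 (E0 `|` E').
  by move=> EE'; apply: rgen_mono => y [|/EE']; [left|right; right].
have FH (c : I') h : F c h -> rgen (E0 `|` e @` V) h.
  move=> [w Ew Jw]; rewrite -(subrK w h); apply: subgroupD => //; first exact: JH.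
  exact: rgen_mono (belowE0V c) _ Ew.
have supp W h w (sW : W `<=` V) : rgen (E0 `|` e @` W) w -> J (h - w) ->
    sumset (rgen E0) J h \/ exists b : I', W (sval b) /\ F' b h.
  move=> Ew Jw; have [E0w|[b Wb]] := rgen_support Ew; first by left; exists w.
  move=> /(rgen_adjoin (ee b))[u [v [Eu Ev wuv]]].
  right; exists (exist _ b (sW _ Wb)); split=> //=; exists v.
    by apply: rgen_mono Ev => y [|[/E01|]]; [left|left|right].
  exists u => //=; move: Jw; rewrite wuv.
  by congr (J _); rewrite opprD addrA addrAC.
have wo' : strict_wellorder lt'.
  split=> [a|a b c|a b]; [|exact: tr|].
    rewrite /lt'; have : Acc lt (sval a) by exact: wf.
    move: {2}(sval a) (erefl (sval a)) => k ka; rewrite ka => acc.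
    elim: acc a ka => {}k _ IH a ka; constructor=> b; rewrite ka => bk.
    exact: IH bk _ erefl.
  rewrite /lt'; case: a b => [a Va] [b Vb] /=.
  have [?|?|?] := tot a b; [exact: Or31| |exact: Or33].
  by apply: Or32; exact: eq_exist.
have sL : subgroup (sumset (rgen E0) J) by exact: subgroup_sumset.
refine (free_filtration (F := F) (F' := F') wo' sL (sr _) sF _ _ _ _ _ _).
- move=> c h [w Ew Jw]; exists w => //; apply: rgen_mono Ew => y; by left.
- move=> b c bc h [x Ex [w Ew Jw]]; exists (w + x * e (sval b)).
    apply: subgroupD => //.
      apply: rgen_mono Ew => y [|[d db <-]]; [by left|right].
      by exists d => //; exact: tr bc.
    apply: (@rgen1_mul _ (E0 `|` below (sval c))).
      apply: lift1 Ex => _ [d db <-]; exists d => //; exact: tr bc.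
    by apply: rgen_in; right; exists (sval b).
  by rewrite opprD addrA addrAC.
- move=> c h [x Ex /FH Fx]; rewrite -(subrK (x * e (sval c)) h).
  apply: subgroupD => //; apply: rgen1_mul; last first.
    by apply: rgen_in; right; exists (sval c) => //; exact: svalP.
  by apply: lift1 Ex; exact: belowV.
- move=> c h [w Ew Jw].
  have [|?|[b [bc ?]]] := supp _ h w _ Ew Jw; [|by left|by right; exists b].
  by move=> d dc; exact: Vdown dc (svalP c).
- move=> h Eh; have [//||?|[b [_ ?]]] := supp V h h _ Eh; last 2 first.
  + by left.
  + by right; exists b.
  + by rewrite subrr; exact: sJ.1.
- move=> c; apply: free_mod_adjoin => //; last by apply: free; exact: svalP.
  + move=> a x Ea [w Ew Jw]; exists (a * w).
      by apply: rgen1_mul => //; apply: lift1 Ea.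
    by rewrite -mulrBr; apply: J_mul => //; exact: below1V Ea.
  + move=> n x n0 Ex [w Ew Jw].
    apply: (rgen_purity (E' := E0 `|` e @` V) (n := n) (y := w)) => //.
    * by move=> _ [/E01 ->|[d _ <-]] //; exact: mul1r.
    * move=> a z Ea Jz; apply: J_mul => //.
      by apply: rgen_mono Ea => y [|[/E01|]]; [left|left|right].
    * apply: rgen1_mul; last first.
        by apply: rgen_in; right; exists (sval c) => //; exact: svalP.
      by apply: lift1 Ex; exact: belowV.
Qed.

(** Bergman's induction: the steps from Z + J to rgen1 (below b) have quotients of
the same kind with a smaller index. The quotient of Z + J by J is 0 or Z because
J is pure. *)
Lemma free_mod_below b J : pure_ideal (below b) J -> free_mod (rgen1 (below b)) J.
Proof.
have [wf tr _] := wo.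
elim/(well_founded_ind wf): b J => b IH J [sJ JE J_mul pure].
have sZ : subgroup (sumset (rgen [set 1 : S]) J).
  by apply: subgroup_sumset => //; exact: subgroup_rgen.
have rgen1P (w : S) : rgen [set 1] w -> exists n : int, w = 1 *~ n.
  elim=> [|x ->|x y _ [m ->] _ [n ->]|x y _ [m ->] _ [n ->]].
  - by exists 0.
  - by exists 1.
  - by exists (m - n); rewrite mulrzBr.
  - by exists (m * n); rewrite intrM.
apply: (free_mod_trans (M := sumset (rgen [set 1]) J)) => //.
- exact: subgroup_rgen.
- by move=> x Jx; exists 0; [exact: rgen0|rewrite subr0].
- move=> x [w Ew Jw]; rewrite -(subrK w x); apply: subgroupD.
  + exact: subgroup_rgen.
  + exact: JE.
  + by apply: rgen_mono Ew => y; left.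
- by apply: free_mod_rgen => // c d cd db; exact: tr db.
- have [J1|nJ1] := pselect (J 1).
    exists void, (lin (fun i : void => 0)); split=> [c|c _|h [w /rgen1P[n ->] Jn]].
    + by apply: subgroup_sum => // -[].
    + by apply: dsum_eqP => -[].
    + exists 0; rewrite raddf0 subr0 -(subrK (1 *~ n) h).
      by apply: subgroupD => //; exact: subgroup_mulz.
  have linE (c : dsum (fun _ : unit => int)) : lin (fun=> 1 : S) c = 1 *~ c tt.
    rewrite [LHS](@dliftE _ _ _ _ [:: (tt : {classic unit})]) //; last by case=> _; rewrite inE eqxx.
    by rewrite big_seq1.
  exists unit, (lin (fun=> 1)); split=> [c|c|h [w /rgen1P[n ->] Jn]].
  - rewrite linE; exists (1 *~ c tt); last by rewrite subrr; exact: sJ.1.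
    by apply: subgroup_mulz; [exact: subgroup_rgen|exact: rgen_in].
  - rewrite linE => Jc; apply: dsum_eqP => -[]; apply/eqP/negPn/negP => c0.
    by apply: nJ1; apply: pure Jc => //; apply: rgen_in; left.
  - exists (single (V := fun=> int) (a := tt) n).
    by rewrite linE /= single_same.
Qed.
End Nobeling.

(** Noebeling's theorem in Bergman's form. With no constants in the base, the
filtration starts at 0. *)
Theorem free_idempotents (S : comPzRingType) (E : set S) :
  (forall x, E x -> idem x) -> (forall (n : int) (x : S), n != 0 -> x *~ n = 0 -> x = 0) ->
  free_mod (rgen E) [set 0].
Proof.
move=> iE tf; pose e (i : {x | E x}) := sval i.
have [lt wo] := wellorder_exists {x | E x}.
have ee i : idem (e i) by apply: iE; exact: svalP.
have imE : E = set0 `|` e @` setT.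
  rewrite set0U; apply/seteqP; split=> [x Ex|_ [i _ <-]]; last exact: svalP.
  by exists (exist _ x Ex).
have sum0 : sumset (rgen (set0 : set S)) [set 0] = [set 0].
  apply/seteqP; split=> x /= => [[w Ew]|->]; last first.
    by exists 0; [exact: rgen0|rewrite subrr].
  suff -> : w = 0 by rewrite subr0.
  elim: Ew => // [y z _ -> _ ->|y z _ -> _ _]; first exact: subrr.
  exact: mul0r.
rewrite imE -sum0; apply: (free_mod_rgen wo ee) => //.
- exact: subgroup0.
- by move=> _ ->; exact: rgen0.
- by move=> a x _ ->; rewrite /= mulr0.
- by move=> m x m0 _; exact: tf.
- by move=> c _ J; exact: free_mod_below.
Qed.

(** * Compactly supported functions *)

Lemma inj_surj_bijective (T U : Type) (f : T -> U) :
  injective f -> (forall u, exists t, f t = u) -> bijective f.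
Proof.
move=> fi /choice[g gK]; exists g => // t; exact/fi/gK.
Qed.

(** If P K fails, then the sets A such that P (K \ A) form a proper filter. It has a
cluster point in K, although the complement of a neighbourhood U of that point
with P U belongs to the filter. *)
Lemma compact_ind (Y : topologicalType) (K : set Y) (P : set Y -> Prop) :
  compact K -> P set0 -> (forall A B, P A -> P B -> P (A `|` B)) ->
  (forall A B, A `<=` B -> P B -> P A) ->
  (forall y, K y -> exists2 U, nbhs y U & P U) -> P K.
Proof.
move=> cK P0 PU Pmono Ploc; apply: contrapT => nPK.
pose F : set_system Y := [set A | P (K `\` A)].
have fF : Filter F.
  split; rewrite /F /=.
  - by apply: Pmono P0 => y [_ /(_ I)].
  - move=> A B PA PB; apply: Pmono (PU _ _ PA PB) => y [Ky nAB].
    by have [Ay|?] := pselect (A y); [right; split=> // By; apply: nAB|left].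
  - by move=> A B AB; apply: Pmono => y [Ky nB]; split=> // /AB.
have pF : ProperFilter F by split=> //; rewrite /F /= setD0.
have [|y [Ky cly]] := cK F pF.
  by apply: Pmono P0 => y [].
have [U yU PU'] := Ploc y Ky.
have [|z [nUz /nUz //]] := cly (~` U) U _ yU.
by apply: Pmono PU' => z [_ /contrapT].
Qed.

Section CcFree.
Variable Y : topologicalType.
Implicit Types f g : Y -> int.

Lemma Cc_sub_support f g : f \in @Cc_pred Y ->
  (forall y, f y = 0 -> g y = 0) ->
  (forall y, \forall z \near y, g z = g y) -> g \in @Cc_pred Y.
Proof.
move=> /asboolP[_ kf] fg cg; apply/asboolP; split; first exact/cts_discrete.
apply: (subclosed_compact _ kf); first exact: closed_closure.
apply: closure_subset => y /=; exact/contra_neq/fg.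
Qed.

(** By compactness f takes finitely many values, and it is a combination of the
indicators of its level sets. *)
Lemma Cc_span f : f \in @Cc_pred Y ->
  rgen [set g | idem g /\ g \in @Cc_pred Y] f.
Proof.
move=> Cf; have [cf kf] := asboolP _ Cf.
have {}cf := (cts_discrete f).1 cf.
have [D0 hD0] : exists D : seq int, forall y, fsupport f y -> f y \in D.
  apply: (compact_ind (P := fun A => exists D : seq int, forall y, A y -> f y \in D) kf).
  - by exists [::].
  - move=> A B [D hD] [D' hD']; exists (D ++ D') => y.
    by rewrite mem_cat => -[/hD ->|/hD' ->]; rewrite ?orbT.
  - by move=> A B AB [D hD]; exists D => y /AB/hD.
  - move=> y _; exists [set z | f z = f y]; first exact: cf.
    by exists [:: f y] => z /= ->; rewrite inE.
pose D := undup D0.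
have -> : f = \sum_(k <- D | k != 0) (fun y => (f y == k)%:R : int) *~ k.
  apply/funext => y; rewrite fct_sumE.
  have E k : ((fun y => (f y == k)%:R : int) *~ k) y = if f y == k then f y else 0.
    have -> : ((fun y => (f y == k)%:R : int) *~ k) y = (f y == k)%:R *~ k.
      have M m (h : Y -> int) : (h *+ m) y = h y *+ m.
        by elim: m => [|m IH]; rewrite ?mulr0n // !mulrS -IH.
      by case: k => m; [exact: M|rewrite NegzE !mulrNz; congr (- _); exact: M].
    by case: eqP => [->|_]; rewrite ?mul0rz // intz.
  rewrite (eq_bigr _ (fun k _ => E k)) -big_mkcondr /=.
  have [f0|f0] := eqVneq (f y) 0.
    by rewrite f0 big1.
  have fD : f y \in D by rewrite mem_undup; apply: hD0; exact: subset_closure.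
  rewrite -big_filter (_ : [seq _ <- _ | _] = [:: f y]) ?big_seq1 //.
  rewrite -[RHS](filter_pred1_uniq (undup_uniq D0) fD).
  by apply: eq_filter => k /=; rewrite [RHS]eq_sym; case: (f y =P k) => [<-|]; rewrite ?f0 // andbF.
apply: subgroup_sum => [|k k0]; first exact: subgroup_rgen.
apply: subgroup_mulz; first exact: subgroup_rgen.
apply: rgen_in; split.
  by apply/funext => y; rewrite /GRing.mul /=; case: eqP; rewrite ?mulr1 ?mulr0.
apply: (Cc_sub_support Cf) => [y ->|y]; first by rewrite eq_sym (negPf k0).
by apply: filterS (cf y) => z ->.
Qed.

Lemma Cc_free : free_abelian (Cc Y).
Proof.
pose E : set (Y -> int) := [set g | idem g /\ g \in @Cc_pred Y].
have sub : rgen E `<=` [set g | g \in @Cc_pred Y].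
  move=> f; elim=> [|g []//|g h _ IHg _ IHh|g h _ IHg _ IHh] /=.
  - exact: rpred0.
  - exact: rpredB.
  - have [/asboolP[/cts_discrete cg _] /asboolP[/cts_discrete ch _]] := (IHg, IHh).
    apply: (Cc_sub_support IHg) => [y gy|y]; first by rewrite /GRing.mul /= gy mul0r.
    by apply: filterS2 (cg y) (ch y) => z gz hz; rewrite /GRing.mul /= gz hz.
have [|n x n0 xn|B [s [sE inj surj]]] := @free_idempotents _ E.
- by move=> x [].
- apply/funext => y; apply/eqP; move/(congr1 (@^~ y))/eqP: xn.
  have -> : (x *~ n) y = x y *~ n.
    have M m (h : Y -> int) : (h *+ m) y = h y *+ m.
      by elim: m => [|m IH]; rewrite ?mulr0n // !mulrS -IH.
    by case: n {n0} => m; [exact: M|rewrite NegzE !mulrNz; congr (- _); exact: M].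
  by rewrite mulrz_eq0 (negPf n0).
pose t c : Cc Y := MkCc (sub _ (sE c)).
have t_add : zmod_morphism t by move=> c d; apply: val_inj; rewrite /= raddfB.
exists B, (HB.pack t (GRing.isZmodMorphism.Build _ _ t t_add) : {additive _ -> _}).
apply: inj_surj_bijective => [c d /= cd|f] /=.
  apply/eqP; rewrite -subr_eq0; apply/eqP/inj; rewrite /= raddfB.
  by rewrite -[s c]/(val (t c)) cd subrr.
have [c /= /eqP] := surj f (Cc_span (cc_valP f)).
by rewrite subr_eq0 => /eqP sc; exists c; apply: val_inj; rewrite /= sc.
Qed.
End CcFree.

(** * Valued groups and critical points *)

Section Valued.
Variables (Omega : topologicalType) (G : zmodType) (X : set Omega).
Variable v : Omega -> G -> int.
Implicit Types (C : set Omega) (g h : G) (P Q : Omega).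

Definition nonneg g := forall P, 0 <= (v P g).

(** The properties of Inv_X(D) on which the combinatorial part rests. The functions
are defined on all of Omega and vanish outside X, which makes their supports
subsets of X. *)
Record valued_group := {
  vB : forall P g h, v P (g - h) = v P g - v P h;
  v_out : forall P g, ~ X P -> v P g = 0;
  v_inf : forall g h, exists k, forall P, v P k = Num.min (v P g) (v P h);
  v_faithful : forall g, (forall P, v P g = 0) -> g = 0;
  v_open : forall g, nonneg g -> open [set P | v P g != 0];
  v_compact : forall g, nonneg g -> compact [set P | v P g != 0];
  v_zero_near : forall g P, nonneg g -> X P -> v P g = 0 -> \forall Q \near P, v Q g = 0;
  v_basis : forall P U, X P -> nbhs P U ->
    exists g, [/\ nonneg g, v P g != 0 & forall Q, v Q g != 0 -> U Q];
  v_unit : forall P, X P -> exists2 g, nonneg g & v P g = 1 }.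

Hypothesis vG : valued_group.

Lemma v0 P : v P 0 = 0.
Proof. by rewrite -(subrr 0) (vB vG) subrr. Qed.

Lemma vN P g : v P (- g) = - v P g.
Proof. by rewrite -sub0r (vB vG) v0 sub0r. Qed.

Lemma vD P g h : v P (g + h) = v P g + v P h.
Proof. by rewrite -{1}[h]opprK (vB vG) vN opprK. Qed.

Lemma vMz P g n : v P (g *~ n) = v P g * n.
Proof.
have M m : v P (g *+ m) = v P g * m%:Z.
  elim: m => [|m IH]; first by rewrite mulr0n v0 mulr0.
  by rewrite mulrS vD IH -add1n PoszD mulrDr mulr1.
by case: n => m; rewrite ?NegzE ?mulrNz ?vN M // mulrN.
Qed.

Lemma v_sup g h : exists k, forall P, v P k = Num.max (v P g) (v P h).
Proof.
have [k hk] := v_inf vG (- g) (- h); exists (- k) => P.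
rewrite !vN hk !vN; lia.
Qed.

(** As |g| has the support of g, properties of the supports of positive elements
extend to all elements. *)
Lemma v_abs g : exists2 k, nonneg k & forall P, v P k = `|v P g|.
Proof.
have [k hk] := v_sup g (- g).
have E P : v P k = `|v P g| by rewrite hk vN; case: (ger0P (v P g)) => ?; lia.
by exists k => // P; rewrite E.
Qed.

Lemma supp_openW g : open [set P | v P g != 0].
Proof.
have [k k0 kE] := v_abs g; have := v_open vG k0; congr open.
by apply/seteqP; split=> P /=; rewrite kE normr_eq0.
Qed.

Lemma supp_compactW g : compact [set P | v P g != 0].
Proof.
have [k k0 kE] := v_abs g; have := v_compact vG k0; congr compact.
by apply/seteqP; split=> P /=; rewrite kE normr_eq0.
Qed.

Lemma zero_nearW g P : X P -> v P g = 0 -> \forall Q \near P, v Q g = 0.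
Proof.
have [k k0 kE] := v_abs g => XP gP.
have /(v_zero_near vG k0 XP) : v P k = 0 by rewrite kE gP.
by apply: filterS => Q; rewrite kE => /eqP; rewrite normr_eq0 => /eqP.
Qed.

Lemma nonzero_near g P : v P g != 0 -> \forall Q \near P, v Q g != 0.
Proof. by move=> gP; apply: open_nbhs_nbhs; split=> //; exact: supp_openW. Qed.

Lemma v_in P g : v P g != 0 -> X P.
Proof. by move=> /eqP gP; apply: contrapT => /(v_out vG)/gP. Qed.

Definition vanish C g := forall P, C P -> v P g = 0.

(** The supports of positive elements form a basis of X, so this is closedness in X;
the algebraic part uses the element g itself. *)
Definition closedX C :=
  C `<=` X /\ forall P, X P -> ~ C P -> exists g, [/\ nonneg g, v P g != 0 & vanish C g].

(** The analogue of the critical maximal ideals, see [crit_stepE]: 0-1 valued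
functions on C play the role of radical ideals. *)
Definition critical_points C : set Omega :=
  [set P | C P /\ ~ exists2 g, (forall Q, C Q -> v Q g = 0 \/ v Q g = 1) & v P g = 1].

Lemma critical_points_sub C : critical_points C `<=` C. Proof. by move=> P []. Qed.

Lemma critical_points_vanish C g : (forall Q, C Q -> v Q g = 0 \/ v Q g = 1) -> vanish (critical_points C) g.
Proof.
by move=> g01 P [CP nP]; case: (g01 P CP) => // gP; case: nP; exists g.
Qed.

Lemma subgroup_vanish C : subgroup (vanish C).
Proof.
split=> [P _|g h g0 h0 P CP]; first exact: v0.
by rewrite (vB vG) g0 // h0.
Qed.

Lemma closedX_X : closedX X.
Proof. by split. Qed.

Lemma closedX_critical_points C : closedX C -> closedX (critical_points C).
Proof.
move=> [CX clC]; split=> [P /critical_points_sub/CX //|P XP nP].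
have [CP|nCP] := pselect (C P); last first.
  have [g [g0 gP gC]] := clC P XP nCP; exists g; split=> // Q /critical_points_sub; exact: gC.
have [g g01 gP] : exists2 g, (forall Q, C Q -> v Q g = 0 \/ v Q g = 1) & v P g = 1.
  by apply: contrapT => ng; apply: nP.
have [k k0 kE] := v_abs g.
exists k; split=> //; first by rewrite kE gP.
by move=> Q /(critical_points_vanish g01); rewrite kE => ->.
Qed.

Lemma closedX_bigcap (I : Type) (D : set I) (C : I -> set Omega) :
  D !=set0 -> (forall i, D i -> closedX (C i)) -> closedX (\bigcap_(i in D) C i).
Proof.
move=> [i0 Di0] clC; split=> [P /(_ _ Di0)|P XP nP]; first by apply (clC i0 Di0).1.
have [i [Di nCi]] : exists i, D i /\ ~ C i P.
  by apply: contrapT => ni; apply: nP => i Di; apply: contrapT => ?; apply: ni; exists i.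
have [g [g0 gP gC]] := (clC i Di).2 P XP nCi.
by exists g; split=> // Q /(_ _ Di); exact: gC.
Qed.

(** Each point of the support of g lies outside some C i, hence has a neighbourhood
outside C i. The support is compact and the C i form a chain, so one index i
serves for the whole support. *)
Lemma vanish_bigcap (I : Type) (D : set I) (C : I -> set Omega) g :
  D !=set0 -> (forall i, D i -> closedX (C i)) ->
  (forall i j, D i -> D j -> C i `<=` C j \/ C j `<=` C i) ->
  vanish (\bigcap_(i in D) C i) g -> exists2 i, D i & vanish (C i) g.
Proof.
move=> [i0 Di0] clC tot gC.
suff [i Di hi] : exists2 i, D i & forall Q, v Q g != 0 -> ~ C i Q.
  by exists i => // Q CQ; apply/eqP/negPn/negP => /hi.
apply: (compact_ind (P := fun A => exists2 i, D i & forall Q, A Q -> ~ C i Q)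
  (@supp_compactW g)) => [|A B [i Di iA] [j Dj jB]|A B AB [i Di iB]|P gP].
- by exists i0.
- have [ij|ji] := tot i j Di Dj.
    by exists i => // Q [/iA|/jB jQ /ij].
  by exists j => // Q [/iA iQ /ji|/jB].
- by exists i => // Q /AB/iB.
- have [i [Di nCi]] : exists i, D i /\ ~ C i P.
    apply: contrapT => ni; move: gP; rewrite /= gC ?eqxx // => i Di.
    by apply: contrapT => ?; apply: ni; exists i.
  have [h [_ hP hC]] := (clC i Di).2 P (v_in gP) nCi.
  exists [set Q | v Q h != 0]; first exact: nonzero_near.
  by exists i => // Q /= /eqP hQ /hC.
Qed.

Section Step.
Variables C C' : set Omega.
Hypotheses (clC : closedX C) (CC' : C' = critical_points C).
Let Y := C `\` C'.

Let valY (y : Y) : Omega := set_val y.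

Lemma valY_in (y : Y) : C (valY y) /\ ~ C' (valY y).
Proof. by rewrite /valY; case: y => y yP; have /= [] := set_mem yP. Qed.

Lemma near_val (y : Y) (U : set Omega) : nbhs (valY y) U -> nbhs y [set z | U (valY z)].
Proof. exact: (@initial_continuous _ _ (set_val : Y -> Omega)). Qed.

Lemma near_valP (y : Y) (A : set Y) : nbhs y A ->
  exists2 U, nbhs (valY y) U & forall z, U (valY z) -> A z.
Proof.
move=> [B [[U oU UB] By BA]]; exists U.
  by apply: open_nbhs_nbhs; split=> //; move: By; rewrite /= -UB.
by move=> z Uz; apply: BA; rewrite -UB.
Qed.

Lemma indicator_near (y : Y) : exists e, [/\ forall Q, C Q -> v Q e = 0 \/ v Q e = 1,
  vanish C' e & v (valY y) e = 1].
Proof.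
have [Cy nCy] := valY_in y.
have [e e01 ey] : exists2 g, (forall Q, C Q -> v Q g = 0 \/ v Q g = 1) & v (valY y) g = 1.
  by apply: contrapT => ng; apply: nCy; rewrite CC'.
by exists e; split=> //; rewrite CC'; exact: critical_points_vanish.
Qed.

Definition restr g : Y -> int := fun y => v (valY y) g.
Fact restr_is_additive : zmod_morphism restr.
Proof. by move=> g h; apply/funext => y; rewrite /restr (vB vG). Qed.
HB.instance Definition _ := GRing.isZmodMorphism.Build G (Y -> int) restr
  restr_is_additive.

(** If e is 0-1 valued on C with e(y) = 1, then g - g(y) e vanishes at y and hence
near y, so g is constant near y in Y. The support of the restriction is compact
because it is the trace of the support of g on the closed set C. *)
Lemma restr_Cc g : vanish C' g -> restr g \in @Cc_pred Y.
Proof.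
move=> gC'; have lc (y : Y) : \forall z \near y, restr g z = restr g y.
  have [e [e01 _ ey]] := indicator_near y.
  set n := restr g y.
  have XY : X (valY y) by apply: clC.1; exact: (valY_in y).1.
  have /(zero_nearW XY) : v (valY y) (g - e *~ n) = 0.
    by rewrite (vB vG) vMz ey mul1r subrr.
  have : v (valY y) e != 0 by rewrite ey.
  move=> /nonzero_near /near_val near1 /near_val near2.
  apply: filterS2 near1 near2 => z /= ez; rewrite (vB vG) vMz.
  have [|->] := e01 _ (valY_in z).1; first by move/eqP: ez.
  by rewrite mul1r => /eqP; rewrite subr_eq0 => /eqP.
apply/asboolP; split; first exact/cts_discrete.
have cl : closed [set y : Y | restr g y != 0].
  rewrite -[X in closed X]setCK; apply: open_closedC.
  rewrite openE => y /= /negP/negPn/eqP gy.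
  by apply: filterS (lc y) => z /= ->; rewrite gy eqxx.
rewrite /fsupport -(closure_id _).1 //.
move=> F pF FK.
have [|P [/= gP clP]] := @supp_compactW g (valY @ F) _.
  exact: FK.
have CP : C P.
  apply: contrapT => /(clC.2 P (v_in gP))[h [_ hP hC]].
  have [|_ [[z _ <-]]] := clP (valY @` setT) _ _ (nonzero_near hP).
    by apply: (@filterS _ F _ setT) filterT => z _; exists z.
  by rewrite /= hC ?eqxx //; exact: (valY_in z).1.
have YP : Y P by split=> // /gC' g0; rewrite g0 in gP.
pose y : Y := SigSub (mem_set YP).
exists y; split=> // A B FA /near_valP[U UP UB].
have [|Q [[z Az <-] Uz]] := clP (valY @` A) U _ UP.
  by apply: (@filterS _ F _ A) FA => z Az; exists z.
by exists z; split=> //; exact: UB.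
Qed.

(** The support of f is covered by finitely many sets on which f is constant and
whose indicators on C come from G. These are combined into a function equal to f
after the sets have been made disjoint. *)
Lemma restr_surj (f : Cc Y) : exists2 g, vanish C' g & restr g = f.
Proof.
have /asboolP[/cts_discrete cf kf] := cc_valP f.
pose good (p : G * int) := [/\ forall Q, C Q -> v Q p.1 = 0 \/ v Q p.1 = 1,
  vanish C' p.1 & forall y : Y, v (valY y) p.1 = 1 -> f y = p.2].
have [r hr cov] : exists2 r : seq (G * int), forall p, p \in r -> good p &
    forall y, fsupport f y -> exists2 p, p \in r & v (valY y) p.1 = 1.
  apply: (compact_ind (P := fun A => exists2 r : seq (G * int),
    forall p, p \in r -> good p & forall y, A y -> exists2 p, p \in r & v (valY y) p.1 = 1) kf).
  - by exists [::].
  - move=> A B [r hr Ar] [t ht Bt]; exists (r ++ t).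
      by move=> p; rewrite mem_cat => /orP[/hr|/ht].
    move=> y [/Ar|/Bt] [p pr py]; exists p => //; rewrite mem_cat pr ?orbT //.
  - by move=> A B AB [r hr Br]; exists r => // y /AB/Br.
  - move=> y _; have [e [e01 eC' ey]] := indicator_near y.
    have [U Uy hU] := near_valP (cf y).
    have XY : X (valY y) by apply: clC.1; exact: (valY_in y).1.
    have [g [g0 gy gU]] := v_basis vG XY Uy.
    have [k hk] := v_inf vG e g.
    have k01 Q : C Q -> v Q k = 0 \/ v Q k = 1.
      by move=> /e01; rewrite hk; move: (g0 Q); lia.
    exists [set z | v (valY z) k != 0].
      by apply: (near_val (U := [set Q | v Q k != 0])); apply: nonzero_near; rewrite hk ey; move: (g0 (valY y)) gy; lia.
    exists [:: (k, f y)] => [p|z /= kz].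
      rewrite inE => /eqP ->; split=> //= [Q /eC'|z]; first by rewrite hk => ->; move: (g0 Q); lia.
      rewrite hk => kz; apply: hU; apply: gU; move: kz; lia.
    exists (k, f y); first by rewrite inE.
    by case: (k01 _ (valY_in z).1) => // kz0; rewrite kz0 in kz.
(* E is the indicator of the union of the pieces treated so far, and g is equal
   to f there; e - min (e, E) is the part of a new piece that is not yet covered *)
have [E [g [E01 EC' gC' Eg EY]]] : exists E g, [/\ forall Q, C Q -> v Q E = 0 \/ v Q E = 1,
    vanish C' E, vanish C' g,
    forall y : Y, v (valY y) g = if v (valY y) E == 1 then f y else 0 &
    forall y : Y, (exists2 p, p \in r & v (valY y) p.1 = 1) -> v (valY y) E = 1].
  elim: r hr {cov} => [|[e n] r IH] hr.
    exists 0, 0; split=> [Q _|||y|y [p //]]; rewrite ?v0 //; first by left.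
    - exact: (subgroup_vanish _).1.
    - exact: (subgroup_vanish _).1.
  have [|E [g [E01 EC' gC' Eg EY]]] := IH; first by move=> p pr; apply: hr; rewrite inE pr orbT.
  have [/= e01 eC' en] := hr _ (mem_head _ _).
  have [m hm] := v_inf vG e E.
  exists (E + (e - m)), (g + (e - m) *~ n); split.
  - by move=> Q CQ; rewrite vD (vB vG) hm; move: (E01 Q CQ) (e01 Q CQ); lia.
  - by move=> Q CQ; rewrite vD (vB vG) hm EC' // eC'.
  - by move=> Q CQ; rewrite vD vMz (vB vG) hm EC' // eC' // gC' // mul0r.
  - move=> y; have Cy := (valY_in y).1.
    rewrite !vD vMz !vD !vN !hm Eg; have fy := en y.
    have [E0|E1] := E01 _ Cy; have [e0|e1] := e01 _ Cy.
    + by rewrite E0 e0 minxx subrr mul0r !addr0.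
    + by rewrite E0 e1 (_ : Num.min 1 0 = 0) // subr0 mul1r !add0r fy.
    + by rewrite E1 e0 (_ : Num.min 0 1 = 0) // subrr mul0r !addr0.
    + by rewrite E1 e1 minxx subrr mul0r !addr0.
  - move=> y [p]; have Cy := (valY_in y).1.
    rewrite inE vD (vB vG) hm => /predU1P[-> /= ->|pr py].
      by move: (E01 _ Cy); lia.
    by rewrite EY; [move: (e01 _ Cy); lia|exists p].
exists g => //; apply/funext => y; rewrite /restr Eg; case: eqP => // nE.
apply/eqP; rewrite eq_sym; apply/negPn/negP => fy; apply: nE; apply: EY; apply: cov.
exact: subset_closure.
Qed.

(** The group C_c(Y, Z) is free, so its identification with a quotient lifts. *)
Lemma crit_section : exists s : {additive Cc Y -> G},
  (forall f, vanish C' (s f)) /\ forall f, restr (s f) = f.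
Proof.
have [B [f [f' fK f'K]]] := Cc_free Y.
pose vf (c : dsum (fun _ : B => int)) : Y -> int := f c.
have vf_add : zmod_morphism vf by move=> c d; rewrite /vf raddfB.
pose vfa : {additive _ -> _} := HB.pack vf (GRing.isZmodMorphism.Build _ _ vf vf_add).
have [|c|t tC' tE] := @dsum_int_lift B G _ restr (vanish C') vfa.
- exact: subgroup_vanish.
- by have [g gC' gE] := restr_surj (f c); exists g.
have s_add : zmod_morphism (t \o f').
  by move=> a b /=; rewrite -raddfB; congr (t _); apply: (can_inj fK); rewrite raddfB !f'K.
pose sa : {additive Cc Y -> G} :=
  HB.pack (t \o f') (GRing.isZmodMorphism.Build _ _ (t \o f') s_add).
exists sa.
by split=> a //=; rewrite [LHS]tE /= /vf f'K.
Qed.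

Lemma crit_restr g : vanish C' g -> exists f : Cc Y, restr g = f.
Proof. by move=> gC'; exists (MkCc (restr_Cc gC')). Qed.

Lemma vanish_restr g : vanish C' g -> restr g = 0 -> vanish C g.
Proof.
move=> gC' g0 P CP; have [/gC' //|nP] := pselect (C' P).
have YP : Y P by [].
exact: (congr1 (@^~ (SigSub (mem_set YP) : Y)) g0).
Qed.
End Step.

(** Suppose that all points of C are critical. If h is positive at some point of C,
then h takes a value at least 2 on C, and there is h' >= 0 with 2 h' <= h which
again is positive somewhere on C. Iteration gives h_n with 2^n h_n <= h_0. By
compactness some point of C lies in the supports of all h_n, and the value of h_0
at this point would be at least 2^n for every n. *)
Lemma critical_points_proper C : closedX C -> C !=set0 -> exists P, C P /\ ~ critical_points C P.
Proof.
move=> clC [P0 CP0]; apply: contrapT => nP.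
have critC P : C P -> critical_points C P.
  by move=> CP; apply: contrapT => ncP; apply: nP; exists P.
pose T := {h : G | nonneg h /\ exists2 Q, C Q & 1 <= v Q h}.
pose R (h k : T) := forall P, 2 * v P (sval k) <= v P (sval h).
have step (t : T) : {t' : T | R t t'}.
  apply: cid; case: t => h [h0 [Q CQ hQ]].
  have [u u0 uQ] := v_unit vG (clC.1 _ CQ).
  have [u1 hu1] := v_inf vG u h.
  have [Q' CQ' hQ'] : exists2 Q', C Q' & 2 <= v Q' h.
    apply: contrapT => nQ'; case: (critC Q CQ) => _; apply; exists u1.
      move=> Q' CQ'; have : ~ 2 <= v Q' h by move=> hQ'; apply: nQ'; exists Q'.
      by move: (h0 Q') (u0 Q'); rewrite hu1; lia.
    by rewrite hu1 uQ; lia.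
  have [w w0 wQ'] := v_unit vG (clC.1 _ CQ').
  (* k = max (min (w, h - w), 0) is w where 2 w <= h, and at most h / 2 elsewhere *)
  have [m hm] := v_inf vG w (h - w); have [k hk] := v_sup m 0.
  have kE P : v P k = Num.max (Num.min (v P w) (v P h - v P w)) 0.
    by rewrite hk hm (vB vG) v0.
  have kT : nonneg k /\ exists2 Q, C Q & 1 <= v Q k.
    split=> [P|]; first by rewrite kE; lia.
    by exists Q' => //; rewrite kE wQ'; lia.
  by exists (exist _ k kT) => P /=; rewrite kE; move: (h0 P); lia.
have [u u0 uP] := v_unit vG (clC.1 _ CP0).
have uT : nonneg u /\ exists2 Q, C Q & 1 <= v Q u.
  by split=> //; exists P0 => //; rewrite uP.
have [h [hu hR]] := dependent_choice step (exist _ u uT).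
have h_ge0 n P : 0 <= v P (sval (h n)) by case: (svalP (h n)).
have h_growth n P : (2 ^ n)%:Z * v P (sval (h n)) <= v P u.
  elim: n => [|n IH]; first by rewrite expn0 mul1r hu.
  apply: le_trans IH; rewrite expnSr PoszM -mulrA ler_pM2l ?ltz_nat ?expn_gt0 //.
  exact: hR.
have h_zero P n m : (n <= m)%N -> v P (sval (h n)) = 0 -> v P (sval (h m)) = 0.
  move=> /subnK <- h0; elim: (m - n)%N => // k IH.
  by move: (hR (k + n)%N P) (h_ge0 (k + n).+1 P); rewrite IH addSn; lia.
have [n hn] : exists n, forall Q, v Q u != 0 -> C Q -> v Q (sval (h n)) = 0.
  apply: (compact_ind (P := fun A => exists n, forall Q, A Q -> C Q ->
      v Q (sval (h n)) = 0) (@supp_compactW u)).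
  - by exists 0%N.
  - move=> A B [n An] [m Bm]; exists (maxn n m) => Q [AQ|BQ] CQ.
      by apply: h_zero (An Q AQ CQ); exact: leq_maxl.
    by apply: h_zero (Bm Q BQ CQ); exact: leq_maxr.
  - by move=> A B AB [n Bn]; exists n => Q /AB; exact: Bn.
  - move=> P uPn; have XP := v_in uPn.
    have [CP|nCP] := pselect (C P); last first.
      have [g [_ gP gC]] := clC.2 P XP nCP.
      exists [set Q | v Q g != 0]; first exact: nonzero_near.
      by exists 0%N => Q /= /eqP gQ /gC.
    have [n hn] : exists n, v P (sval (h n)) = 0.
      apply: contrapT => nh; pose n := `|v P u|%N.
      have /eqP hn : v P (sval (h n)) <> 0 by move=> ?; apply: nh; exists n.
      have h1 : 1 <= v P (sval (h n)) by move: (h_ge0 n P) hn; lia.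
      have : (2 ^ n)%:Z <= v P u.
        by apply: le_trans (h_growth n P); rewrite ler_peMr.
      have : (n < 2 ^ n)%N by exact: ltn_expl.
      by rewrite {2}/n; move: (2 ^ n)%N (u0 P); rewrite /n; lia.
    exists [set Q | v Q (sval (h n)) = 0]; first exact: zero_nearW.
    by exists n.
have [_ [Q CQ hQ]] := svalP (h n).
have uQ : v Q u != 0.
  apply/eqP => uQ; have := h_zero Q 0%N n isT; rewrite hu /= uQ => /(_ erefl) e.
  by rewrite e in hQ.
by rewrite hn in hQ.
Qed.

Section Chain.
Context {d : Order.disp_t} {W : orderType d}.
Hypothesis wfW : well_founded (fun a b : W => (a < b)%O).
(* st stands for crit_step X, which agrees with critical_points on closed sets *)
Variables (st : set Omega -> set Omega) (Cr : W -> set Omega).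
Hypotheses (stE : forall C, closedX C -> st C = critical_points C)
  (Cr0 : forall a : W, is_zero a -> Cr a = X)
  (CrS : forall b a : W, is_succ b a -> Cr a = st (Cr b))
  (CrL : forall a : W, is_limit a -> Cr a = \bigcap_(i in [set i | (i < a)%O]) Cr i).
Implicit Types a b c : W.

Lemma ord_cases a : [\/ is_zero a, exists b, is_succ b a | is_limit a].
Proof.
have [?|?] := pselect (is_zero a); first exact: Or31.
by have [?|?] := pselect (exists b, is_succ b a); [exact: Or32|exact: Or33].
Qed.

Lemma not_zero a : ~ is_zero a -> exists b, (b < a)%O.
Proof.
by move=> na; apply: contrapT => nb; apply: na => b; rewrite leNgt; apply/negP => ?; apply: nb; exists b.
Qed.

Lemma exists_succ a b : (a < b)%O -> exists2 c, is_succ a c & (c <= b)%O.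
Proof.
elim/(well_founded_ind wfW): b => b IH ab.
have [[c ac cb]|nc] := pselect (exists2 c, (a < c)%O & (c < b)%O).
  by have [c' ? c'c] := IH c cb ac; exists c' => //; exact: le_trans c'c (ltW cb).
by exists b => //; split=> // c ac; rewrite leNgt; apply/negP => cb; apply: nc; exists c.
Qed.

Lemma closedX_Cr a : closedX (Cr a).
Proof.
elim/(well_founded_ind wfW): a => a IH.
have [a0|[b ba]|al] := ord_cases a.
- by rewrite Cr0 //; exact: closedX_X.
- have clb : closedX (Cr b) by apply: IH; case: ba.
  by rewrite (CrS ba) stE //; exact: closedX_critical_points.
- rewrite CrL //; apply: closedX_bigcap => //.
  by have [b] := not_zero al.1; exists b.
Qed.

Lemma Cr_lt a b : (a < b)%O -> Cr b `<=` st (Cr a).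
Proof.
elim/(well_founded_ind wfW): b => b IH ab.
have [b0|[c cb]|bl] := ord_cases b.
- by have := b0 a; rewrite leNgt ab.
- rewrite (CrS cb); case: (ltgtP a c) => [ac|ca|<- //].
    rewrite (stE (closedX_Cr c)).
    by apply: subset_trans (IH c _ ac); [exact: critical_points_sub|case: cb].
  by have := cb.2 a ca; rewrite leNgt ab.
- have [c ac] := exists_succ ab; rewrite le_eqVlt => /predU1P[cb|cb].
    by case: bl => _ []; exists a; rewrite -cb.
  by rewrite (CrL bl) => P /(_ c cb); rewrite (CrS ac).
Qed.

Lemma Cr_le a b : (a <= b)%O -> Cr b `<=` Cr a.
Proof.
rewrite le_eqVlt => /predU1P[->//|/Cr_lt ab] P /ab.
by rewrite (stE (closedX_Cr a)) => /critical_points_sub.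
Qed.

Let Y b := Cr b `\` st (Cr b).

(** The chain of the subgroups K a below is continuous: at limits this is
[vanish_bigcap]. *)
Lemma vanish_Cr a g : vanish (Cr a) g -> g = 0 \/
  exists2 b, (b < a)%O & vanish (st (Cr b)) g.
Proof.
have [a0|[b ba]|al] := ord_cases a => ga.
- left; apply: (v_faithful vG) => P.
  by have [XP|/(v_out vG)//] := pselect (X P); apply: ga; rewrite Cr0.
- by right; exists b; [case: ba|move: ga; rewrite (CrS ba)].
- rewrite (CrL al) in ga.
  have [||i j _ _|b ba gb] := vanish_bigcap _ _ _ ga.
  + by have [b] := not_zero al.1; exists b.
  + by move=> i _; exact: closedX_Cr.
  + by have [/Cr_le ?|/ltW/Cr_le ?] := leP i j; [right|left].
  + by right; exists b => // P; rewrite (stE (closedX_Cr b)) => /critical_points_sub; exact: gb.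
Qed.

Lemma wo_below c : strict_wellorder (fun a b : {b | (b < c)%O} => (sval a < sval b)%O).
Proof.
split=> [a|a b e|[a ac] [b bc]] /=.
- have : Acc (fun a b : W => (a < b)%O) (sval a) by exact: wfW.
  move: {2}(sval a) (erefl (sval a)) => k ka; rewrite ka => acc.
  elim: acc a ka => {}k _ IH a ka; constructor=> b; rewrite ka => bk.
  exact: IH bk _ erefl.
- exact: lt_trans.
- case: (ltgtP a b) => ab; [exact: Or31|exact: Or33|apply: Or32].
  exact: eq_exist.
Qed.

Let K a : set G := vanish (Cr a).
Let K' a : set G := vanish (st (Cr a)).

Lemma Kmono a b : (a < b)%O -> K' a `<=` K b.
Proof. by move=> /Cr_lt ab g ga P /ab; exact: ga. Qed.

Lemma chain_section a : exists s : {additive Cc (Y a) -> G},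
  [/\ forall x, K' a (s x), forall x, K a (s x) -> x = 0
    & forall g, K' a g -> exists x, K a (g - s x)].
Proof.
have clC := closedX_Cr a; have CC' := stE clC.
have [s [sC' sE]] := crit_section clC CC'.
exists s; split=> // [x sx|g gC'].
  apply: val_inj; rewrite -[LHS]sE; apply/funext => y.
  by apply: sx; exact: (valY_in y).1.
have [x xE] := crit_restr clC CC' gC'; exists x.
have gs : vanish (st (Cr a)) (g - s x) by apply: (subgroup_vanish _).2.
apply: vanish_restr gs _.
apply/funext => y; rewrite /restr (vB vG).
by rewrite -[v _ g]/(restr g y) -[v _ (s x)]/(restr (s x) y) sE xE subrr.
Qed.

(** The section from [crit_section] splits the step of the chain at b, whose
quotient is C_c(Y b, Z). *)
Theorem chain_dsum c : exists f : {additive dsum (fun b : {b | (b < c)%O} =>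
    Cc (Y (sval b))) -> G}, injective f /\ range f = vanish (Cr c).
Proof.
pose s (i : {b | (b < c)%O}) := sval (cid (chain_section (sval i))).
have hs (i : {b | (b < c)%O}) := svalP (cid (chain_section (sval i))).
have sF' (i : {b | (b < c)%O}) x : K' (sval i) (s i x) by case: (hs i) => + _ _; apply.
have sinj (i : {b | (b < c)%O}) x : K (sval i) (s i x) -> x = 0.
  by case: (hs i) => _ + _; apply.
have ssurj (i : {b | (b < c)%O}) h : K' (sval i) h -> exists x, K (sval i) (h - s i x).
  by case: (hs i) => _ _; apply.
exists (dlift s); split.
  move=> x y xy; apply/eqP; rewrite -subr_eq0; apply/eqP.
  refine (@filtration_inj _ _ (wo_below c) _ [set 0]
    (fun i => K (sval i)) (fun i => K' (sval i)) _ s _ _ _ sF' sinj (x - y) _).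
  - by move=> a; exact: subgroup_vanish.
  - by move=> a h ->; exact: (subgroup_vanish _).1.
  - by move=> a b; exact: Kmono.
  - by rewrite /= raddfB xy subrr.
apply/seteqP; split=> [_ [x _ <-]|g gc].
  apply: (@filtration_sub _ _ (vanish (Cr c)) (fun i => K' (sval i))) => //.
  - exact: subgroup_vanish.
  - by move=> i; exact: (Kmono (svalP i)).
have HE h : vanish (Cr c) h -> [set 0] h \/ exists i : {b | (b < c)%O}, K' (sval i) h.
  by move=> /vanish_Cr[->|[b bc hb]]; [left|right; exists (exist _ b bc)].
have FE (i : {b | (b < c)%O}) h : K (sval i) h -> [set 0] h \/
    exists2 j : {b | (b < c)%O}, (sval j < sval i)%O & K' (sval j) h.
  move=> /vanish_Cr[->|[b ba hb]]; [by left|right].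
  by exists (exist _ b (lt_trans ba (svalP i))).
have [x /= /eqP] := filtration_surj (wo_below c) FE HE ssurj gc.
by rewrite subr_eq0 => /eqP ->; exists x.
Qed.

(** The same chain, now with each step decomposed further along a basis of
C_c(Y b, Z). *)
Theorem chain_free c : Cr c = set0 -> free_abelian G.
Proof.
move=> c0.
have vT : vanish (Cr c) = setT by apply/seteqP; split=> // g _ P; rewrite c0.
have wo := wo_below c.
have HE h : setT h -> [set 0] h \/ exists i : {b | (b < c)%O}, K' (sval i) h.
  by rewrite -vT => /vanish_Cr[->|[b bc hb]]; [left|right; exists (exist _ b bc)].
have FE (i : {b | (b < c)%O}) h : K (sval i) h -> [set 0] h \/
    exists2 j : {b | (b < c)%O}, (sval j < sval i)%O & K' (sval j) h.
  move=> /vanish_Cr[->|[b ba hb]]; [by left|right].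
  by exists (exist _ b (lt_trans ba (svalP i))).
have sT : subgroup (setT : set G) by [].
have [||||i|B [s [_ inj surj]]] := free_filtration (F := fun i : {b | (b < c)%O} => K (sval i))
  (F' := fun i => K' (sval i)) wo (subgroup0 G) sT _ _ _ _ FE HE _.
- by move=> i; exact: subgroup_vanish.
- by move=> i _ ->; exact: (subgroup_vanish _).1.
- by move=> i j; exact: Kmono.
- by [].
- have [s [sK' inj surj]] := chain_section (sval i).
  have [B [f [f' fK f'K]]] := Cc_free (Y (sval i)).
  exists B, (s \o f); split=> [x|x /=|h /surj[x hx]] /=.
  + exact: sK'.
  + by move=> /inj fx; rewrite -(fK x) fx -(raddf0 f) fK.
  + by exists (f' x); rewrite /= f'K.
exists B, s; apply: inj_surj_bijective => [x y xy|g].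
  by apply/eqP; rewrite -subr_eq0; apply/eqP/inj; rewrite /= raddfB xy subrr.
have [x /= /eqP] := surj g I.
by rewrite subr_eq0 => /eqP ->; exists x.
Qed.

(** Send a to a point that is lost at the step a. *)
Lemma chain_injection : (forall a, Cr a !=set0) -> exists p : W -> Omega, injective p.
Proof.
move=> Cr_n0.
have pick a : {P | Cr a P /\ ~ st (Cr a) P}.
  have cla := closedX_Cr a.
  by apply: cid; rewrite (stE cla); exact: critical_points_proper.
exists (fun a => sval (pick a)) => a b.
have out x y : (x < y)%O -> sval (pick x) <> sval (pick y).
  move=> xy e; case: (svalP (pick x)) => _; rewrite e; apply.
  by apply: (Cr_lt xy); case: (svalP (pick y)).
by case: (ltgtP a b) => // [/out //|/out ba /esym/ba].
Qed.
End Chain.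
End Valued.

(** Applied to the set of subsets of Spec(D), this gives an ordinal that is too long
for a strictly decreasing sequence of subsets of Spec(D). *)
Lemma wellordered_orderType (T : Type) : exists (d : Order.disp_t) (W : orderType d)
  (f : T -> W), well_founded (fun a b : W => (a < b)%O) /\ injective f.
Proof.
have [lt [wf tr tot]] := wellorder_exists T.
pose T' := {classic T}.
have irr x : ~ lt x x.
  by elim/(well_founded_ind wf): x => x IH x_lt; exact: (IH x).
pose ltb : rel T' := fun x y => `[< lt x y >].
pose leb : rel T' := fun x y => (x == y) || ltb x y.
pose mb x y : T' := if ltb x y then x else y.
pose jb x y : T' := if ltb x y then y else x.
have h1 x y : leb x y = (x == y) || ltb x y by [].
have h4 : irreflexive ltb by move=> x; apply/asboolP; exact: irr.
have h5 : transitive ltb.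
  by move=> y x z /asboolP xy /asboolP yz; apply/asboolP; exact: tr yz.
have h6 x y : x != y -> ltb x y || ltb y x.
  move=> /eqP xy; have [h|//|h] := tot x y; first by rewrite [ltb x y]asboolT.
  by rewrite [ltb y x]asboolT ?orbT.
pose d : Order.disp_t := Order.Disp tt tt.
pose W : orderType d := HB.pack T' (@Order.LtOrder.Build d T' leb ltb mb jb
  h1 (fun x y => erefl) (fun x y => erefl) h4 h5 h6).
have wfW : well_founded (fun a b : W => (a < b)%O).
  move=> a; elim: (wf a) => {}a _ IH; constructor=> b /asboolP; exact: IH.
exists d, W, id; split; [exact: wfW|exact: inj_id].
Qed.

Lemma no_injection_set (T : Type) (q : set T -> T) : ~ injective q.
Proof.
move=> qi; pose D := [set x | exists2 A, q A = x & ~ A x].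
have nD : ~ D (q D) by move=> Dq; case: (Dq) => A /qi -> /(_ Dq).
by apply: (nD); exists D.
Qed.

(** * Fractional ideals *)

Section Submodules.
Variable K : fieldType.
Implicit Types (A : subringClosed K) (I J L : set K).

Lemma idmulS I I' J J' : I `<=` I' -> J `<=` J' -> idmul I J `<=` idmul I' J'.
Proof.
move=> II' JJ'; apply: idmul_sub; [exact: idmul0|exact: idmulD|].
by move=> x y /II' Ix /JJ' Jy; exact: idmul_prod.
Qed.

Lemma submod_sum A I (T : Type) (r : seq T) (P : pred T) (f : T -> K) :
  submod A I -> (forall i, P i -> I (f i)) -> I (\sum_(i <- r | P i) f i).
Proof. by move=> [I0 ID _] h; elim/big_ind: _. Qed.

Lemma idmul_submodl A I J : submod A I -> submod A (idmul I J).
Proof.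
move=> [I0 ID IM]; split; [exact: idmul0|exact: idmulD|move=> a x Aa IJx].
suff /(_ x IJx) : idmul I J `<=` [set z | idmul I J (a * z)] by [].
apply: idmul_sub => /=.
- by rewrite mulr0; exact: idmul0.
- by move=> u v hu hv; rewrite mulrDr; exact: idmulD.
- by move=> u v Iu Jv; rewrite mulrA; apply: idmul_prod => //; exact: IM.
Qed.

Lemma idmul_submodr A I J : submod A J -> submod A (idmul I J).
Proof. by rewrite idmulC; exact: idmul_submodl. Qed.

(** If y is a nonzero element of J, then its numerator is a common denominator
for I. *)
Lemma mk_invertible A I J : is_quotient_field A -> submod A I -> submod A J ->
  (forall x y, I x -> J y -> x * y \in A) -> idmul I J 1 -> invertible A I.
Proof.
move=> qA sI sJ IJA IJ1.
have frac I' J' : submod A I' -> (forall x y, I' x -> J' y -> x * y \in A) ->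
    idmul I' J' 1 -> fractional_ideal A I'.
  move=> sI' IJ' [s hs /eqP]; rewrite eq_sym => s1; split=> //.
  have [y J'y y0] : exists2 y, J' y & y != 0.
    apply: contrapT => ny; move: s1; rewrite big_seq big1 ?(eq_sym 0) ?oner_eq0 //.
    move=> p /hs[_ Jp]; apply/eqP; rewrite mulf_eq0 orbC; apply/orP; left.
    by apply/negPn/negP => p0; apply: ny; exists p.2.
  have [a [b [Aa Ab b0 yab]]] := qA y.
  exists a; split=> // [|x I'x].
    by apply: contra_neq y0 => a0; rewrite yab a0 mul0r.
  have -> : a * x = b * (x * y) by rewrite yab; field.
  by rewrite rpredM // IJ'.
split; first exact: (frac _ J).
exists J.
  by apply: (frac _ I) => // [x y Jx Iy|]; rewrite ?[x * y]mulrC ?(idmulC J) //; exact: IJA.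
apply/seteqP; split.
  by apply: idmul_sub => [|x y|x y]; [exact: rpred0|exact: rpredD|exact: IJA].
move=> x Ax; have [_ _ IM] := idmul_submodl J sI.
by rewrite -[x]mulr1; exact: IM.
Qed.

Lemma invertibleE A I : invertible A I -> exists J,
  [/\ submod A I, submod A J, forall x y, I x -> J y -> x * y \in A & idmul I J 1].
Proof.
move=> [[sI _] [J [sJ _] IJ]]; exists J; split=> // [x y Ix Jy|].
  by have := idmul_prod Ix Jy; rewrite IJ.
by rewrite IJ /=; exact: rpred1.
Qed.

Lemma span_nil A : span A [::] = [set 0].
Proof.
apply/seteqP; split=> x /= => [[c _ ->]|->]; first by rewrite big_ord0.
by exists (fun=> 0) => [i|]; rewrite ?rpred0 // big_ord0.
Qed.

Lemma span_cons A a s x :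
  span A (a :: s) x <-> exists c y, [/\ c \in A, span A s y & x = c * a + y].
Proof.
split=> [[c Ac ->]|[c [_ [Ac [d Ad ->] ->]]]].
  rewrite /= big_ord_recl /=; exists (c 0%N), (\sum_(i < size s) c i.+1 * s`_i).
  by split=> //; exists (fun i => c i.+1).
exists (fun i => if i is j.+1 then d j else c) => [[|i] //|].
by rewrite /= big_ord_recl.
Qed.

Lemma submod_span A s : submod A (span A s).
Proof.
elim: s => [|a s [s0 sD sM]].
  by rewrite span_nil; split=> //= [x y -> ->|c x _ ->]; rewrite ?addr0 ?mulr0.
split=> [|x y /span_cons[c [u [Ac su ->]]] /span_cons[d [w [Ad sw ->]]]|
    b x Ab /span_cons[c [u [Ac su ->]]]]; apply/span_cons.
- by exists 0, 0; rewrite rpred0 mul0r addr0.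
- exists (c + d), (u + w); split; [exact: rpredD|exact: sD|].
  by rewrite mulrDl addrACA.
- exists (b * c), (b * u); split; [exact: rpredM|exact: sM|].
  by rewrite mulrDr mulrA.
Qed.

Lemma span_mem A s x : x \in s -> span A s x.
Proof.
elim: s => // a s IH; rewrite inE => /predU1P[->|/IH sx]; apply/span_cons.
  exists 1, 0; rewrite rpred1 mul1r addr0; split=> //.
  by case: (submod_span A s).
by exists 0, x; rewrite rpred0 mul0r add0r.
Qed.

Lemma span_sub A s I : submod A I -> (forall x, x \in s -> I x) -> span A s `<=` I.
Proof.
move=> [I0 ID IM]; elim: s => [_|a s IH sI]; first by rewrite span_nil => _ ->.
move=> _ /span_cons[c [y [Ac sy ->]]]; apply: ID.
  by apply: IM => //; apply: sI; rewrite inE eqxx.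
by apply: IH => // x xs; apply: sI; rewrite inE xs orbT.
Qed.

(** If 1 is the sum of the x_i y_i, with x_i in I and y_i in the inverse of I, then
the x_i generate: x is the sum of the (x y_i) x_i. *)
Lemma invertible_fg A I : invertible A I -> exists2 s, {in s, forall x, I x} & I = span A s.
Proof.
move=> /invertibleE[J [sI sJ IJA [s hs s1]]].
have sI' : {in map fst s, forall x, I x} by move=> _ /mapP[p /hs[? _] ->].
exists (map fst s) => //; apply/seteqP; split; last exact: span_sub.
move=> x Ix; rewrite -[x]mulr1 s1 mulr_sumr big_seq.
apply: (@submod_sum A) => [|p ps]; first exact: submod_span.
have [Ip Jp] := hs _ ps; rewrite mulrA.
have [_ _ sM] := submod_span A (map fst s).
have -> : x * p.1 * p.2 = (x * p.2) * p.1 by rewrite mulrAC.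
by apply: sM; [exact: IJA|apply: span_mem; exact: map_f].
Qed.

Lemma invertible_neq0 A I : invertible A I -> exists2 x, I x & x != 0.
Proof.
move=> /invertibleE[J [_ _ _ [s hs s1]]]; apply: contrapT => nx.
move/eqP: s1; rewrite big_seq big1 ?oner_eq0 // => p /hs[Ip _].
have -> : p.1 = 0; last by rewrite mul0r.
by apply/eqP/negPn/negP => p0; apply: nx; exists p.1.
Qed.

(** Clear denominators to land in the ideals of A. *)
Lemma invertible_span A s : is_quotient_field A -> prufer A ->
  (exists2 x, x \in s & x != 0) -> invertible A (span A s).
Proof.
move=> qA pA [x xs x0].
have [d [Ad d0 ds]] : exists d, [/\ d \in A, d != 0 & forall y, y \in s -> d * y \in A].
  elim: s {x xs x0} => [|y s [d [Ad d0 ds]]].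
    by exists 1; rewrite rpred1 oner_eq0.
  have [a [b [Aa Ab b0 yab]]] := qA y.
  exists (b * d); split; [exact: rpredM|exact: mulf_neq0|move=> z].
  rewrite inE => /predU1P[->|/ds dz]; last by rewrite -mulrA rpredM.
  have -> : b * d * y = d * a by rewrite yab; field.
  exact: rpredM.
have sd z : span A (map ( *%R d) s) z <-> span A s (d^-1 * z).
  split=> [|].
    have sm : submod A [set z | span A s (d^-1 * z)].
      have [s0 sD sM] := submod_span A s; split=> /= [|u w hu hw|c u Ac hu].
      - by rewrite mulr0.
      - by rewrite mulrDr; exact: sD.
      - by rewrite mulrCA; exact: sM.
    apply: (span_sub sm) => _ /mapP[u us ->] /=; rewrite mulKf //; exact: span_mem.
  have sm : submod A [set w | span A (map ( *%R d) s) (d * w)].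
    have [s0 sD sM] := submod_span A (map ( *%R d) s); split=> /= [|u w hu hw|c u Ac hu].
    - by rewrite mulr0.
    - by rewrite mulrDr; exact: sD.
    - by rewrite mulrCA; exact: sM.
  move=> h; rewrite -[z](mulVKf d0); apply: (span_sub sm) h => u us /=.
  by apply: span_mem; exact: map_f.
have /pA/(_ _) : fg_ideal A (span A (map ( *%R d) s)).
  by exists (map ( *%R d) s) => // _ /mapP[y ys ->]; exact: ds.
case/(_ _)/invertibleE => [d_eq0|J [sI sJ IJA IJ1]].
  have : span A (map ( *%R d) s) (d * x) by apply: span_mem; exact: map_f.
  by rewrite d_eq0 /= => /eqP; rewrite mulf_eq0 (negPf d0) (negPf x0).
apply: (mk_invertible (J := [set y | J (d^-1 * y)])) => //.
- exact: submod_span.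
- have [s0 sD sM] := sJ; split=> /= [|u w hu hw|c u Ac hu].
  + by rewrite mulr0.
  + by rewrite mulrDr; exact: sD.
  + by rewrite mulrCA; exact: sM.
- move=> u w su Jw /=.
  have -> : u * w = (d * u) * (d^-1 * w) by field.
  by apply: IJA => //; apply/sd; rewrite mulKf.
- suff : idmul (span A (map ( *%R d) s)) J `<=` idmul (span A s) [set y | J (d^-1 * y)].
    exact.
  apply: idmul_sub; [exact: idmul0|exact: idmulD|move=> u w /sd su Jw].
  have -> : u * w = (d^-1 * u) * (d * w) by field.
  by apply: idmul_prod => //=; rewrite mulKf.
Qed.
End Submodules.

(** * Localizations of a Pruefer domain *)

Local Notation loc := localization.

Section PrimeLoc.
Variables (K : fieldType) (A : subringClosed K).
Implicit Types (P Q : Spec A) (I J : set K).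

Lemma loc1 P : loc P 1. Proof. by case: (localizationP P). Qed.
Lemma locB P x y : loc P x -> loc P y -> loc P (x - y).
Proof. by case: (localizationP P) => _ h _; exact: h. Qed.
Lemma locM P x y : loc P x -> loc P y -> loc P (x * y).
Proof. by case: (localizationP P) => _ _ h; exact: h. Qed.
Lemma loc0 P : loc P 0.
Proof. by rewrite -(subrr 1); apply: locB; exact: loc1. Qed.
Lemma locD P x y : loc P x -> loc P y -> loc P (x + y).
Proof. by move=> lx ly; rewrite -[y]opprK -[- y]sub0r; do 2!apply: locB => //; exact: loc0. Qed.
Lemma loc_in P x : x \in A -> loc P x.
Proof.
by move=> Ax; exists x, 1; rewrite rpred1 divr1; split=> //; case: (spec_prime P).
Qed.
Lemma locX P x n : loc P x -> loc P (x ^+ n).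
Proof. by move=> lx; elim: n => [|n IH]; rewrite ?expr0 ?exprS; [exact: loc1|exact: locM]. Qed.
Lemma loc_inv P b : b \in A -> ~ spec_val P b -> loc P b^-1.
Proof. by move=> Ab Pb; exists 1, b; rewrite rpred1 div1r. Qed.
Lemma submod_loc P : submod A (loc P).
Proof.
by split; [exact: loc0|exact: locD|move=> a x Aa; apply: locM; exact: loc_in].
Qed.

Lemma spec_in P x : spec_val P x -> x \in A.
Proof. by case: (spec_prime P) => -[_ h] _ _ /h. Qed.
Lemma spec_submod P : submod A P.
Proof. by case: (spec_prime P) => -[]. Qed.
Lemma spec_n1 P : ~ spec_val P 1.
Proof. by case: (spec_prime P). Qed.
Lemma specM P x y : x \in A -> y \in A -> spec_val P (x * y) -> spec_val P x \/ spec_val P y.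
Proof. by case: (spec_prime P) => _ _; apply. Qed.
Lemma spec_mul P a x : a \in A -> spec_val P x -> spec_val P (a * x).
Proof. by move=> Aa Px; have [_ _] := spec_submod P; apply. Qed.
Lemma specD P x y : spec_val P x -> spec_val P y -> spec_val P (x + y).
Proof. by have [_ h _] := spec_submod P; exact: h. Qed.
Lemma spec0 P : spec_val P 0. Proof. by case: (spec_submod P). Qed.
Lemma loc_sub P Q : Q `<=` P -> loc P `<=` loc Q.
Proof. by move=> QP _ [a [b [Aa Ab Pb ->]]]; exists a, b; split=> // /QP. Qed.

(** This is PD_P, the maximal ideal of D_P. *)
Definition mloc P : set K := [set x | exists a b, [/\ spec_val P a, b \in A, ~ spec_val P b & x = a / b]].

Lemma mloc_in P x : x \in A -> mloc P x -> spec_val P x.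
Proof.
move=> Ax [a [b [Pa Ab Pb xab]]].
have : spec_val P (x * b) by rewrite xab divfK //; exact: (localization_nz Pb).
by move=> /specM[].
Qed.

Lemma spec_mloc P x : spec_val P x -> mloc P x.
Proof. by move=> Px; exists x, 1; rewrite rpred1 divr1; split=> //; exact: spec_n1. Qed.

Lemma mlocD P x y : mloc P x -> mloc P y -> mloc P (x + y).
Proof.
move=> [a [b [Pa Ab Pb ->]]] [c [d [Pc Ad Pd ->]]].
exists (a * d + c * b), (b * d); split.
- by apply: specD; rewrite mulrC; exact: spec_mul.
- exact: rpredM.
- by move=> /specM[].
- by rewrite addf_div //; exact: (@localization_nz _ _ P).
Qed.

Lemma mlocM P x y : loc P x -> mloc P y -> mloc P (x * y).
Proof.
move=> [a [b [Aa Ab Pb ->]]] [c [d [Pc Ad Pd ->]]].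
exists (a * c), (b * d); split.
- exact: spec_mul.
- exact: rpredM.
- by move=> /specM[].
- by rewrite mulf_div.
Qed.

Lemma mloc_n1 P : ~ mloc P 1.
Proof. by move=> /(mloc_in (rpred1 A))/spec_n1. Qed.

Lemma mloc_inv P x : x != 0 -> mloc P x -> ~ loc P x^-1.
Proof. by move=> x0 mx lx; apply: (@mloc_n1 P); rewrite -(mulVf x0); exact: mlocM. Qed.

Lemma loc_dich P x : loc P x -> mloc P x \/ (x != 0 /\ loc P x^-1).
Proof.
move=> [a [b [Aa Ab Pb ->]]]; have [Pa|nPa] := pselect (spec_val P a).
  by left; exists a, b.
right; have a0 := localization_nz nPa; have b0 := localization_nz Pb.
by split; [rewrite mulf_neq0 ?invr_eq0|exists b, a; rewrite invf_div].
Qed.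

Lemma idmul_loc_den P I z : submod A I -> idmul I (loc P) z ->
  exists s, [/\ s \in A, ~ spec_val P s & I (s * z)].
Proof.
move=> [I0 ID IM]; suff /(_ z) : idmul I (loc P) `<=` [set z | exists s, [/\ s \in A, ~ spec_val P s & I (s * z)]] by [].
apply: idmul_sub => [|x y [s [As Ps Isx]] [t [At Pt Ity]]|x y Ix [a [b [Aa Ab Pb ->]]]] /=.
- by exists 1; rewrite rpred1 mulr0; split=> //; exact: spec_n1.
- exists (s * t); split; [exact: rpredM|by move=> /specM[]|].
  by rewrite mulrDr; apply: ID; [rewrite mulrAC mulrC|rewrite -mulrA]; exact: IM.
- exists b; split=> //; have b0 := localization_nz Pb.
  by rewrite (_ : b * (x * (a / b)) = a * x); [exact: IM|field].
Qed.

Lemma idmul_den_loc P I s z : s \in A -> ~ spec_val P s -> I (s * z) -> idmul I (loc P) z.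
Proof.
move=> As Ps Isz; have s0 := localization_nz Ps.
by rewrite -(mulKf s0 z) mulrC; apply: idmul_prod => //; exact: loc_inv.
Qed.

Lemma idmul_loc_sub P I x : I x -> idmul I (loc P) x.
Proof. by move=> Ix; rewrite -[x]mulr1; apply: idmul_prod => //; exact: loc1. Qed.

Lemma idmul_loc_le P I : I `<=` loc P -> idmul I (loc P) `<=` loc P.
Proof.
move=> IP; apply: idmul_sub; [exact: loc0|exact: locD|].
by move=> x y /IP lx; exact: locM.
Qed.

Lemma loc_idmul_loc P : idmul (loc P) (loc P) = loc P.
Proof.
apply/seteqP; split; first exact: idmul_loc_le.
by move=> x; exact: idmul_loc_sub.
Qed.

Lemma idmul_locM P I x y : loc P x -> idmul I (loc P) y -> idmul I (loc P) (x * y).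
Proof.
move=> lx; rewrite mulrC => Iy.
by rewrite -loc_idmul_loc idmulA; exact: idmul_prod.
Qed.

Lemma idmul_loc_eq P I : I `<=` loc P -> idmul I (loc P) 1 -> idmul I (loc P) = loc P.
Proof.
move=> IP I1; apply/seteqP; split; first exact: idmul_loc_le.
by move=> x lx; rewrite -[x]mulr1; exact: idmul_locM.
Qed.

(** If 1 is the sum of the x_i y_i, with x_i in I and y_i in the inverse of I, then
some x_i y_i is outside P, and this x_i generates I at P. *)
Lemma invertible_loc P I : invertible A I ->
  exists x, [/\ I x, x != 0 & forall z, idmul I (loc P) z <-> loc P (z / x)].
Proof.
move=> /invertibleE[J [sI sJ IJA [s hs s1]]].
have [p ps nPp] : exists2 p, p \in s & ~ spec_val P (p.1 * p.2).
  apply: contrapT => np; apply: (@spec_n1 P); rewrite s1 big_seq.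
  apply: (@submod_sum _ A _ _ _ _ _ (spec_submod P)) => p ps.
  by apply: contrapT => nPp; apply: np; exists p.
have [Ip Jp] := hs _ ps; have := localization_nz nPp.
rewrite mulf_eq0 => /norP[p10 p20].
exists p.1; split=> // z; split.
  suff /(_ z) : idmul I (loc P) `<=` [set z | loc P (z / p.1)] by [].
  apply: idmul_sub => /= [|x y lx ly|x y Ix ly].
  - by rewrite mul0r; exact: loc0.
  - by rewrite mulrDl; exact: locD.
  - rewrite mulrAC; apply: locM => //.
    rewrite (_ : x / p.1 = (x * p.2) / (p.1 * p.2)); last by field; apply/andP.
    by apply: locM; [apply: loc_in; exact: IJA|apply: loc_inv => //; exact: IJA].
move=> lz; rewrite -(divfK p10 z); apply: idmul_locM => //; exact: idmul_loc_sub.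
Qed.
End PrimeLoc.

Section PruferLoc.
Variables (K : fieldType) (D : subringClosed K).
Hypotheses (qD : is_quotient_field D) (pD : prufer D).
Implicit Types (P Q : Spec D) (I J : set K).

Lemma pair_invertible a b : a != 0 \/ b != 0 ->
  exists J, [/\ submod D J, forall y, J y -> a * y \in D /\ b * y \in D
    & exists u w, [/\ J u, J w & 1 = a * u + b * w]].
Proof.
move=> ab0.
have /invertibleE[J [sI sJ IJ IJ1]] : invertible D (span D [:: a; b]).
  apply: invertible_span => //.
  by case: ab0 => ?; [exists a|exists b]; rewrite ?inE ?eqxx ?orbT.
exists J; split=> // [y Jy|].
  by split; apply: IJ => //; apply: span_mem; rewrite !inE eqxx ?orbT.
suff /(_ _ IJ1) : idmul (span D [:: a; b]) J `<=` [set x | exists u w, [/\ J u, J w & x = a * u + b * w]].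
  by [].
have [J0 JD JM] := sJ.
apply: idmul_sub => [|_ _ [u [w [Ju Jw ->]]] [u' [w' [Ju' Jw' ->]]]|x y sx Jy] /=.
- by exists 0, 0; rewrite !mulr0 addr0.
- by exists (u + u'), (w + w'); split; [exact: JD|exact: JD|rewrite !mulrDr addrACA].
- move: sx => /span_cons[c [y1 [Dc + ->]]] => /span_cons[d [y2 [Dd + ->]]].
  rewrite span_nil => ->; exists (c * y), (d * y); split; [exact: JM|exact: JM|ring].
Qed.

(** For x = a / b write 1 = a u + b w with u, w in the inverse of (a, b). One of
a u and b w is outside P. *)
Lemma valuation P x : loc P x \/ loc P x^-1.
Proof.
have [a [b [Da Db b0 ->]]] := qD x.
have [J [sJ JD [u [w [Ju Jw e]]]]] := @pair_invertible a b (or_intror b0).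
have [[au bu] [aw bw]] := (JD _ Ju, JD _ Jw).
have [nau|nbw] : ~ spec_val P (a * u) \/ ~ spec_val P (b * w).
  apply: contrapT => /not_orP[/contrapT pa /contrapT pb].
  by apply: (@spec_n1 _ _ P); rewrite e; exact: specD.
- right; exists (b * u), (a * u); split=> //.
  have := localization_nz nau; rewrite mulf_eq0 => /norP[a0 u0].
  by field; apply/and3P.
- left; exists (a * w), (b * w); split=> //.
  have := localization_nz nbw; rewrite mulf_eq0 => /norP[_ w0].
  by field; apply/andP.
Qed.

Lemma max_comax P s : Max D P -> s \in D -> ~ spec_val P s -> exists d p, [/\ d \in D, spec_val P p & 1 = s * d + p].
Proof.
move=> [iP nP maxP] Ds Ps; apply: contrapT => n1.
pose J := [set x | exists d p, [/\ d \in D, spec_val P p & x = s * d + p]].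
have JP : J = P.
  apply: maxP.
  - split; last by move=> _ [d [p [Dd /spec_in Dp ->]]]; rewrite /= rpredD ?rpredM.
    split=> [|_ _ [d [p [Dd Pp ->]]] [d' [p' [Dd' Pp' ->]]]|a _ Da [d [p [Dd Pp ->]]]].
    + by exists 0, 0; rewrite rpred0 mulr0 addr0; split=> //; exact: spec0.
    + by exists (d + d'), (p + p'); split; [exact: rpredD|exact: specD|ring].
    + by exists (a * d), (a * p); split; [exact: rpredM|exact: spec_mul|ring].
  - move=> JD; apply: n1; have J1 : J 1 by rewrite JD; exact: rpred1.
    exact: J1.
  - by move=> p Pp; exists 0, p; rewrite rpred0 mulr0 add0r.
apply: Ps; rewrite -JP; exists 1, 0; rewrite rpred1 mulr1 addr0; split=> //; exact: spec0.
Qed.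

Lemma max_sub P Q : Max D Q -> Q `<=` P -> P = Q.
Proof.
move=> [_ _ maxQ] QP; apply: val_inj; apply: maxQ => //.
  by case: (spec_prime P).
by move=> PD; apply: (@spec_n1 _ _ P); rewrite PD; exact: rpred1.
Qed.

Definition uniformizer P p := [/\ spec_val P p, p != 0 & forall y, mloc P y -> loc P (y / p)].

(** Any x in P outside P^2 will do. If y in P is not a multiple of x in D_P, then x
is a multiple of y by an element of PD_P, so that s x is in P^2 for some s outside
P; as P is maximal, x itself is in P^2. *)
Lemma uniformizer_exists P : Max D P -> P <> idmul P P :> set K ->
  exists p, uniformizer P p.
Proof.
move=> mP nPP.
have PPP : idmul P P `<=` P.
  apply: idmul_sub; [exact: spec0|exact: specD|].
  by move=> x y /spec_in Dx; exact: spec_mul.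
have [x Px nx] : exists2 x, spec_val P x & ~ idmul P P x.
  apply: contrapT => nx; apply: nPP; apply/seteqP; split=> // x Px.
  by apply: contrapT => ?; apply: nx; exists x.
have x0 : x != 0 by apply/eqP => x0; apply: nx; rewrite x0; exact: idmul0.
suff h y : spec_val P y -> loc P (y / x).
  exists x; split=> // _ [a [b [Pa Db Pb ->]]].
  by rewrite mulrAC; apply: locM; [exact: h|exact: loc_inv].
move=> Py; have [y0|y0] := eqVneq y 0; first by rewrite y0 mul0r; exact: loc0.
apply: contrapT => nyx.
have : loc P (x / y).
  by have [/nyx //|] := valuation P (y / x); rewrite invf_div.
case/loc_dich => [[p [s [Pp Ds Ps xy]]]|[_]]; last by rewrite invf_div => /nyx.
have [d [q [Dd Pq e]]] := max_comax mP Ds Ps.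
apply: nx; have s0 := localization_nz Ps.
have sx : s * x = p * y by rewrite -(divfK y0 x) xy; field.
rewrite -[x]mul1r e mulrDl -mulrA mulrCA sx; apply: idmulD; last exact: idmul_prod.
by rewrite mulrA; apply: idmul_prod => //; exact: spec_mul.
Qed.

Lemma uniformizer_out P p : uniformizer P p -> ~ loc P p^-1.
Proof. by move=> [Pp p0 _]; apply: mloc_inv => //; exact: spec_mloc. Qed.

Lemma loc_exp P p (n : int) : uniformizer P p -> loc P (p ^ n) <-> 0 <= n.
Proof.
move=> up; have [Pp p0 _] := up; have lp : loc P p by apply: loc_in; exact: spec_in Pp.
split=> [|]; case: n => // n; last by move=> _; exact: locX.
rewrite NegzE => h; case: (uniformizer_out up).
have -> : p^-1 = p ^+ n * p ^- n.+1.
  by rewrite exprS invfM mulrCA divff ?mulr1 // expf_neq0.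
by apply: locM => //; exact: locX.
Qed.

Definition valued P p I (n : int) := forall z, idmul I (loc P) z <-> loc P (z / p ^ n).

Lemma valued_exp P p I n : uniformizer P p -> valued P p I n -> idmul I (loc P) (p ^ n).
Proof.
move=> [_ p0 _] h; apply/h; rewrite divff ?expfz_neq0 //; exact: loc1.
Qed.

Lemma valued_inj P p I m n : uniformizer P p -> valued P p I m -> valued P p I n -> m = n.
Proof.
move=> up; have [_ p0 _] := up.
suff le a b : valued P p I a -> valued P p I b -> b <= a.
  by move=> hm hn; apply/eqP; rewrite eq_le !le.
move=> ha hb; rewrite -subr_ge0; apply/(loc_exp _ up).
by rewrite expfzDr // -invr_expz; apply/hb; exact: valued_exp.
Qed.

Lemma valuedM P p I J m n : uniformizer P p ->
  valued P p I m -> valued P p J n -> valued P p (idmul I J) (m + n).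
Proof.
move=> up hI hJ z; have [_ p0 _] := up.
have pm := expfz_neq0 m p0; have pn := expfz_neq0 n p0.
rewrite expfzDr // invfM [_^-1 * _]mulrC mulrA -idmulA; split=> h.
  apply/hI; move: z h.
  suff : idmul I (idmul J (loc P)) `<=` [set z | idmul I (loc P) (z / p ^ n)] by [].
  apply: idmul_sub => /= [|x y hx hy|x y Ix Jy].
  - by rewrite mul0r; exact: idmul0.
  - by rewrite mulrDl; exact: idmulD.
  - by rewrite -mulrA; apply: idmul_prod => //; apply/hJ.
move/hI: h => h; rewrite -(divfK pn z).
have -> : idmul I (idmul J (loc P)) = idmul (idmul I (loc P)) (idmul J (loc P)).
  by rewrite -[RHS]idmulA [in RHS](idmulC (loc P)) -[in RHS](idmulA J) loc_idmul_loc.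
apply: idmul_prod => //; exact: valued_exp.
Qed.

Lemma valued0 P p I : uniformizer P p -> valued P p I 0 <-> idmul I (loc P) = loc P.
Proof.
move=> up; rewrite /valued; split=> [h|-> z]; last by rewrite expr0z divr1.
by apply/seteqP; split=> z; move: (h z); rewrite expr0z divr1 => -[].
Qed.

(** Let x generate I at P. If neither x nor its inverse is a power of p up to a unit
of D_P, then one of them is divisible by all powers of p. The elements of D that
are so divisible form a prime ideal Q0, properly contained in P and hence outside
the support of I. So x is a unit at Q0, a contradiction. *)
Lemma valued_exists P p I : uniformizer P p -> invertible D I ->
  (forall Q : Spec D, Q `<=` P -> Q <> P -> ~ supp I Q) -> exists n, valued P p I n.
Proof.
move=> up invI noQ; have [Pp p0 pP] := up.
have [x [Ix x0 hx]] := invertible_loc P invI.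
suff [n [xn nx]] : exists n : int, loc P (x / p ^ n) /\ loc P (p ^ n / x).
  exists n => z; rewrite hx; have pn := expfz_neq0 n p0; split=> h.
    by rewrite (_ : z / p ^ n = (z / x) * (x / p ^ n)); [exact: locM|field; apply/andP].
  by rewrite (_ : z / x = (z / p ^ n) * (p ^ n / x)); [exact: locM|field; apply/andP].
have key y : y != 0 -> loc P y -> (exists n : nat, loc P (y / p ^+ n) /\ loc P (p ^+ n / y)) \/
    forall n : nat, loc P (y / p ^+ n).
  move=> y0 ly; have [|nall] := pselect (forall n : nat, loc P (y / p ^+ n)); first by right.
  left; have ex : exists n : nat, `[< ~ loc P (y / p ^+ n) >].
    by apply: contrapT => ne; apply: nall => n; apply: contrapT => /asboolT ?; apply: ne; exists n.
  case: (ex_minnP ex) => -[|n] /asboolP nl minn.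
    by case: nl; rewrite expr0 divr1.
  exists n; have ln : loc P (y / p ^+ n).
    apply: contrapT => /asboolT /minn; by rewrite ltnn.
  split=> //; case/loc_dich: ln => [/pP|[_]]; last by rewrite invf_div.
  by rewrite -mulrA -invfM -exprSr => /nl.
pose Q0 := [set d | d \in D /\ forall n : nat, loc P (d / p ^+ n)].
have Q0P : Q0 `<=` P.
  move=> d [Dd /(_ 1%N)]; rewrite expr1 => h; apply: mloc_in => //.
  by rewrite -(divfK p0 d); apply: mlocM => //; exact: spec_mloc.
have primeQ : prime_ideal D Q0.
  split; [split| |].
  - split=> [|a b [Da ha] [Db hb]|c a Dc [Da ha]].
    + by split; [exact: rpred0|move=> n; rewrite mul0r; exact: loc0].
    + by split; [exact: rpredD|move=> n; rewrite mulrDl; exact: locD].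
    + split; [exact: rpredM|move=> n; rewrite -mulrA; apply: locM => //; exact: loc_in].
  - by move=> a [].
  - by move=> /Q0P /spec_n1.
  - move=> a b Da Db [Dab hab].
    have [a0|a0] := eqVneq a 0.
      by left; split=> // n; rewrite a0 mul0r; exact: loc0.
    have [b0|b0] := eqVneq b 0.
      by right; split=> // n; rewrite b0 mul0r; exact: loc0.
    have [[n [_ na]]|ha] := key a a0 (loc_in P Da); last by left.
    have [[m [_ mb]]|hb] := key b b0 (loc_in P Db); last by right.
    case: (uniformizer_out up).
    have pn := expf_neq0 n p0; have pm := expf_neq0 m p0.
    rewrite (_ : p^-1 = a * b / p ^+ (n + m).+1 * (p ^+ n / a) * (p ^+ m / b)).
      by do 2!apply: locM => //.
    by rewrite exprS exprD; field; apply/and5P.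
pose Q : Spec D := MkSpec (asboolT primeQ).
have nQp : ~ spec_val Q p.
  move=> [_ /(_ 2%N)]; rewrite expr2 invfM mulrA divff // mul1r; exact: uniformizer_out.
have QnP : Q <> P by move=> QP; apply: nQp; rewrite QP.
have locPQ : loc P `<=` loc Q by exact: loc_sub.
have IQ : idmul I (loc Q) = loc Q by apply: supp_out; exact: noQ.
have lQx : loc Q x by rewrite -IQ; exact: idmul_loc_sub.
have lQx1 : loc Q x^-1.
  have : idmul I (loc Q) 1 by rewrite IQ; exact: loc1.
  rewrite -[x^-1]mul1r.
  suff /(_ 1) : idmul I (loc Q) `<=` [set z | loc Q (z / x)] by [].
  apply: idmul_sub => /= [|u w hu hw|u w Iu lw].
  - by rewrite mul0r; exact: loc0.
  - by rewrite mulrDl; exact: locD.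
  - rewrite mulrAC; apply: locM => //; apply: locPQ; apply/hx; exact: idmul_loc_sub.
have nall y : y != 0 -> loc P y -> loc Q y^-1 -> ~ forall n : nat, loc P (y / p ^+ n).
  move=> y0 [a [b [Da Db Pb yab]]] lQ h; apply: (@mloc_inv _ _ Q _ y0 _ lQ).
  exists a, b; split=> // [|/Q0P //]; split=> // n.
  have b0 := localization_nz Pb.
  rewrite (_ : a = b * y); last by rewrite yab; field.
  by rewrite -mulrA; apply: locM => //; exact: loc_in.
have [lx|lx] := valuation P x.
  have [[n [h1 h2]]|/(nall _ x0 lx lQx1)//] := key x x0 lx.
  by exists n.
have x10 : x^-1 != 0 by rewrite invr_eq0.
have [[n [h1 h2]]|] := key _ x10 lx; last by move=> /(nall _ x10 lx); rewrite invrK => /(_ lQx).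
exists (- n%:Z); rewrite -invr_expz; split; first by move: h2; rewrite invrK invrK mulrC.
by move: h1; rewrite mulrC.
Qed.
End PruferLoc.

(** * The valued group Inv_X(D) *)

Section SpecGeneral.
Variables (K : fieldType) (A : subringClosed K).
Implicit Types (P Q : Spec A) (I J : set K).

Lemma prime_above I : ideal A I -> ~ I 1 -> exists P : Spec A, I `<=` P.
Proof.
move=> idI I1.
pose good (M : set K) := [/\ ideal A M, I `<=` M & ~ M 1].
have [F Fgood totF|M [[M0|[[[M0 MD MM] MA] IM M1]] maxM]] := @Zorn_bigcup K [set M | M = set0 \/ good M].
- have [[M [FM gM]]|nF] := pselect (exists M, F M /\ good M); last first.
    left; apply/seteqP; split=> // x [M FM Mx].
    have [M0|gM] := Fgood _ FM; first by rewrite M0 in Mx.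
    by apply: nF; exists M.
  have sub N x : F N -> N x -> good N.
    by move=> /Fgood[-> //|].
  right; split; [split; [split|]| |].
  + by exists M => //; case: gM => -[[]].
  + move=> x y [N1 FN1 N1x] [N2 FN2 N2y].
    have [N12|N21] := totF _ _ FN1 FN2.
      exists N2 => //; have [[[_ ND _] _] _ _] := sub _ _ FN2 N2y.
      by apply: ND => //; exact: N12.
    exists N1 => //; have [[[_ ND _] _] _ _] := sub _ _ FN1 N1x.
    by apply: ND => //; exact: N21.
  + move=> a x Aa [N FN Nx]; exists N => //; have [[[_ _ NM] _] _ _] := sub _ _ FN Nx.
    exact: NM.
  + by move=> x [N FN Nx]; have [[_ NA] _ _] := sub _ _ FN Nx; exact: NA.
  + by move=> x Ix; exists M => //; case: gM => _ h _; exact: h.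
  + by move=> [N FN N1]; have [] := sub _ _ FN N1.
- exfalso; apply: (maxM I); last by right; split.
  rewrite M0; split=> // /(_ 0) I0; apply: I0; by case: idI => -[].
- have prM : prime_ideal A M.
    split=> // x y Ax Ay Mxy; have [|nMx] := pselect (M x); [by left|right].
    pose N := [set z | exists m a, [/\ M m, a \in A & z = m + a * x]].
    have sMN : M `<=` N by move=> m Mm; exists m, 0; rewrite rpred0 mul0r addr0.
    have [m [a [Mm Aa e]]] : N 1.
      apply: contrapT => nN1; apply: (maxM N).
        split=> // /(_ x) Nx; apply: nMx; apply: Nx.
        by exists 0, 1; rewrite rpred1 mul1r add0r.
      right; split=> //; last by move=> z /IM/sMN.
      split; last by move=> _ [m [a [/MA Am Aa ->]]]; rewrite /= rpredD ?rpredM.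
      split=> [|_ _ [m [a [Mm Aa ->]]] [m' [a' [Mm' Aa' ->]]]|b _ Ab [m [a [Mm Aa ->]]]].
      + exact: sMN.
      + by exists (m + m'), (a + a'); split; [exact: MD|exact: rpredD|ring].
      + by exists (b * m), (b * a); split; [exact: MM|exact: rpredM|ring].
    rewrite -[y]mul1r e mulrDl; apply: MD; first by rewrite mulrC; exact: MM.
    by rewrite -mulrA; exact: MM.
  by exists (MkSpec (asboolT prM)).
Qed.

Lemma loc_inter x : (forall P, loc P x) -> x \in A.
Proof.
move=> lx; apply: contrapT => nAx.
have [|/= [_]|P NP] := @prime_above [set d | d \in A /\ d * x \in A].
- split=> [|d []//]; split=> [|d e [Ad Adx] [Ae Aex]|a d Aa [Ad Adx]] /=.
  + by rewrite mul0r rpred0.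
  + by rewrite mulrDl; split; exact: rpredD.
  + by rewrite -mulrA; split; exact: rpredM.
- by rewrite mul1r.
have [a [b [Aa Ab Pb xab]]] := lx P.
have b0 := localization_nz Pb.
apply: Pb; apply: NP; split=> //; by rewrite xab mulrC divfK.
Qed.

Lemma sub_bigcap_loc (F : set (Spec A)) x : x \in A -> x \in bigcap_loc F.
Proof. by move=> Ax; apply/asboolP => P _; exact: loc_in. Qed.

Lemma bigcap_locP (F : set (Spec A)) x :
  x \in bigcap_loc F <-> forall P, F P -> loc P x.
Proof. by split=> [/asboolP|h]; [|apply/asboolP]. Qed.

(** Both I and its inverse are contained in the intersection of the D_P. *)
Lemma bigcap_loc_trivial (F : set (Spec A)) I : invertible A I ->
  (forall P, F P -> idmul I (loc P) = loc P) ->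
  idmul I [set` bigcap_loc F] = [set` bigcap_loc F].
Proof.
move=> /invertibleE[J [sI sJ IJA IJ1]] IF.
have subI x : I x -> x \in bigcap_loc F.
  by move=> Ix; apply/bigcap_locP => P FP; rewrite -IF //; exact: idmul_loc_sub.
have subJ y : J y -> y \in bigcap_loc F.
  move=> Jy; apply/bigcap_locP => P FP.
  have : idmul I (loc P) 1 by rewrite IF //; exact: loc1.
  rewrite -[y]mul1r.
  suff /(_ 1) : idmul I (loc P) `<=` [set z | loc P (z * y)] by [].
  apply: idmul_sub => /= [|u w hu hw|u w Iu lw].
  - by rewrite mul0r; exact: loc0.
  - by rewrite mulrDl; exact: locD.
  - by rewrite mulrAC; apply: locM => //; apply: loc_in; exact: IJA.
apply/seteqP; split.
  apply: idmul_sub => /= [|x y|x y /subI Tx]; [exact: rpred0|exact: rpredD|exact: rpredM].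
have T1 : idmul I [set` bigcap_loc F] 1.
  by move: IJ1; apply: idmulS => // y /subJ.
move=> x Tx; rewrite -[x]mulr1.
suff /(_ 1 T1) : idmul I [set` bigcap_loc F] `<=`
  [set z | idmul I [set` bigcap_loc F] (x * z)] by [].
apply: idmul_sub => /= [|u w hu hw|u w Iu lw].
- by rewrite mulr0; exact: idmul0.
- by rewrite mulrDr; exact: idmulD.
- by rewrite mulrCA; apply: idmul_prod => //=; exact: rpredM.
Qed.

Lemma fg_ideal_span s : {subset s <= A} -> fg_ideal A (span A s).
Proof. by exists s. Qed.

Lemma fg_ideal_sub P s : (span A s `<=` P) <-> (forall x, x \in s -> spec_val P x).
Proof.
split=> [h x xs|h]; first by apply: h; exact: span_mem.
by apply: span_sub => //; exact: spec_submod.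
Qed.

Lemma fg_ideal_open J : fg_ideal A J -> open [set P : Spec A | J `<=` P].
Proof.
move=> fgJ; exists [set [set P : Spec A | J `<=` P]]; last by rewrite bigcup_set1.
by move=> _ ->; apply: finI_from1.
Qed.

(** A finite intersection of sets V(I_k) is V of the sum of the I_k. *)
Lemma nbhs_fg P (U : set (Spec A)) : nbhs P U ->
  exists s, [/\ {subset s <= A}, span A s `<=` P &
    forall Q : Spec A, span A s `<=` Q -> U Q].
Proof.
rewrite nbhsE => -[B [[E EB <-] [V EV VP]] BU].
have [F FE FV] := EB _ EV.
have [s sA sF] : exists2 s, {subset s <= A} &
    forall Q : Spec A, span A s `<=` Q <-> forall I, I \in finmap.enum_fset F -> I `<=` Q.
  have : forall I, I \in finmap.enum_fset F -> fg_ideal A I by move=> I /FE; rewrite inE.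
  elim: (finmap.enum_fset F) => [_|I r IH hr].
    by exists [::] => // Q; split=> // _; apply/fg_ideal_sub.
  have [|s sA sr] := IH; first by move=> J Jr; apply: hr; rewrite inE Jr orbT.
  have [t tA It] := hr I (mem_head _ _).
  exists (t ++ s) => [x|Q].
    by rewrite mem_cat => /orP[/tA|/sA].
  split=> [/fg_ideal_sub h J|h].
    rewrite inE => /predU1P[->|Jr].
      by rewrite It; apply/fg_ideal_sub => x xt; apply: h; rewrite mem_cat xt.
    apply: (sr Q).1 => //.
    by apply/fg_ideal_sub => x xt; apply: h; rewrite mem_cat xt orbT.
  apply/fg_ideal_sub => x; rewrite mem_cat => /orP[xt|xs].
    by apply: (h I (mem_head _ _)); rewrite It; exact: span_mem.
  have : span A s `<=` Q by apply/sr => J Jr; apply: h; rewrite inE Jr orbT.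
  by move=> /fg_ideal_sub; apply.
exists s; split=> // [|Q sQ].
  by apply/sF => I IF; move: VP; rewrite -FV; apply.
have VQ : V Q by rewrite -FV => I IF; apply: (sF Q).1.
by apply: BU; exists V.
Qed.

(** An ultrafilter F converges to the prime ideal of the elements x such that the
primes containing x form a member of F. *)
Lemma closed_set_compact I : compact [set P : Spec A | I `<=` P].
Proof.
rewrite compact_ultra => F UF FI.
pose L := [set x | x \in A /\ F [set P : Spec A | spec_val P x]].
have primeL : prime_ideal A L.
  split; [split| |].
  - split=> [|x y [Ax Fx] [Ay Fy]|a x Aa [Ax Fx]].
    + by split; [exact: rpred0|apply: filterS filterT => P _; exact: spec0].
    + split; [exact: rpredD|]; apply: filterS2 Fx Fy => P; exact: specD.
    + split; [exact: rpredM|]; apply: filterS Fx => P; exact: spec_mul.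
  - by move=> x [].
  - by move=> [_ F1]; have [P /spec_n1] := filter_ex F1.
  - move=> x y Ax Ay [_ Fxy].
    have [Fx|nFx] := in_ultra_setVsetC [set P : Spec A | spec_val P x] UF; first by left.
    right; split=> //; apply: filterS2 Fxy nFx => P /= /specM[] //.
exists (MkSpec (asboolT primeL)); split.
  move=> x Ix; split.
    by have [P /(_ _ Ix)] := filter_ex FI; exact: spec_in.
  by apply: filterS FI => P; apply.
move=> U /nbhs_fg[s [sA sL sU]].
have : F [set Q : Spec A | span A s `<=` Q].
  have : forall x, x \in s -> L x by apply/(fg_ideal_sub (MkSpec (asboolT primeL))).
  elim: s {sA sL sU} => [_|x s IH sL].
    by apply: filterS filterT => P _; apply/fg_ideal_sub.
  have [|_ Fx] := sL x; first exact: mem_head.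
  have Fs := IH (fun y ys => sL y (mem_behead (s := x :: s) ys)).
  apply: filterS2 Fx Fs => P /= Px /fg_ideal_sub Ps; apply/fg_ideal_sub => y.
  by rewrite inE => /predU1P[->|/Ps].
by apply: filterS => Q; exact: sU.
Qed.
End SpecGeneral.

Section Valuations.
Variables (K : fieldType) (D : subringClosed K) (X : set (Spec D)).
Hypotheses (qD : is_quotient_field D) (pD : prufer D).
Hypotheses (XMax : X `<=` Max D) (splX : splitting_set X) (discX : discrete_set X).
Implicit Types (P Q : Spec D) (I J : InvX X).

Definition unif P : K := xget 0 [set p | uniformizer P p].

Lemma unifP P : X P -> uniformizer P (unif P).
Proof.
move=> XP; have [p pP] := uniformizer_exists qD pD (XMax XP) (discX XP).
by rewrite /unif; case: xgetP => // /(_ p).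
Qed.

Definition invx_value P I : int :=
  if pselect (X P) is left _ then xget 0 [set n | valued P (unif P) I n] else 0.

Local Notation v := invx_value.

Lemma InvX_inv I : invertible D I. Proof. by case: (invxP I). Qed.
Lemma InvX_submod I : submod D I. Proof. by case: (InvX_inv I) => -[]. Qed.

Lemma InvX_out P I : ~ X P -> idmul I (loc P) = loc P.
Proof. by move=> nX; apply: supp_out => /(invxP I).2. Qed.

(** A prime properly below P is outside X, whose members are maximal, and hence
outside the support of I. *)
Lemma invx_valueP P I : X P -> valued P (unif P) I (v P I).
Proof.
move=> XP; have [|n hn] := valued_exists qD pD (unifP XP) (InvX_inv I).
  move=> Q QP neq /(invxP I).2 XQ; apply: neq; symmetry.
  exact: max_sub (XMax XQ) QP.
by rewrite /invx_value; case: pselect => // _; case: xgetP => // /(_ n).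
Qed.

Lemma invx_value_eq P I n : X P -> valued P (unif P) I n -> v P I = n.
Proof. by move=> XP; apply: valued_inj (unifP XP) (invx_valueP I XP). Qed.

Lemma invx_value_eq0 P I : v P I = 0 <-> idmul I (loc P) = loc P.
Proof.
have [XP|nXP] := pselect (X P).
  rewrite -(valued0 I (unifP XP)); split=> [<-|]; [exact: invx_valueP|exact: invx_value_eq].
by split=> [_|_]; [exact: InvX_out|rewrite /invx_value; case: pselect].
Qed.

Lemma invx_value_out P I : ~ X P -> v P I = 0.
Proof. by move=> nXP; rewrite /invx_value; case: pselect. Qed.

Lemma invx_valueD P I J : v P (I + J) = v P I + v P J.
Proof.
have [XP|nXP] := pselect (X P); last by rewrite !invx_value_out.
by apply: invx_value_eq => //; apply: valuedM; [exact: unifP|exact: invx_valueP|exact: invx_valueP].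
Qed.

Lemma invx_value_ge0 P I : (forall x, invx_val I x -> loc P x) <-> 0 <= v P I.
Proof.
have [XP|nXP] := pselect (X P); last first.
  rewrite invx_value_out //; split=> // _ x Ix; rewrite -(InvX_out I nXP); exact: idmul_loc_sub.
have up := unifP XP; have [_ p0 _] := up; split=> h.
  apply/(loc_exp _ up); have := valued_exp up (invx_valueP I XP).
  exact: idmul_loc_le.
move=> x Ix; have /(invx_valueP I XP) lx := idmul_loc_sub P Ix.
rewrite -(divfK (expfz_neq0 (v P I) p0) x); apply: locM => //.
by apply/(loc_exp _ up).
Qed.

Lemma nonneg_in I x : nonneg v I -> invx_val I x -> x \in D.
Proof. by move=> I0 Ix; apply: loc_inter => P; apply: (invx_value_ge0 P I).2. Qed.

Lemma nonneg_supp I P : nonneg v I -> (v P I != 0) = `[< invx_val I `<=` P >].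
Proof.
move=> I0; apply/idP/asboolP => [/eqP vI x Ix|IP].
  apply: contrapT => nPx; apply: vI; apply/invx_value_eq0; apply: idmul_loc_eq.
    by move=> y Iy; apply: loc_in; exact: nonneg_in Iy.
  apply: (idmul_den_loc (s := x)); rewrite ?mulr1 //; exact: nonneg_in Ix.
apply/eqP => /invx_value_eq0 e; apply: (@mloc_n1 _ _ P).
have : idmul I (loc P) 1 by rewrite e; exact: loc1.
suff /(_ 1) : idmul I (loc P) `<=` mloc P by [].
apply: idmul_sub => [|x y|x y /IP Px ly].
- by apply: spec_mloc; exact: spec0.
- exact: mlocD.
- by rewrite mulrC; apply: mlocM => //; exact: spec_mloc.
Qed.

Lemma nonneg_suppE I : nonneg v I -> [set P | v P I != 0] = [set P : Spec D | invx_val I `<=` P].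
Proof.
by move=> I0; apply/seteqP; split=> P /=; rewrite nonneg_supp //; [move/asboolP|move/asboolT].
Qed.

Lemma in_InvX_supp s : (exists2 x, x \in s & x != 0) -> {subset s <= D} ->
  (forall P, span D s `<=` P -> X P) -> in_InvX X (span D s).
Proof.
move=> s0 sD sX; split; first exact: invertible_span.
move=> P; apply: contraPP => nX; apply.
have sl : span D s `<=` loc P.
  by apply: span_sub; [exact: submod_loc|move=> x /sD; exact: loc_in].
apply: idmul_loc_eq => //.
have [x sx nPx] : exists2 x, span D s x & ~ spec_val P x.
  apply: contrapT => nx; apply: nX; apply: sX => x sx.
  by apply: contrapT => ?; apply: nx; exists x.
apply: (idmul_den_loc (s := x)); rewrite ?mulr1 //.
suff : span D s `<=` [set` D] by apply.
by apply: span_sub => //; exact: submod1.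
Qed.

Lemma span_sub_D s x : {subset s <= D} -> span D s x -> x \in D.
Proof.
move=> sD; suff : span D s `<=` [set` D] by apply.
by apply: span_sub => //; exact: submod1.
Qed.

(** The finitely generated ideal given by the topology is nonzero: otherwise all
primes, in particular the idempotent ideal 0, would belong to X. *)
Lemma nbhs_InvX P U : X P -> nbhs P U -> exists s, [/\ in_InvX X (span D s),
  {subset s <= D}, exists2 x, x \in s & x != 0,
  span D s `<=` P & forall Q : Spec D, span D s `<=` Q -> X Q /\ U Q].
Proof.
move=> XP PU; have PX : nbhs P X by apply: open_nbhs_nbhs; split=> //; case: splX.
have [s [sD sP sU]] := nbhs_fg (filterI PU PX).
have s0 : exists2 x, x \in s & x != 0.
  apply: contrapT => ns0.
  have sQ (Q : Spec D) : span D s `<=` Q.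
    apply/fg_ideal_sub => x xs; suff -> : x = 0 by exact: spec0.
    by apply/eqP/negPn/negP => x0; apply: ns0; exists x.
  have pr0 : prime_ideal D [set 0].
    split; [split; [split=> //|]| |].
    - by move=> x y -> ->; rewrite addr0.
    - by move=> a x _ ->; rewrite mulr0.
    - by move=> x ->; exact: rpred0.
    - by move=> /eqP; rewrite oner_eq0.
    - by move=> x y _ _ /eqP; rewrite mulf_eq0 => /orP[/eqP|/eqP]; [left|right].
  pose Z := MkSpec (asboolT pr0).
  have [_ /discX] := sU Z (sQ Z); apply; apply/seteqP; split=> x /=.
    by move=> ->; exact: idmul0.
  suff /(_ x) : idmul [set 0] [set 0] `<=` [set (0 : K)] by [].
  by apply: idmul_sub => //= [u w -> ->|u w -> _]; rewrite ?addr0 ?mul0r.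
exists s; split=> // [|Q /sU[]//].
by apply: in_InvX_supp => // Q /sU[].
Qed.

Lemma InvX_valued_group : valued_group X v.
Proof.
split.
- move=> P I J; apply/eqP; rewrite -(addrK (v P J) (v P (I - J))) -invx_valueD subrK //.
- by move=> P I; exact: invx_value_out.
(* the minimum is the value of I + J *)
- move=> I J; have [sI sJ] := (InvX_submod I, InvX_submod J).
  have [[s sI' Is] [t tJ' Jt]] := (invertible_fg (InvX_inv I), invertible_fg (InvX_inv J)).
  have [x0 Ix0 x00] := invertible_neq0 (InvX_inv I).
  pose H := span D (s ++ t).
  have IH : invx_val I `<=` H.
    rewrite Is; apply: span_sub; first exact: submod_span.
    by move=> x xs; apply: span_mem; rewrite mem_cat xs.
  have JH : invx_val J `<=` H.
    rewrite Jt; apply: span_sub; first exact: submod_span.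
    by move=> x xs; apply: span_mem; rewrite mem_cat xs orbT.
  have Hsub (S : set K) : submod D S -> invx_val I `<=` S -> invx_val J `<=` S -> H `<=` S.
    move=> sS IS JS; apply: span_sub => // x; rewrite mem_cat => /orP[/sI'/IS|/tJ'/JS] //.
  have invH : invertible D H.
    apply: invertible_span => //; apply: contrapT => ns.
    have : H x0 by exact: IH.
    suff : H `<=` [set 0] by move=> /[apply] /eqP; rewrite (negPf x00).
    apply: span_sub.
      by split=> //= [x y -> ->|a x _ ->]; rewrite ?addr0 ?mulr0.
    by move=> x xs; apply/eqP/negPn/negP => xn; apply: ns; exists x.
  have HX : in_InvX X H.
    split=> // P; apply: contraPP => nX; apply; apply: idmul_loc_eq.
      apply: Hsub; first exact: submod_loc.
        by rewrite -(InvX_out I nX) => x; exact: idmul_loc_sub.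
      by rewrite -(InvX_out J nX) => x; exact: idmul_loc_sub.
    have : idmul I (loc P) 1 by rewrite InvX_out //; exact: loc1.
    exact: idmulS.
  exists (MkInvX (asboolT HX)) => P.
  have [XP|nXP] := pselect (X P); last by rewrite !invx_value_out.
  have up := unifP XP; have [_ p0 _] := up.
  apply: invx_value_eq => // z /=; set m := Num.min _ _.
  have pm := expfz_neq0 m p0.
  have shift n y : m <= n -> loc P (y / unif P ^ n) -> loc P (y / unif P ^ m).
    move=> mn ly; rewrite (_ : y / unif P ^ m = y / unif P ^ n * unif P ^ (n - m)).
      by apply: locM => //; apply/(loc_exp _ up); rewrite subr_ge0.
    by rewrite expfzDr // -invr_expz mulrA divfK // expfz_neq0.
  have mI : m <= v P I by rewrite /m; lia.
  have mJ : m <= v P J by rewrite /m; lia.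
  split.
    suff : idmul H (loc P) `<=` [set z | loc P (z / unif P ^ m)] by apply.
    apply: idmul_sub => /= [|x y lx ly|x y Hx ly].
    + by rewrite mul0r; exact: loc0.
    + by rewrite mulrDl; exact: locD.
    + rewrite mulrAC; apply: locM => //; move: Hx.
      suff : H `<=` [set x | loc P (x / unif P ^ m)] by apply.
      apply: Hsub => [|w Iw|w Jw] /=.
      * split=> /= [|u w lu lw|a u Da lu].
        - by rewrite mul0r; exact: loc0.
        - by rewrite mulrDl; exact: locD.
        - by rewrite -mulrA; apply: locM => //; exact: loc_in.
      * by apply: (shift (v P I)) => //; apply/(invx_valueP I XP); exact: idmul_loc_sub.
      * by apply: (shift (v P J)) => //; apply/(invx_valueP J XP); exact: idmul_loc_sub.
  move=> lz; rewrite -(divfK pm z); apply: idmul_locM => //.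
  have [mE|mE] : m = v P I \/ m = v P J by rewrite /m; lia.
    rewrite mE; apply: (@idmulS _ I _ (loc P) _ IH) => //; exact: valued_exp (invx_valueP I XP).
  rewrite mE; apply: (@idmulS _ J _ (loc P) _ JH) => //; exact: valued_exp (invx_valueP J XP).
- move=> I I0; apply: val_inj => /=.
  have IT : idmul I [set` bigcap_loc (setT : set (Spec D))] = [set` bigcap_loc (setT : set (Spec D))].
    by apply: bigcap_loc_trivial (InvX_inv I) _ => P _; exact/invx_value_eq0.
  have TD : [set` bigcap_loc (setT : set (Spec D))] = [set` D].
    apply/seteqP; split=> x /=; last exact: sub_bigcap_loc.
    by move=> /bigcap_locP h; apply: loc_inter => P; exact: h.
  by rewrite TD idmulC idmul1 in IT; last exact: InvX_submod.
- move=> I I0; rewrite nonneg_suppE //; apply: fg_ideal_open.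
  have [s sI Is] := invertible_fg (InvX_inv I).
  by exists s => // x /sI; exact: nonneg_in.
- by move=> I I0; rewrite nonneg_suppE //; exact: closed_set_compact.
(* if 1 = x a + p with x in I and p in P, then no prime in V(p) contains I *)
- move=> I P I0 XP /eqP; rewrite -[_ == _]negbK nonneg_supp // => /asboolP nIP.
  have [x Ix nPx] : exists2 x, invx_val I x & ~ spec_val P x.
    apply: contrapT => nx; apply: nIP => x Ix; apply: contrapT => ?; apply: nx; exists x => //.
  have Dx := nonneg_in I0 Ix.
  have [a [p [Da Pp e]]] := max_comax (XMax XP) Dx nPx.
  have sp : {subset [:: p] <= D} by move=> y; rewrite inE => /eqP ->; exact: spec_in Pp.
  have : nbhs P [set Q : Spec D | span D [:: p] `<=` Q].
    apply: open_nbhs_nbhs; split; first exact: fg_ideal_open (fg_ideal_span sp).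
    by apply/fg_ideal_sub => y; rewrite inE => /eqP ->.
  apply: filterS => Q /fg_ideal_sub/(_ p (mem_head _ _)) Qp.
  apply/eqP; rewrite -[_ == _]negbK nonneg_supp //; apply/asboolP => IQ.
  apply: (@spec_n1 _ _ Q); rewrite e; apply: specD => //.
  by rewrite mulrC; apply: spec_mul => //; exact: IQ.
- move=> P U XP PU; have [s [sX sD s0 sP sU]] := nbhs_InvX XP PU.
  pose I : InvX X := MkInvX (asboolT sX).
  have I0 : nonneg v I.
    by move=> Q; apply/invx_value_ge0 => x Ix; apply: loc_in; exact: span_sub_D Ix.
  exists I; split=> // [|Q]; first by rewrite nonneg_supp //; apply/asboolP.
  by rewrite nonneg_supp // => /asboolP /sU[].
(* adding a uniformizer to an ideal of Inv_X(D) inside P gives the value 1 *)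
- move=> P XP; have [s [sX sD s0 sP sU]] := nbhs_InvX XP filterT.
  have up := unifP XP; have [Pp p0 pP] := up; set p := unif P in up Pp p0 pP.
  have psD : {subset p :: s <= D}.
    by move=> x; rewrite inE => /predU1P[->|/sD//]; exact: spec_in Pp.
  have HX : in_InvX X (span D (p :: s)).
    apply: in_InvX_supp => //; first by exists p; rewrite ?mem_head.
    move=> Q /fg_ideal_sub h; apply: (sU Q _).1; apply/fg_ideal_sub => x xs.
    by apply: h; rewrite inE xs orbT.
  pose I : InvX X := MkInvX (asboolT HX).
  exists I.
    by move=> Q; apply/invx_value_ge0 => x Ix; apply: loc_in; exact: span_sub_D Ix.
  apply: invx_value_eq => // z; rewrite expr1z -/p /=; split.
    suff : idmul (span D (p :: s)) (loc P) `<=` [set z | loc P (z / p)] by apply.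
    apply: idmul_sub => /= [|x y lx ly|x y Hx ly].
    + by rewrite mul0r; exact: loc0.
    + by rewrite mulrDl; exact: locD.
    + rewrite mulrAC; apply: locM => //; apply: pP; apply: spec_mloc; move: Hx.
      suff : span D (p :: s) `<=` P by apply.
      apply/fg_ideal_sub => w; rewrite inE => /predU1P[->//|ws].
      by apply: sP; exact: span_mem.
  move=> lz; rewrite -(divfK p0 z); apply: idmul_locM => //.
  by apply: idmul_loc_sub; apply: span_mem; exact: mem_head.
Qed.
End Valuations.

(** * The overring T attached to a closed subset of X *)

Section Overring.
Variables (K : fieldType) (D : subringClosed K) (X : set (Spec D)).
Hypotheses (qD : is_quotient_field D) (pD : prufer D).
Hypotheses (XMax : X `<=` Max D) (splX : splitting_set X) (discX : discrete_set X).
Variable C : set (Spec D).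
Hypothesis clC : closedX X (@invx_value K D X) C.
Implicit Types (P Q : Spec D) (I J : InvX X).

Let T : subringClosed K := Tring X C.
Local Notation v := (@invx_value K D X).
Local Notation XT := (ext_set X T).

Let v_zero := invx_value_eq0 qD pD XMax discX.
Let v_nonneg := invx_value_ge0 qD pD XMax discX.
Let CX : C `<=` X := clC.1.

Lemma TP x : x \in T <-> forall P, C P \/ ~ X P -> loc P x.
Proof. exact: bigcap_locP. Qed.

Lemma D_T x : x \in D -> x \in T.
Proof. exact: sub_bigcap_loc. Qed.

Lemma T_loc P x : C P \/ ~ X P -> x \in T -> loc P x.
Proof. by move=> CP /TP; apply. Qed.

Lemma qT : is_quotient_field T.
Proof.
by move=> x; have [a [b [Da Db b0 ->]]] := qD x; exists a, b; split=> //; exact: D_T.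
Qed.

Lemma submod_T (S : set K) : submod T (idmul S [set` T]).
Proof. by apply: idmul_submodr; exact: submod1. Qed.

Lemma submodTD (S : set K) : submod T S -> submod D S.
Proof. by move=> [S0 SD SM]; split=> // a x /D_T; exact: SM. Qed.

Lemma sub_idmulT (S : set K) x : S x -> idmul S [set` T] x.
Proof. by move=> Sx; rewrite -[x]mulr1; apply: idmul_prod => //=; exact: rpred1. Qed.

Lemma idmulT_loc (S : set K) P : C P \/ ~ X P ->
  idmul (idmul S [set` T]) (loc P) = idmul S (loc P).
Proof.
move=> CP; rewrite -idmulA; congr idmul; apply/seteqP; split.
  apply: idmul_sub; [exact: loc0|exact: locD|move=> x y Tx; apply: locM; exact: T_loc Tx].
by move=> x lx; rewrite -[x]mul1r; apply: idmul_prod => //=; exact: rpred1.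
Qed.

(** Write 1 = u + x w with u, w in the inverse of (1, x). Then x u and x w are in D
and in PD_P, hence in P, and x = (x u) 1 + (x w) x. *)
Lemma mlocT P x : x \in T -> mloc P x -> idmul P [set` T] x.
Proof.
move=> Tx mx.
have [J [sJ JD [u [w [Ju Jw e]]]]] := @pair_invertible K D qD pD 1 x (or_introl (oner_neq0 K)).
have [[_ Dxu] [_ Dxw]] := (JD _ Ju, JD _ Jw).
have xP y : J y -> spec_val P (x * y).
  move=> Jy; have [Dy Dxy] := JD _ Jy; apply: mloc_in => //.
  by rewrite mulrC; apply: mlocM => //; apply: loc_in; rewrite -[y]mul1r.
rewrite -[x]mul1r e mulrDl; apply: idmulD.
  by rewrite mul1r mulrC; apply: sub_idmulT; exact: xP.
by apply: idmul_prod => //; exact: xP.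
Qed.

Lemma idmulT_mloc P x : C P -> idmul P [set` T] x -> x \in T /\ mloc P x.
Proof.
move=> CP; suff /(_ x) : idmul P [set` T] `<=` [set x | x \in T /\ mloc P x] by [].
apply: idmul_sub => /= [|y z [Ty my] [Tz mz]|y z Py Tz].
- by split; [exact: rpred0|apply: spec_mloc; exact: spec0].
- by split; [exact: rpredD|exact: mlocD].
- split; first by apply: rpredM => //; apply: D_T; exact: spec_in Py.
  rewrite mulrC; apply: mlocM; last exact: spec_mloc.
  by apply: T_loc => //; left.
Qed.

Lemma prime_mlocT P : C P \/ ~ X P -> prime_ideal T [set x | x \in T /\ mloc P x].
Proof.
move=> CP; split; [split; [split=> /=|]| |].
- by split; [exact: rpred0|apply: spec_mloc; exact: spec0].
- by move=> y z [Ty my] [Tz mz]; split; [exact: rpredD|exact: mlocD].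
- by move=> a y Ta [Ty my]; split; [exact: rpredM|apply: mlocM => //; exact: T_loc Ta].
- by move=> x [].
- by move=> [_ /mloc_n1].
- move=> x y Tx Ty [_ mxy].
  have [mx|[x0 lx]] := loc_dich (T_loc CP Tx); first by left.
  by right; split=> //; rewrite -(mulKf x0 y); exact: mlocM.
Qed.

Definition specT P (CP : C P \/ ~ X P) : Spec T := MkSpec (asboolT (prime_mlocT CP)).

Lemma specT_ext P (CP : C P) : specT (or_introl CP) = idmul P [set` T] :> set K.
Proof.
apply/seteqP; split=> x; first by move=> [Tx mx]; exact: mlocT.
exact: idmulT_mloc.
Qed.

(** A strictly larger ideal contains an element of D outside P, and P is maximal
in D. *)
Lemma specT_Max P (CP : C P) : Max T (specT (or_introl CP)).
Proof.
split.
- by case: (spec_prime (specT (or_introl CP))).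
- move=> e; have : [set` T] 1 by exact: rpred1.
  by rewrite -e => -[_ /mloc_n1].
move=> J [[J0 JD JM] JT] nJ PJ; apply/seteqP; split=> // x Jx.
have Tx : x \in T by exact: JT.
split=> //; have [//|[x0]] := loc_dich (T_loc (or_introl CP) Tx).
move=> [b [a [Db Da Pa xab]]]; case: nJ; apply/seteqP; split=> // y Ty.
have nPb : ~ spec_val P b.
  move=> Pb; apply: (@mloc_inv _ _ P x^-1); rewrite ?invr_eq0 ?invrK //.
    by exists b, a.
  by apply: T_loc Tx; left.
have b0 := localization_nz nPb; have a0 := localization_nz Pa.
have Ja : J a.
  have -> : a = b * x by rewrite -[x]invrK xab; field; apply/andP.
  by apply: JM => //; exact: D_T.
have [d [p [Dd Pp e]]] := max_comax (XMax (CX CP)) Da Pa.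
rewrite -[y]mulr1 e; apply: (JM) => //; apply: JD.
  by rewrite mulrC; apply: (JM) => //; exact: D_T.
by apply: PJ; split; [apply: D_T; exact: spec_in Pp|exact: spec_mloc].
Qed.

Lemma prime_contract (Q : Spec T) : prime_ideal D [set x | x \in D /\ spec_val Q x].
Proof.
split; [split; [split=> /=|]| |].
- by split; [exact: rpred0|exact: spec0].
- by move=> y z [Ty my] [Tz mz]; split; [exact: rpredD|exact: specD].
- by move=> a y Ta [Ty my]; split; [exact: rpredM|apply: spec_mul => //; exact: D_T].
- by move=> x [].
- by move=> [_ /spec_n1].
- by move=> x y Dx Dy [_ /specM]; case; [exact: D_T|exact: D_T|left|right].
Qed.

Definition contract (Q : Spec T) : Spec D := MkSpec (asboolT (prime_contract Q)).

Lemma loc_contract (Q : Spec T) : loc (contract Q) `<=` loc Q.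
Proof.
move=> _ [a [b [Da Db Qb ->]]]; exists a, b; split=> //; try exact: D_T.
by move=> Qb'; apply: Qb.
Qed.

(** The contraction P of Q to D is in X, because I is trivial at the other primes. It
is in C: otherwise some ideal g contained in P is trivial at the points of C and
outside X, so that gT = T, although gT is contained in Q. *)
Lemma ext_supp I (Q : Spec T) : supp (idmul I [set` T]) Q -> ext_set X T Q.
Proof.
move=> sQ; pose P := contract Q.
have nl : idmul I (loc P) <> loc P.
  move=> IP; apply: sQ; apply: idmul_loc_eq.
    apply: idmul_sub; [exact: loc0|exact: locD|move=> x y Ix Ty].
    apply: locM; last exact: loc_in.
    by apply: loc_contract; rewrite -IP; exact: idmul_loc_sub.
  have : idmul I (loc P) 1 by rewrite IP; exact: loc1.
  apply: idmulS; last exact: loc_contract.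
  by move=> x; exact: sub_idmulT.
have XP : X P by apply: contrapT => /(InvX_out I)/nl.
have CP : C P.
  apply: contrapT => nCP; have [g [g0 gP gC]] := clC.2 P XP nCP.
  have gT : idmul g [set` T] = [set` T].
    apply: bigcap_loc_trivial (InvX_inv g) _ => Q' [CQ'|nXQ']; last exact: InvX_out.
    by apply/v_zero; exact: gC.
  apply: (@spec_n1 _ _ Q).
  have : idmul g [set` T] 1 by rewrite gT; exact: rpred1.
  suff /(_ 1) : idmul g [set` T] `<=` Q by [].
  apply: idmul_sub; [exact: spec0|exact: specD|move=> x y gx Ty].
  rewrite mulrC; apply: spec_mul => //.
  move: gP; rewrite (nonneg_supp qD pD XMax discX P g0) => /asboolP /(_ x gx).
  by case.
exists P => //; apply/seteqP; split=> x.
  move=> Qx; have Tx : x \in T := spec_in Qx; apply: mlocT => //.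
  have [a [b [Da Db Pb xab]]] := T_loc (or_introl CP) Tx.
  exists a, b; split=> //; split=> //; have b0 := localization_nz Pb.
  have -> : a = b * x by rewrite xab; field.
  by apply: spec_mul => //; exact: D_T.
suff : idmul P [set` T] `<=` Q by apply.
apply: idmul_sub; [exact: spec0|exact: specD|move=> z y [Dz Qz] Ty].
by rewrite mulrC; exact: spec_mul.
Qed.

Lemma ext_inv (S : set K) : invertible D S -> invertible T (idmul S [set` T]).
Proof.
move=> /invertibleE[J [sS sJ SJ SJ1]].
apply: (mk_invertible (J := idmul J [set` T])).
- exact: qT.
- exact: submod_T.
- exact: submod_T.
- move=> x y Sx Jy.
  have sub a : J a -> idmul S [set` T] `<=` [set z | z * a \in T].
    move=> Ja; apply: idmul_sub => /= [|z w hz hw|z w Sz Tw].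
    - by rewrite mul0r rpred0.
    - by rewrite mulrDl; exact: rpredD.
    - by rewrite mulrAC; apply: rpredM => //; apply: D_T; exact: SJ.
  have : idmul J [set` T] `<=` [set z | x * z \in T].
    apply: idmul_sub => /= [|z w hz hw|z w Jz Tw].
    - by rewrite mulr0 rpred0.
    - by rewrite mulrDr; exact: rpredD.
    - by rewrite mulrA; apply: rpredM => //; exact: (sub z Jz x Sx).
  by move=> /(_ y Jy).
- by move: SJ1; apply: idmulS => x; exact: sub_idmulT.
Qed.

Lemma ext_in_InvX I : in_InvX XT (idmul I [set` T]).
Proof. by split; [apply: ext_inv; exact: InvX_inv|move=> Q; exact: ext_supp]. Qed.

Definition ext_invx I : InvX XT := MkInvX (asboolT (ext_in_InvX I)).

Lemma ext_add I J : ext_invx (I + J) = ext_invx I + ext_invx J.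
Proof.
apply: val_inj => /=.
by rewrite -[RHS]idmulA idmul1 ?idmulA //; exact: submod_T.
Qed.

Fact ext_is_additive : zmod_morphism ext_invx.
Proof.
by move=> I J; apply/eqP; rewrite -(addrK (ext_invx J) (ext_invx (I - J))) -ext_add subrK.
Qed.
HB.instance Definition _ := GRing.isZmodMorphism.Build (InvX X) (InvX XT) ext_invx
  ext_is_additive.

Lemma ext_ker I : ext_invx I = 0 <-> vanish v C I.
Proof.
split=> [e P CP|IC].
  apply/v_zero; rewrite -(idmulT_loc I (or_introl CP)) -[idmul I _]/(val (ext_invx I)) e.
  rewrite /=; apply/seteqP; split.
    apply: idmul_sub; [exact: loc0|exact: locD|move=> x y Tx; apply: locM].
    by apply: T_loc Tx; left.
  by move=> x lx; rewrite -[x]mul1r; apply: idmul_prod => //=; exact: rpred1.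
apply: val_inj => /=; apply: bigcap_loc_trivial (InvX_inv I) _ => P [CP|nX].
  by apply/v_zero; exact: IC.
exact: InvX_out.
Qed.

(** Let I be generated over D by generators of J, so that IT = J. If P is outside X,
then the contraction of PD_P to T is a prime of T with localization D_P, and it is
not the extension of a member of X. So J is trivial there, and I is trivial
at P. *)
Lemma ext_surj (J : InvX XT) : exists I, ext_invx I = J.
Proof.
have [invJ suppJ] := invxP J.
have [s sJ Js] := invertible_fg invJ.
have JE : idmul (span D s) [set` T] = J.
  rewrite Js; apply/seteqP; split.
    apply: idmul_sub => [|x y|x y].
    - by case: (submod_span T s).
    - by case: (submod_span T s) => _ h _; exact: h.
    - move=> sx Ty; rewrite mulrC; have [_ _ h] := submod_span T s; apply: h => //.
      move: sx; suff : span D s `<=` span T s by apply.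
      apply: span_sub; first by apply: submodTD; exact: submod_span.
      by move=> z; exact: span_mem.
  apply: span_sub; first exact: submod_T.
  by move=> x xs; apply: sub_idmulT; exact: span_mem.
have invS : invertible D (span D s).
  apply: invertible_span => //.
  have [x Jx x0] := invertible_neq0 invJ; apply: contrapT => ns.
  have : span T s x by rewrite -Js.
  suff : span T s `<=` [set 0] by move=> /[apply] /eqP; rewrite (negPf x0).
  apply: span_sub; first by split=> //= [u w -> ->|a u _ ->]; rewrite ?addr0 ?mulr0.
  by move=> z zs; apply/eqP/negPn/negP => z0; apply: ns; exists z.
have SX : in_InvX X (span D s).
  split=> // P; apply: contraPP => nXP; apply.
  have CP : C P \/ ~ X P by right.
  pose Q := specT CP.
  have nQ : ~ XT Q.
    move=> [P' XP' QE]; apply: nXP; suff -> : P = P' by [].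
    apply: (max_sub (XMax XP')) => x P'x.
    have : spec_val Q x by rewrite QE; exact: sub_idmulT.
    by move=> [_]; apply: mloc_in; exact: spec_in P'x.
  have JQ : idmul J (loc Q) = loc Q by apply: supp_out => /suppJ.
  have QP : loc Q = loc P.
    apply/seteqP; split=> _ [a [b [Ta Tb Qb ->]]].
      apply: locM; first exact: T_loc Ta.
      by have [mb|[]//] := loc_dich (T_loc CP Tb); case: Qb.
    exists a, b; split; [exact: D_T|exact: D_T| |by []].
    by move=> [_ /(mloc_in Tb)].
  by rewrite -(idmulT_loc _ CP) JE -QP.
by exists (MkInvX (asboolT SX)); apply: val_inj.
Qed.

(** Let IT be radical with value n >= 1 at P. For some s outside P the element s p^n
is in I; then (s p)^n is in IT, so s p is in ID_P = p^n D_P and n = 1. Conversely,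
if some power of x in T is in IT and the values are 0 or 1, then x is in ID_P for
all P in C or outside X. Hence J x is contained in T for the inverse J of I, and
x is in IJx, which is contained in IT. *)
Lemma ext_radical I : radical_ideal T (ext_invx I) <-> forall P, C P -> v P I = 0 \/ v P I = 1.
Proof.
split=> [[[sIT IT] rad] P CP|I01].
  have up := unifP qD pD XMax discX (CX CP); have [Pp p0 _] := up.
  have hI := invx_valueP qD pD XMax discX I (CX CP).
  set p := unif P in up Pp p0 hI; set n := v P I in hI *.
  have n0 : 0 <= n.
    apply/v_nonneg => x Ix; apply: (T_loc (or_introl CP)).
    by apply: IT; exact: sub_idmulT.
  have [s [Ds Ps Isn]] := idmul_loc_den (InvX_submod I) (valued_exp up hI).
  have s0 := localization_nz Ps.
  case: n n0 hI Isn => // -[|n] _ hI Isn; first by left.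
  right; have : invx_val (ext_invx I) (s * p).
    apply: (rad _ n.+1).
      by apply: D_T; apply: rpredM => //; exact: spec_in Pp.
    rewrite exprMn exprSr -mulrA; case: sIT => _ _; apply.
      by apply: D_T; exact: rpredX.
    exact: sub_idmulT.
  move=> /(idmul_loc_sub P); rewrite [idmul _ _](idmulT_loc _ (or_introl CP)).
  move=> /hI h; have : loc P (p ^ (- n%:Z)).
    rewrite -invr_expz (_ : (p ^ n%:Z)^-1 = s^-1 * (s * p / p ^ n.+1)).
      by apply: locM => //; exact: loc_inv.
    rewrite -[p ^ n.+1]/(p ^+ n.+1) -[p ^ n%:Z]/(p ^+ n) exprS.
    have pn := expf_neq0 n p0; field; exact/and3P.
  by move=> /(loc_exp _ up); case: n {hI Isn h}.
have IT x : invx_val I x -> x \in T.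
  move=> Ix; apply/TP => P [CP|nX]; last first.
    by rewrite -(InvX_out I nX); exact: idmul_loc_sub.
  by apply: (v_nonneg P I).2 Ix; case: (I01 P CP) => ->.
split.
  split; first exact: submod_T.
  by apply: idmul_sub => /= [|x y|x y /IT]; [exact: rpred0|exact: rpredD|exact: rpredM].
move=> x n Tx Ixn.
have xloc P : C P \/ ~ X P -> idmul I (loc P) x.
  move=> CP; have lx := T_loc CP Tx.
  case: (CP) => [CP'|nX]; last by rewrite InvX_out.
  have [/v_zero -> //|v1] := I01 P CP'.
  have hI := invx_valueP qD pD XMax discX I (CX CP'); rewrite v1 in hI.
  have up := unifP qD pD XMax discX (CX CP'); have [Pp p0 pP] := up.
  apply/hI; rewrite expr1z; apply: pP.
  have mxn : mloc P (x ^+ n).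
    have : idmul I (loc P) (x ^+ n).
      by rewrite -(idmulT_loc _ CP); exact: idmul_loc_sub.
    move=> /hI; rewrite expr1z => h.
    by rewrite -(divfK p0 (x ^+ n)); apply: mlocM => //; exact: spec_mloc.
  have [//|[x0 lx1]] := loc_dich lx.
  case: (@mloc_inv _ _ P (x ^+ n)) => //; first exact: expf_neq0.
  by rewrite -exprVn; exact: locX.
have [J [sI sJ IJ IJ1]] := invertibleE (InvX_inv I).
have Jx y : J y -> y * x \in T.
  move=> Jy; apply/TP => P CP; move: (xloc P CP).
  suff : idmul I (loc P) `<=` [set z | loc P (y * z)] by apply.
  apply: idmul_sub => /= [|u w hu hw|u w Iu lw].
  - by rewrite mulr0; exact: loc0.
  - by rewrite mulrDr; exact: locD.
  - by rewrite mulrA; apply: locM => //; apply: loc_in; rewrite mulrC; exact: IJ.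
rewrite -[x]mul1r /=.
suff /(_ 1 IJ1) : idmul I J `<=` [set z | idmul I [set` T] (z * x)] by [].
apply: idmul_sub => /= [|u w hu hw|u w Iu Jw].
- by rewrite mul0r; exact: idmul0.
- by rewrite mulrDl; exact: idmulD.
- by rewrite -mulrA; apply: idmul_prod => //; exact: Jx.
Qed.

(** Combine [ext_surj] and [ext_radical]. A point outside C drops out on both sides,
since its extension to T is T. *)
Lemma crit_stepE : crit_step X C = critical_points v C.
Proof.
apply/seteqP; split=> P.
- move=> [XP [Q QE [_ _ ncrit]]].
  have CP : C P.
    apply: contrapT => nCP; have [g [g0 gP gC]] := clC.2 P XP nCP.
    have gT : idmul g [set` T] = [set` T] by have /ext_ker/(congr1 val) := gC.
    apply: (@spec_n1 _ _ Q); rewrite QE.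
    have : idmul g [set` T] 1 by rewrite gT; exact: rpred1.
    apply: idmulS => //.
    by move: gP; rewrite (nonneg_supp qD pD XMax discX P g0) => /asboolP.
  split=> // -[g g01 gP]; apply: ncrit; exists (ext_invx g); split; [|exact: invxP|].
    exact/ext_radical.
  move=> x gx; rewrite QE; apply: mlocT.
    by have [[_ h] _] := (ext_radical g).2 g01; exact: h.
  have hg := invx_valueP qD pD XMax discX g XP; rewrite gP in hg.
  have [Pp p0 _] := unifP qD pD XMax discX XP.
  move: (idmul_loc_sub P gx); rewrite [idmul _ _](idmulT_loc _ (or_introl CP)).
  move=> /hg; rewrite expr1z => h; rewrite -(divfK p0 x); apply: mlocM => //.
  exact: spec_mloc.
- move=> [CP nP]; split; first exact: CX.
  exists (specT (or_introl CP)); first exact: specT_ext.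
  split; first exact: specT_Max.
    by exists P; [exact: CX|exact: specT_ext].
  move=> [J0 [radJ JX JQ]]; pose J : InvX XT := MkInvX (asboolT JX).
  have [g gJ] := ext_surj J.
  have g01 : forall P, C P -> v P g = 0 \/ v P g = 1 by apply/ext_radical; rewrite gJ.
  apply: nP; exists g => //; case: (g01 P CP) => // /v_zero gP.
  have : idmul g (loc P) 1 by rewrite gP; exact: loc1.
  move=> /(idmul_loc_den (InvX_submod g))[s [Ds Ps]]; rewrite mulr1 => gs.
  have : invx_val (ext_invx g) s by exact: sub_idmulT.
  by rewrite gJ => /JQ [_ /(mloc_in Ds)].
Qed.
End Overring.

(** * The structure of Inv_X(D) *)

Theorem theorem6p8 (K : fieldType) (D : subringClosed K) (X : set (Spec D)) :
  is_quotient_field D -> prufer D ->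
  X `<=` Max D -> splitting_set X -> discrete_set X ->
  [/\ (* (a) *)
      forall (d : Order.disp_t) (W : orderType d)
        (wfW : well_founded (fun a b : W => (a < b)%O)) (gamma : W),
        exists (f : {additive sum_Cc wfW X gamma -> InvX X})
          (g : {additive InvX X -> InvX (ext_set X (T_ wfW X gamma))}),
          short_exact f g,
      (* (b) *)
      forall (d : Order.disp_t) (W : orderType d)
        (wfW : well_founded (fun a b : W => (a < b)%O)) (gamma : W),
        is_SP_rank wfW X gamma -> isomorphic (InvX X) (sum_Cc wfW X gamma)
    & (* (c) *)
      free_abelian (InvX X)].
Proof.
move=> qD pD XMax splX discX.
have vG := InvX_valued_group qD pD XMax splX discX.
have stE C (clC : closedX X (invx_value (X := X)) C) : crit_step X C = critical_points (invx_value (X := X)) C.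
  exact: crit_stepE.
have embed (d : Order.disp_t) (W : orderType d)
    (wfW : well_founded (fun a b : W => (a < b)%O)) (gamma : W) :
    exists f : {additive sum_Cc wfW X gamma -> InvX X},
      injective f /\ range f = vanish (invx_value (X := X)) (crit wfW X gamma).
  exact: (chain_dsum vG wfW stE (@crit_zero _ _ wfW _ _ X) (@crit_succ _ _ wfW _ _ X)
    (@crit_limit _ _ wfW _ _ X)).
split.
- move=> d W wfW gamma; have [f [fi fr]] := embed d W wfW gamma.
  have clC := closedX_Cr vG wfW stE (@crit_zero _ _ wfW _ _ X) (@crit_succ _ _ wfW _ _ X)
    (@crit_limit _ _ wfW _ _ X) gamma.
  pose g : {additive InvX X -> InvX (ext_set X (T_ wfW X gamma))} :=
    HB.pack (ext_invx qD pD XMax discX clC) (GRing.isZmodMorphism.Build _ _ _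
      (ext_is_additive qD pD XMax discX clC)).
  exists f, g; split=> //.
    by rewrite fr; apply/seteqP; split=> I hI; apply/(ext_ker qD pD XMax discX clC).
  by apply/seteqP; split=> // J _; have [I <-] := ext_surj qD pD XMax discX clC J; exists I.
- move=> d W wfW gamma [c0 _]; have [f [fi fr]] := embed d W wfW gamma.
  have [h fh hf] : bijective f.
    apply: inj_surj_bijective => // I.
    have : vanish (invx_value (X := X)) (crit wfW X gamma) I by rewrite c0.
    by rewrite -fr => -[x _ <-]; exists x.
  have h_add : zmod_morphism h by move=> I J; apply: fi; rewrite raddfB !hf.
  pose ha : {additive InvX X -> sum_Cc wfW X gamma} :=
    HB.pack h (GRing.isZmodMorphism.Build _ _ h h_add).
  by exists ha; exists f.
- have [d [W [q [wfW qi]]]] := wellordered_orderType (set (Spec D)).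
  have [[gamma c0]|nc] := pselect (exists gamma, crit wfW X gamma = set0).
    exact: (chain_free vG wfW stE (@crit_zero _ _ wfW _ _ X) (@crit_succ _ _ wfW _ _ X)
      (@crit_limit _ _ wfW _ _ X) c0).
  have [|p pi] := chain_injection vG wfW stE (@crit_zero _ _ wfW _ _ X)
      (@crit_succ _ _ wfW _ _ X) (@crit_limit _ _ wfW _ _ X).
    by move=> a; apply/set0P/eqP => a0; apply: nc; exists a.
  by case: (no_injection_set (inj_comp pi qi)).
Qed.
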